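(* Let $\kappa$ be a measurable cardinal and $\alpha$ an ordinal with $\omega\leq\alpha<\kappa^{++}$. Then each of the following implies the next: (1) $\kappa$ has the super $\alpha$-$\mathrm{GP}$; (2) $\kappa$ has the $\alpha$-$\mathrm{GP}$ via ultrafilters; (3) $\kappa$ has the $\alpha$-$\mathrm{GP}$; (4) $\kappa$ has the weak $\alpha$-$\mathrm{GP}$. Moreover, if $\alpha<\kappa^+$ then (1), (2), (3) are equivalent.
   Context: Let $\kappa$ be measurable and $\alpha\geq\omega$ an ordinal. $\kappa$ has the $\alpha$-$\mathrm{GP}$ if for every sequence $\langle U_\beta\mid\beta<\alpha\rangle$ of non-principal $\kappa$-complete ultrafilters on $\kappa$ there are a (definable) elementary embedding $j\colon V\to M$ with $\mathrm{crit}(j)=\kappa$ and $M^\kappa\subseteq M$, and a strictly increasing sequence of ordinals (''seeds'') $\langle\eta_\beta\mid\beta<\alpha\rangle$ with $U_\beta=\{X\subseteq\kappa\mid\eta_\beta\in j(X)\}$ for all $\beta<\alpha$. The super $\alpha$-$\mathrm{GP}$: as the $\alpha$-$\mathrm{GP}$ with, in addition, the seed sequence $\langle\eta_\beta\mid\beta<\alpha\rangle$ belonging to $M$. The $\alpha$-$\mathrm{GP}$ via ultrafilters: the $\alpha$-$\mathrm{GP}$ witnessed by ultrapower embeddings $j_W$ by $\kappa$-complete ultrafilters $W$ on $\kappa^{<\kappa}$. The weak $\alpha$-$\mathrm{GP}$: as the $\alpha$-$\mathrm{GP}$ but the seed sequence need not be increasing. *)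

(* Defs.v *)
(* The ambient universe of sets is an arbitrary first-order structure
   (V, mem) satisfying ZFC.  Equality of sets is Rocq's equality. *)
Record set_structure := SetStructure {
  dom :> Type;
  mem : dom -> dom -> Prop
}.

Arguments mem {_} _ _.

Notation "x ∈ y" := (mem x y) (at level 70, no associativity).

(** * Formulas of the language of set theory *)

(* De Bruijn variables: [FAll] binds variable 0. *)
Inductive formula : Type :=
| FMem : nat -> nat -> formula
| FEq  : nat -> nat -> formula
| FBot : formula
| FImp : formula -> formula -> formula
| FAll : formula -> formula.

Definition scons {A : Type} (x : A) (e : nat -> A) (n : nat) : A :=
  match n with O => x | S m => e m end.

(* Satisfaction in (D, mem), i.e. with quantifiers relativized to D. *)
Fixpoint sat {V : set_structure} (D : V -> Prop) (e : nat -> V) (p : formula)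
  : Prop :=
  match p with
  | FMem m n => e m ∈ e n
  | FEq m n => e m = e n
  | FBot => False
  | FImp q r => sat D e q -> sat D e r
  | FAll q => forall x : V, D x -> sat D (scons x e) q
  end.

Definition universe (V : set_structure) : V -> Prop := fun _ => True.

(* Definability over V is always with parameters, given by the environment. *)
Definition definable_class {V : set_structure} (M : V -> Prop) : Prop :=
  exists (p : formula) (e : nat -> V),
    forall x, M x <-> sat (universe V) (scons x e) p.

Definition definable_function {V : set_structure} (F : V -> V) : Prop :=
  exists (p : formula) (e : nat -> V),
    forall x y, F x = y <-> sat (universe V) (scons x (scons y e)) p.

(** * ZFC *)

Definition subset {V : set_structure} (a b : V) : Prop :=
  forall x, x ∈ a -> x ∈ b.

Definition is_empty {V : set_structure} (a : V) : Prop :=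
  forall x, ~ x ∈ a.

Definition is_succ {V : set_structure} (b a : V) : Prop :=
  forall x, x ∈ b <-> x ∈ a \/ x = a.

Record ZFC (V : set_structure) : Prop := {
  zfc_extensionality : forall a b : V, (forall x, x ∈ a <-> x ∈ b) -> a = b;
  zfc_foundation : forall a : V, (exists x, x ∈ a) ->
    exists x, x ∈ a /\ forall y, y ∈ x -> ~ y ∈ a;
  zfc_pairing : forall a b : V, exists c, forall x, x ∈ c <-> x = a \/ x = b;
  zfc_union : forall a : V, exists b,
    forall x, x ∈ b <-> exists y, y ∈ a /\ x ∈ y;
  zfc_powerset : forall a : V, exists b, forall x, x ∈ b <-> subset x a;
  zfc_infinity : exists a : V,
    (exists x, is_empty x /\ x ∈ a) /\
    (forall x, x ∈ a -> exists y, is_succ y x /\ y ∈ a);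
  zfc_separation : forall (p : formula) (e : nat -> V) (a : V), exists b,
    forall x, x ∈ b <-> x ∈ a /\ sat (universe V) (scons x e) p;
  zfc_replacement : forall (p : formula) (e : nat -> V) (a : V),
    (forall x, x ∈ a ->
       exists! y, sat (universe V) (scons x (scons y e)) p) ->
    exists b, forall y, y ∈ b <->
      exists x, x ∈ a /\ sat (universe V) (scons x (scons y e)) p;
  zfc_choice : forall a : V,
    (forall x, x ∈ a -> exists y, y ∈ x) ->
    (forall x y z, x ∈ a -> y ∈ a -> z ∈ x -> z ∈ y -> x = y) ->
    exists c, forall x, x ∈ a -> exists! y, y ∈ c /\ y ∈ x
}.

(** * Functions *)

Definition is_upair {V : set_structure} (p x y : V) : Prop :=
  forall z, z ∈ p <-> z = x \/ z = y.

(* p = {{x}, {x, y}} *)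
Definition is_opair {V : set_structure} (p x y : V) : Prop :=
  exists u v, is_upair u x x /\ is_upair v x y /\ is_upair p u v.

Definition maps {V : set_structure} (f x y : V) : Prop :=
  exists p, is_opair p x y /\ p ∈ f.

Definition function_on {V : set_structure} (f a : V) : Prop :=
  (forall p, p ∈ f -> exists x y, x ∈ a /\ is_opair p x y) /\
  (forall x, x ∈ a -> exists! y, maps f x y).

Definition function_into {V : set_structure} (f a b : V) : Prop :=
  function_on f a /\ (forall x y, maps f x y -> y ∈ b).

Definition bijection {V : set_structure} (f a b : V) : Prop :=
  function_into f a b /\ (forall y, y ∈ b -> exists! x, maps f x y).

(** * Ordinals and cardinals *)

Definition transitive_set {V : set_structure} (a : V) : Prop :=
  forall x, x ∈ a -> subset x a.

(* Well-foundedness of membership on a is given by Foundation. *)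
Definition ordinal {V : set_structure} (a : V) : Prop :=
  transitive_set a /\
  (forall x y, x ∈ a -> y ∈ a -> x ∈ y \/ x = y \/ y ∈ x).

Definition ord_le {V : set_structure} (a b : V) : Prop := a ∈ b \/ a = b.

Definition limit_ordinal {V : set_structure} (a : V) : Prop :=
  ordinal a /\ (exists x, x ∈ a) /\
  (forall x, x ∈ a -> exists y, y ∈ a /\ x ∈ y).

Definition is_omega {V : set_structure} (w : V) : Prop :=
  limit_ordinal w /\ (forall x, x ∈ w -> ~ limit_ordinal x).

Definition cardinal {V : set_structure} (k : V) : Prop :=
  ordinal k /\ (forall a f, a ∈ k -> ~ bijection f a k).

Definition is_card_succ {V : set_structure} (kp k : V) : Prop :=
  cardinal kp /\ k ∈ kp /\
  (forall c, cardinal c -> k ∈ c -> ord_le kp c).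

(* s is the set of all functions from some g < k into k. *)
Definition is_lt_power {V : set_structure} (s k : V) : Prop :=
  forall t, t ∈ s <-> exists g, g ∈ k /\ function_into t g k.

(** * Ultrafilters *)

Record ultrafilter {V : set_structure} (A U : V) : Prop := {
  uf_subset : forall X, X ∈ U -> subset X A;
  uf_full : A ∈ U;
  uf_nonempty : forall X, X ∈ U -> ~ is_empty X;
  uf_upward : forall X Y, X ∈ U -> subset X Y -> subset Y A -> Y ∈ U;
  uf_inter : forall X Y Z, X ∈ U -> Y ∈ U ->
    (forall x, x ∈ Z <-> x ∈ X /\ x ∈ Y) -> Z ∈ U;
  uf_ultra : forall X Y, subset X A ->
    (forall x, x ∈ Y <-> x ∈ A /\ ~ x ∈ X) -> X ∈ U \/ Y ∈ U
}.

(* U is closed under intersections of families indexed by an ordinal g < k. *)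
Definition complete {V : set_structure} (k A U : V) : Prop :=
  forall g F Z, g ∈ k -> function_into F g U ->
    (forall x, x ∈ Z <->
       x ∈ A /\ (forall b X, maps F b X -> x ∈ X)) ->
    Z ∈ U.

Definition complete_ultrafilter {V : set_structure} (k A U : V) : Prop :=
  ultrafilter A U /\ complete k A U.

Definition principal {V : set_structure} (A U : V) : Prop :=
  exists a, a ∈ A /\ (forall X, X ∈ U <-> subset X A /\ a ∈ X).

Definition measurable {V : set_structure} (k : V) : Prop :=
  cardinal k /\ (exists w, is_omega w /\ w ∈ k) /\
  (exists U, complete_ultrafilter k k U /\ ~ principal k U).

(** * Elementary embeddings *)

(* M is a transitive class and j : V -> M is elementary; both are definable. *)
Record elementary_embedding {V : set_structure} (M : V -> Prop) (j : V -> V)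
  : Prop := {
  ee_definable_class : definable_class M;
  ee_definable_map : definable_function j;
  ee_transitive : forall x y, M x -> y ∈ x -> M y;
  ee_into : forall x, M (j x);
  ee_elementary : forall (p : formula) (e : nat -> V),
    sat (universe V) e p <-> sat M (fun n => j (e n)) p
}.

Definition critical_point {V : set_structure} (j : V -> V) (k : V) : Prop :=
  ordinal k /\ j k <> k /\ (forall a, a ∈ k -> j a = a).

Definition closed_under_seqs {V : set_structure} (M : V -> Prop) (k : V)
  : Prop :=
  forall f, function_on f k -> (forall x y, maps f x y -> M y) -> M f.

Definition is_const {V : set_structure} (c S a : V) : Prop :=
  function_on c S /\ (forall x y, maps c x y -> y = a).

(* M is the transitive collapse of Ult(V, W), W an ultrafilter on S, and j is
   the canonical embedding; [cls f] is the collapse of the class of f. *)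
Definition ultrapower_embedding {V : set_structure} (S W : V)
  (M : V -> Prop) (j : V -> V) : Prop :=
  (forall x y, M x -> y ∈ x -> M y) /\
  exists cls : V -> V,
    definable_function cls /\
    (forall y, M y <-> exists f, function_on f S /\ cls f = y) /\
    (forall f g, function_on f S -> function_on g S ->
       (cls f = cls g <->
        exists X, X ∈ W /\
          forall i, i ∈ X <->
            i ∈ S /\ exists x, maps f i x /\ maps g i x)) /\
    (forall f g, function_on f S -> function_on g S ->
       (cls f ∈ cls g <->
        exists X, X ∈ W /\
          forall i, i ∈ X <->
            i ∈ S /\ exists x y, maps f i x /\ maps g i y /\ x ∈ y)) /\
    (forall a c, is_const c S a -> j a = cls c).

(** * Gluing properties *)

Definition ultrafilter_seq {V : set_structure} (k a U : V) : Prop :=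
  function_on U a /\
  (forall b Ub, maps U b Ub ->
     complete_ultrafilter k k Ub /\ ~ principal k Ub).

Definition suitable_embedding {V : set_structure} (k : V) (M : V -> Prop)
  (j : V -> V) : Prop :=
  elementary_embedding M j /\ critical_point j k /\ closed_under_seqs M k.

(* eta is a sequence of ordinals of length a such that, for all b < a,
   U_b = {X subset of k | eta_b in j(X)}. *)
Definition seeds {V : set_structure} (k a U : V) (j : V -> V) (eta : V)
  : Prop :=
  function_on eta a /\
  (forall b s, maps eta b s -> ordinal s) /\
  (forall b Ub s, maps U b Ub -> maps eta b s ->
     forall X, X ∈ Ub <-> subset X k /\ s ∈ j X).

Definition strictly_increasing {V : set_structure} (eta : V) : Prop :=
  forall b c s t, maps eta b s -> maps eta c t -> b ∈ c -> s ∈ t.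

Definition weak_GP {V : set_structure} (k a : V) : Prop :=
  forall U, ultrafilter_seq k a U ->
    exists (M : V -> Prop) (j : V -> V) (eta : V),
      suitable_embedding k M j /\ seeds k a U j eta.

Definition GP {V : set_structure} (k a : V) : Prop :=
  forall U, ultrafilter_seq k a U ->
    exists (M : V -> Prop) (j : V -> V) (eta : V),
      suitable_embedding k M j /\ seeds k a U j eta /\
      strictly_increasing eta.

Definition super_GP {V : set_structure} (k a : V) : Prop :=
  forall U, ultrafilter_seq k a U ->
    exists (M : V -> Prop) (j : V -> V) (eta : V),
      suitable_embedding k M j /\ seeds k a U j eta /\
      strictly_increasing eta /\ M eta.

Definition GP_via_ultrafilters {V : set_structure} (k a : V) : Prop :=
  forall U, ultrafilter_seq k a U ->
    exists (M : V -> Prop) (j : V -> V) (eta : V),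
      suitable_embedding k M j /\ seeds k a U j eta /\
      strictly_increasing eta /\
      exists S W, is_lt_power S k /\ complete_ultrafilter k S W /\
        ultrapower_embedding S W M j.

(* Main.v *)
From Stdlib Require Import Classical ClassicalEpsilon Arith.
Require Import Defs.

(* The interesting implication is (1) => (2). Let l be the largest limit ordinal <= a.
   Since a < k++, there are pairwise distinct subsets A_b of k for b < a, and a subset A
   of k is coded by a measure: enumerate the bounded subsets of k in order type at most k
   by E and push a measure on k forward along x |-> E^-1((A ∩ x) ∪ {x}). The super GP is
   applied not to the given sequence U but to the sequence that, below l, carries U_b at
   the successor position b + 1 and the code of A_b at each non-successor b. For the
   resulting j : V -> M and seeds eta in M, the set A_b is recovered in M as
   {i < k | i ∈ j(E)(eta_b)}. Hence M sees the non-successors below l inject into P(k), and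
   as j(k) is a strong limit in M, a < j(k). So s := eta together with k is an element of
   j(k^{<k}); let H be the class of all j(f)(s) and W the measure derived from s. Then H is
   elementary in M, its transitive collapse is the ultrapower by W, and every b < a is in H,
   because non-successors are definable from j(A_b), k, s and j(E). The collapses of the
   seeds for U therefore lie in the ultrapower.

   Separation and Replacement are schemas over formulas, so every class or operation they
   are applied to has to be shown definable. *)

(* The seed eta_b can be read off s only at an index that lies in H, and for a of size k^+ closure
   under k-sequences does not supply the indices. This is why each index is made definable from a
   subset of k. The codes need positions of their own: moving U_b from b to b + 1 below l keeps the
   order, stays below l and frees exactly the non-successors. No further codes are required, since l
   is definable from the length of s and every other index is reached by successor steps. The strong
   limit property is phrased for non-successors because only those carry codes; a measure argument
   proves it directly, without cardinal arithmetic. That P(k) has enough elements is Cantor's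
   theorem together with a < k^{++}. Appending k to the seeds has two effects: k becomes an element
   of H, so that the collapse fixes k and its target is closed under k-sequences, and j(A_b) can be
   cut down to A_b inside M. For a < k^+ the implication from (3) back to (1) comes from closure:
   re-indexed by k, the seed sequence is a k-sequence of elements of M. *)
Existing Class ZFC.

(** * Renaming of variables, and the even/odd layout of environments *)

Fixpoint rename (r : nat -> nat) (p : formula) : formula :=
  match p with
  | FMem m n => FMem (r m) (r n)
  | FEq m n => FEq (r m) (r n)
  | FBot => FBot
  | FImp p q => FImp (rename r p) (rename r q)
  | FAll p => FAll (rename (fun n => match n with O => O | S m => S (r m) end) p)
  end.

Lemma sat_ext {V : set_structure} (D : V -> Prop) p :
  forall e e', (forall n, e n = e' n) -> (sat D e p <-> sat D e' p).
Proof.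
  induction p as [m n|m n| |p IHp q IHq|p IHp]; intros e e' E; simpl.
  - now rewrite !E.
  - now rewrite !E.
  - tauto.
  - now rewrite (IHp _ _ E), (IHq _ _ E).
  - split; intros H x Dx; apply (IHp (scons x e) (scons x e')); auto;
      intros [|n]; simpl; auto.
Qed.

Lemma sat_rename {V : set_structure} (D : V -> Prop) p :
  forall r e, sat D e (rename r p) <-> sat D (fun n => e (r n)) p.
Proof.
  induction p as [m n|m n| |p IHp q IHq|p IHp]; intros r e; simpl; try tauto.
  - now rewrite IHp, IHq.
  - split; intros H x Dx; specialize (H x Dx).
    + apply IHp in H. revert H. apply sat_ext. intros [|n]; reflexivity.
    + apply IHp. revert H. apply sat_ext. intros [|n]; reflexivity.
Qed.

Definition nat_split (n : nat) : nat + nat :=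
  if Nat.even n then inl (Nat.div2 n) else inr (Nat.div2 n).

Definition nat_join (x : nat + nat) : nat :=
  match x with inl m => 2 * m | inr m => S (2 * m) end.

Arguments nat_join : simpl never.
Arguments nat_split : simpl never.

Lemma nat_splitK x : nat_split (nat_join x) = x.
Proof.
  destruct x as [m|m]; unfold nat_split, nat_join.
  - now rewrite Nat.even_even, Nat.div2_double.
  - now rewrite <- Nat.add_1_r, Nat.even_odd, Nat.add_1_r, Nat.div2_succ_double.
Qed.

Definition case_env {A : Type} (e c : nat -> A) (x : nat + nat) : A :=
  match x with inl m => e m | inr m => c m end.

(** * Definability with parameters *)

Section Definability.
Context {V : set_structure}.
Implicit Types (e : nat -> V) (P Q : (nat -> V) -> Prop) (t u : (nat -> V) -> V).

(* Variables occur as [e n]; the parameters sit at the odd places of the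
   environment, so that any two definitions can be merged. *)
Definition definable P : Prop :=
  exists (p : formula) (c : nat -> V),
    forall e, P e <-> sat (universe V) (fun n => case_env e c (nat_split n)) p.

Definition definable_term t : Prop :=
  definable (fun e => e 0 = t (fun n => e (S n))).

(** Variables and parameters may be laid out in any way [g]; renaming the formula restores the
    even/odd layout that [definable] demands. *)
Lemma definable_intro P (p : formula) (g : nat -> nat + nat) (c : nat -> V) :
  (forall e, P e <-> sat (universe V) (fun n => case_env e c (g n)) p) ->
  definable P.
Proof.
  intros H. exists (rename (fun n => nat_join (g n)) p), c. intros e.
  rewrite H, sat_rename. apply sat_ext. intros n. now rewrite nat_splitK.
Qed.

Lemma definable_ext P Q : (forall e, P e <-> Q e) -> definable P -> definable Q.
Proof.
  intros H (p & c & Hp). exists p, c. intros e. now rewrite <- H.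
Qed.

Lemma definable_subst P (r : nat -> nat) :
  definable P -> definable (fun e => P (fun n => e (r n))).
Proof.
  intros (p & c & Hp).
  apply (definable_intro _ p
    (fun n => match nat_split n with inl m => inl (r m) | inr m => inr m end) c).
  intros e. rewrite Hp. apply sat_ext. intros n.
  now destruct (nat_split n).
Qed.

Lemma definable_imp P Q :
  definable P -> definable Q -> definable (fun e => P e -> Q e).
Proof.
  intros (p & c & Hp) (q & d & Hq).
  (* The two formulas bring separate parameter lists [c] and [d]. These are interleaved once more
     inside the odd places, while the variables stay where they are. *)
  pose (merge := fun (f : nat -> nat + nat) n =>
     match nat_split n with
     | inl m => nat_join (inl m)
     | inr m => nat_join (inr (nat_join (f m)))
     end).
  exists (FImp (rename (merge inl) p) (rename (merge inr) q)),
    (fun n => case_env c d (nat_split n)).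
  intros e. simpl. rewrite !sat_rename, Hp, Hq.
  assert (E1 : forall n, case_env e c (nat_split n) =
    case_env e (fun m => case_env c d (nat_split m)) (nat_split (merge inl n))).
  { intros n. unfold merge. destruct (nat_split n); rewrite nat_splitK; simpl; auto.
    now rewrite nat_splitK. }
  assert (E2 : forall n, case_env e d (nat_split n) =
    case_env e (fun m => case_env c d (nat_split m)) (nat_split (merge inr n))).
  { intros n. unfold merge. destruct (nat_split n); rewrite nat_splitK; simpl; auto.
    now rewrite nat_splitK. }
  rewrite (sat_ext _ p _ _ E1), (sat_ext _ q _ _ E2). tauto.
Qed.

Lemma definable_all (Q : (nat -> V) -> V -> Prop) :
  definable (fun e => Q (fun n => e (S n)) (e 0)) ->
  definable (fun e => forall x : V, Q e x).
Proof.
  intros (q & c & Hq).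
  (* Variable 0 of [q] becomes the bound variable. The remaining variables move down by one among
     the even places, and every place of the outer environment is raised by one under the binder. *)
  pose (r := fun n => match nat_split n with
     | inl O => O | inl (S m) => S (nat_join (inl m)) | inr m => S (nat_join (inr m)) end).
  exists (FAll (rename r q)), c. intros e. simpl.
  assert (E : forall x, Q e x <->
     sat (universe V) (scons x (fun n => case_env e c (nat_split n))) (rename r q)).
  { intros x. rewrite sat_rename.
    specialize (Hq (scons x e)). simpl in Hq.
    change (fun n => e n) with e in Hq. rewrite Hq.
    apply sat_ext. intros n. unfold r.
    destruct (nat_split n) as [[|m]|m]; cbn [scons case_env]; rewrite ?nat_splitK; reflexivity. }
  split; intros H x; [intros _|]; apply E; auto. apply H. exact I.
Qed.


Context {hV : ZFC V}.

Lemma universe_inhabited : inhabited V.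
Proof.
  destruct (zfc_infinity V hV) as [a _]. exact (inhabits a).
Qed.

(** A proposition that does not mention the environment is either true or false, so one of two
    constant formulas defines it. Side conditions of the metatheory may therefore occur inside
    definable predicates. *)
Lemma definable_prop (A : Prop) : definable (fun _ => A).
Proof.
  destruct universe_inhabited as [v]. destruct (classic A).
  - exists (FImp FBot FBot), (fun _ => v). simpl; tauto.
  - exists FBot, (fun _ => v). simpl; tauto.
Qed.

Lemma definable_not P : definable P -> definable (fun e => ~ P e).
Proof. intros H. apply definable_imp; auto using definable_prop. Qed.

Lemma definable_and P Q :
  definable P -> definable Q -> definable (fun e => P e /\ Q e).
Proof.
  intros HP HQ. apply (definable_ext (fun e => ~ (P e -> ~ Q e))).
  - intros e. tauto.
  - auto using definable_not, definable_imp.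
Qed.

Lemma definable_or P Q :
  definable P -> definable Q -> definable (fun e => P e \/ Q e).
Proof.
  intros HP HQ. apply (definable_ext (fun e => ~ P e -> Q e)).
  - intros e. tauto.
  - auto using definable_not, definable_imp.
Qed.

Lemma definable_ex (Q : (nat -> V) -> V -> Prop) :
  definable (fun e => Q (fun n => e (S n)) (e 0)) ->
  definable (fun e => exists x : V, Q e x).
Proof.
  intros H. apply (definable_ext (fun e => ~ forall x, ~ Q e x)).
  - intros e. split.
    + intros N. apply NNPP. firstorder.
    + firstorder.
  - apply definable_not, definable_all, definable_not, H.
Qed.

Lemma definable_var_mem m n : definable (fun e => e m ∈ e n).
Proof.
  destruct universe_inhabited as [v].
  apply (definable_intro _ (FMem m n) inl (fun _ => v)). simpl; tauto.
Qed.

Lemma definable_var_eq m n : definable (fun e => e m = e n).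
Proof.
  destruct universe_inhabited as [v].
  apply (definable_intro _ (FEq m n) inl (fun _ => v)). simpl; tauto.
Qed.

Lemma definable_term_var n : definable_term (fun e => e n).
Proof. apply (definable_var_eq 0 (S n)). Qed.

Lemma definable_term_const c : definable_term (fun _ => c).
Proof.
  apply (definable_intro _ (FEq 0 1)
    (fun n => match n with O => inl 0 | _ => inr 0 end) (fun _ => c)).
  simpl; tauto.
Qed.

(** The language has no function symbols: a term is eliminated by naming its value with an
    existential quantifier. *)
Lemma definable_comp1 (R : V -> Prop) t :
  definable (fun e => R (e 0)) -> definable_term t -> definable (fun e => R (t e)).
Proof.
  intros HR Ht.
  apply (definable_ext (fun e => exists x, x = t e /\ R x)).
  - intros e. split; [intros (x & -> & H)|]; eauto.
  - apply definable_ex, definable_and; [exact Ht|exact HR].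
Qed.

Lemma definable_comp2 (R : V -> V -> Prop) t u :
  definable (fun e => R (e 0) (e 1)) -> definable_term t -> definable_term u ->
  definable (fun e => R (t e) (u e)).
Proof.
  intros HR Ht Hu.
  apply (definable_ext (fun e => exists x, x = t e /\ exists y, y = u e /\ R x y)).
  - intros e. split; [intros (x & -> & y & -> & H)|]; eauto 6.
  - apply definable_ex, definable_and; [exact Ht|].
    apply definable_ex, definable_and.
    + exact (definable_subst _ (fun n => match n with O => O | S m => S (S m) end) Hu).
    + exact (definable_subst _ (fun n => match n with O => 1 | S O => 0 | n => n end) HR).
Qed.

Lemma definable_mem t u :
  definable_term t -> definable_term u -> definable (fun e => t e ∈ u e).
Proof. apply definable_comp2, definable_var_mem. Qed.

Lemma definable_eq t u :
  definable_term t -> definable_term u -> definable (fun e => t e = u e).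
Proof. apply (definable_comp2 eq), definable_var_eq. Qed.

Lemma definable_term_comp1 (F : V -> V) t :
  definable_term (fun e => F (e 0)) -> definable_term t ->
  definable_term (fun e => F (t e)).
Proof.
  intros HF Ht. apply (definable_comp2 (fun y x => y = F x)).
  - exact HF.
  - apply definable_term_var.
  - exact (definable_subst _ (fun n => match n with O => O | S m => S (S m) end) Ht).
Qed.

Lemma definable_term_comp2 (F : V -> V -> V) t u :
  definable_term (fun e => F (e 0) (e 1)) -> definable_term t -> definable_term u ->
  definable_term (fun e => F (t e) (u e)).
Proof.
  intros HF Ht Hu.
  apply (definable_ext (fun e => exists x, x = t (fun n => e (S n)) /\
     e 0 = F x (u (fun n => e (S n))))).
  - intros e. split; [intros (x & -> & H)|]; eauto.
  - apply definable_ex, definable_and.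
    + exact (definable_subst _ (fun n => match n with O => O | S m => S (S m) end) Ht).
    + apply (definable_ext (fun e => exists y, y = u (fun n => e (S (S n))) /\
        e 1 = F (e 0) y)).
      * intros e. split; [intros (x & -> & H)|]; eauto.
      * apply definable_ex, definable_and.
        -- exact (definable_subst _ (fun n => match n with O => O | S m => S (S (S m)) end) Hu).
        -- exact (definable_subst _
             (fun n => match n with O => 2 | S O => 1 | S (S O) => 0 | n => n end) HF).
Qed.

(** The induction is on a formula fixed outside the theory, so no truth predicate for V is involved.
    This makes the truth sets in Łoś's theorem instances of Separation. *)
Lemma definable_sat p : forall t : nat -> (nat -> V) -> V,
  (forall n, definable_term (t n)) ->
  definable (fun e => sat (universe V) (fun n => t n e) p).
Proof.
  induction p as [m n|m n| |p IHp q IHq|p IHp]; intros t Ht; simpl.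
  - apply definable_mem; auto.
  - apply definable_eq; auto.
  - apply definable_prop.
  - apply definable_imp; auto.
  - apply definable_all. apply definable_imp; [exact (definable_prop True)|].
    pose (t' := fun n e => match n with O => e 0 | S m => t m (fun k => e (S k)) end).
    apply (definable_ext (fun e => sat (universe V) (fun n => t' n e) p)).
    + intros e. apply sat_ext. intros [|n]; reflexivity.
    + apply IHp. intros [|n].
      * apply definable_term_var.
      * exact (definable_subst _ (fun n => match n with O => O | S m => S (S m) end) (Ht n)).
Qed.

(** * Class comprehension *)

(* The empty set when the class is proper, so that [set_of] preserves definability. *)
Definition set_of (P : V -> Prop) : V :=
  epsilon universe_inhabited (fun b =>
    (forall x, x ∈ b <-> P x) \/
    ((~ exists b', forall x, x ∈ b' <-> P x) /\ is_empty b)).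

Lemma set_extensionality (a b : V) : (forall x, x ∈ a <-> x ∈ b) -> a = b.
Proof. apply (zfc_extensionality V hV). Qed.

Lemma definable_separation (P : V -> Prop) (a : V) :
  definable (fun e => P (e 0)) -> exists b, forall x, x ∈ b <-> x ∈ a /\ P x.
Proof.
  intros (p & c & Hp).
  destruct (zfc_separation V hV (rename (fun n => match nat_split n with
     inl _ => O | inr m => S m end) p) c a) as [b Hb].
  exists b. intros x. rewrite Hb, sat_rename, (Hp (fun _ => x)).
  apply and_iff_compat_l, sat_ext. intros n. now destruct (nat_split n).
Qed.

Lemma definable_replacement (R : V -> V -> Prop) (a : V) :
  definable (fun e => R (e 0) (e 1)) ->
  (forall x, x ∈ a -> exists! y, R x y) ->
  exists b, forall y, y ∈ b <-> exists x, x ∈ a /\ R x y.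
Proof.
  intros (p & c & Hp) HR.
  pose (q := rename (fun n => match nat_split n with
     inl O => O | inl _ => 1 | inr m => S (S m) end) p).
  assert (E : forall x y, R x y <-> sat (universe V) (scons x (scons y c)) q).
  { intros x y. unfold q. rewrite sat_rename, (Hp (scons x (fun _ => y))).
    apply sat_ext. intros n. now destruct (nat_split n) as [[|m]|m]. }
  destruct (zfc_replacement V hV q c a) as [b Hb].
  - intros x Hx. destruct (HR x Hx) as (y & Hy & Uy). exists y. split.
    + now apply E.
    + intros y' Hy'. apply Uy. now apply E.
  - exists b. intros y. rewrite Hb. split; intros (x & Hx & H); exists x; split; auto;
      now apply E.
Qed.

Lemma empty_exists : exists b : V, is_empty b.
Proof.
  destruct universe_inhabited as [v].
  destruct (definable_separation (fun _ => False) v) as [b Hb].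
  - apply definable_prop.
  - exists b. intros x Hx. now apply Hb in Hx.
Qed.

(** The graph of [set_of] is described by a first-order condition that also covers proper classes.
    Definability of every operation built from [set_of] rests on it. *)
Lemma set_of_eq (P : V -> Prop) (b : V) : b = set_of P <->
  (forall x, x ∈ b <-> P x) \/
    ((~ exists b', forall x, x ∈ b' <-> P x) /\ is_empty b).
Proof.
  assert (S : (forall x, x ∈ set_of P <-> P x) \/
    ((~ exists b', forall x, x ∈ b' <-> P x) /\ is_empty (set_of P))).
  { apply (epsilon_spec universe_inhabited (fun b => (forall x, x ∈ b <-> P x) \/
      ((~ exists b', forall x, x ∈ b' <-> P x) /\ is_empty b))).
    destruct (classic (exists b', forall x, x ∈ b' <-> P x)) as [[b' Hb]|N].
    - eauto.
    - destruct empty_exists as [o Ho]. eauto. }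
  split; [now intros ->|].
  intros H. apply set_extensionality. intros x. unfold is_empty in *.
  destruct S as [S|[N S]], H as [H|[N' H]].
  - now rewrite S, H.
  - destruct N'; eauto.
  - destruct N; eauto.
  - specialize (S x). specialize (H x). tauto.
Qed.

Lemma set_ofE (P : V -> Prop) :
  (exists b, forall x, x ∈ b <-> P x) -> forall x, x ∈ set_of P <-> P x.
Proof.
  intros H. destruct (proj1 (set_of_eq P (set_of P)) eq_refl) as [S|[N _]]; tauto.
Qed.

Lemma set_of_subE (P : V -> Prop) (a : V) : (forall x, P x -> x ∈ a) ->
  definable (fun e => P (e 0)) -> forall x, x ∈ set_of P <-> P x.
Proof.
  intros Ha HP. apply set_ofE.
  destruct (definable_separation P a HP) as [b Hb]. exists b. intros x.
  rewrite Hb. split; [tauto|auto].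
Qed.

Lemma set_of_ext (P Q : V -> Prop) : (forall x, P x <-> Q x) -> set_of P = set_of Q.
Proof.
  intros H. apply set_of_eq.
  destruct (proj1 (set_of_eq P (set_of P)) eq_refl) as [S|[N S]].
  - left. intros x. now rewrite S.
  - right. split; auto. intros (b & Hb). apply N. exists b. intros x. now rewrite Hb, H.
Qed.

Lemma definable_term_set_of (P : (nat -> V) -> V -> Prop) :
  definable (fun e => P (fun n => e (S n)) (e 0)) ->
  definable_term (fun e => set_of (P e)).
Proof.
  intros H. eapply definable_ext; [intros e; symmetry; apply set_of_eq|].
  assert (H' : definable (fun e => P (fun n => e (S (S n))) (e 0))).
  { exact (definable_subst _ (fun n => match n with O => O | S m => S (S m) end) H). }
  assert (M : definable (fun e => e 0 ∈ e 1)) by apply definable_var_mem.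
  apply definable_or.
  - apply definable_all, definable_and; apply definable_imp; auto.
  - apply definable_and.
    + apply definable_not, definable_ex, definable_all.
      assert (H'' : definable (fun e => P (fun n => e (S (S (S n)))) (e 0))).
      { exact (definable_subst _ (fun n => match n with O => O | S m => S (S (S m)) end) H). }
      apply definable_and; apply definable_imp; auto.
    + apply definable_all, definable_not, M.
Qed.

End Definability.

(* Automation of definability proofs *)
Create HintDb defs.
Create HintDb set_unfold.

Ltac definability_comp :=
  match goal with
  | |- definable (fun e => ?R (@?t e) (@?u e)) =>
      apply (definable_comp2 R t u); [solve [auto with defs]| |]
  | |- definable (fun e => ?R (@?t e)) =>
      apply (definable_comp1 R t); [solve [auto with defs]|]
  | |- definable_term (fun e => ?F (@?t e) (@?u e)) =>
      apply (definable_term_comp2 F t u); [solve [auto with defs]| |]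
  | |- definable_term (fun e => ?F (@?t e)) =>
      apply (definable_term_comp1 F t); [solve [auto with defs]|]
  end.

Ltac definability_step :=
  cbv beta; unfold iff, not, unique;
  lazymatch goal with
  | |- definable (fun e => @?P e /\ @?Q e) => apply (definable_and P Q)
  | |- definable (fun e => @?P e \/ @?Q e) => apply (definable_or P Q)
  | |- definable (fun e => @?P e -> @?Q e) => apply (definable_imp P Q)
  | |- definable (fun e => forall x : _, @?Q e x) => apply (definable_all Q)
  | |- definable (fun e => exists x : _, @?Q e x) => apply (definable_ex Q)
  | |- definable (fun e => @?t e ∈ @?u e) => apply (definable_mem t u)
  | |- definable (fun e => @?t e = @?u e) => apply (definable_eq t u)
  | |- definable (fun _ => ?A) => apply (definable_prop A)
  | |- definable_term (fun e => e ?n) => apply (definable_term_var n)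
  | |- definable_term (fun _ => ?c) => apply (definable_term_const c)
  | |- definable_term (fun e => set_of (@?P e)) => apply (definable_term_set_of P)
  | _ => definability_comp
  end.

Ltac definability :=
  solve [autounfold with set_unfold; repeat definability_step].

#[export] Hint Unfold subset is_empty is_succ is_upair is_opair maps function_on
  function_into bijection transitive_set ordinal ord_le limit_ordinal is_omega
  cardinal is_card_succ is_lt_power is_const : set_unfold.

(** * Elementary set theory *)

Section SetTheory.
Context {V : set_structure} {hV : ZFC V}.
Implicit Types (a b c f g p x y z : V).

Definition upair x y : V := set_of (fun z => z = x \/ z = y).
Definition opair x y : V := upair (upair x x) (upair x y).
Definition union a : V := set_of (fun x => exists y, y ∈ a /\ x ∈ y).
Definition cup a b : V := union (upair a b).
Definition succ x : V := cup x (upair x x).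
Definition power a : V := set_of (fun x => subset x a).
Definition sep a (P : V -> Prop) : V := set_of (fun x => x ∈ a /\ P x).
Definition image a (F : V -> V) : V := set_of (fun y => exists x, x ∈ a /\ y = F x).
Definition graph a (F : V -> V) : V :=
  set_of (fun p => exists x, x ∈ a /\ p = opair x (F x)).
(* The union of the values of the relation f at x, hence f(x) for a function f. *)
Definition app f x : V := set_of (fun z => exists y, maps f x y /\ z ∈ y).
(* The y with P y if it is unique, otherwise a junk value. *)
Definition the (P : V -> Prop) : V := set_of (fun z => exists y, P y /\ z ∈ y).

Hint Unfold upair opair union cup succ power sep image graph app the : set_unfold.

Lemma upairE x y z : z ∈ upair x y <-> z = x \/ z = y.
Proof. unfold upair. apply (set_ofE (fun z => z = x \/ z = y)), (zfc_pairing V hV). Qed.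

Lemma unionE a x : x ∈ union a <-> exists y, y ∈ a /\ x ∈ y.
Proof.
  unfold union. apply (set_ofE (fun x => exists y, y ∈ a /\ x ∈ y)), (zfc_union V hV).
Qed.

Lemma cupE a b x : x ∈ cup a b <-> x ∈ a \/ x ∈ b.
Proof.
  unfold cup. rewrite unionE. split.
  - intros (y & Hy & Hx). apply upairE in Hy. destruct Hy as [-> | ->]; auto.
  - intros [H|H]; [exists a|exists b]; rewrite upairE; auto.
Qed.

Lemma succE x y : y ∈ succ x <-> y ∈ x \/ y = x.
Proof. unfold succ. rewrite cupE, upairE. tauto. Qed.

Lemma powerE a x : x ∈ power a <-> subset x a.
Proof. unfold power. apply (set_ofE (fun x => subset x a)), (zfc_powerset V hV). Qed.

Lemma sepE a (P : V -> Prop) : definable (fun e => P (e 0)) ->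
  forall x, x ∈ sep a P <-> x ∈ a /\ P x.
Proof. intros H. unfold sep. apply set_ofE, definable_separation, H. Qed.

Lemma imageE a (F : V -> V) : definable_term (fun e => F (e 0)) ->
  forall y, y ∈ image a F <-> exists x, x ∈ a /\ y = F x.
Proof.
  intros H. unfold image. apply set_ofE.
  apply (definable_replacement (fun x y => y = F x)).
  - apply definable_eq; [apply definable_term_var|].
    apply (definable_term_comp1 F); auto. apply definable_term_var.
  - intros x _. exists (F x). split; congruence.
Qed.

Lemma graphE a (F : V -> V) : definable_term (fun e => F (e 0)) ->
  forall p, p ∈ graph a F <-> exists x, x ∈ a /\ p = opair x (F x).
Proof.
  intros H. apply (imageE a (fun x => opair x (F x))). definability.
Qed.

Lemma is_upairE p x y : is_upair p x y <-> p = upair x y.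
Proof.
  split.
  - intros H. apply set_extensionality. intros z. now rewrite (H z), upairE.
  - intros ->. intros z. apply upairE.
Qed.

Lemma is_opairE p x y : is_opair p x y <-> p = opair x y.
Proof.
  split.
  - intros (u & v & Hu & Hv & Hp). apply is_upairE in Hu, Hv, Hp. now subst.
  - intros ->. exists (upair x x), (upair x y). now rewrite !is_upairE.
Qed.

Lemma is_succE b a : is_succ b a <-> b = succ a.
Proof.
  split.
  - intros H. apply set_extensionality. intros z. now rewrite (H z), succE.
  - intros ->. intros z. apply succE.
Qed.

Lemma upair_eq x y u v :
  upair x y = upair u v -> (x = u /\ y = v) \/ (x = v /\ y = u).
Proof.
  intros E.
  assert (H : forall z, z = x \/ z = y <-> z = u \/ z = v).
  { intros z. now rewrite <- !upairE, E. }
  destruct (proj1 (H x) (or_introl eq_refl)), (proj1 (H y) (or_intror eq_refl)),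
    (proj2 (H u) (or_introl eq_refl)), (proj2 (H v) (or_intror eq_refl));
    subst; auto.
Qed.

Lemma opair_inj x y u v : opair x y = opair u v -> x = u /\ y = v.
Proof.
  unfold opair. intros E.
  destruct (upair_eq _ _ _ _ E) as [[E1 E2]|[E1 E2]];
    apply upair_eq in E1; apply upair_eq in E2; intuition congruence.
Qed.

Lemma mapsE f x y : maps f x y <-> opair x y ∈ f.
Proof.
  split.
  - intros (p & Hp & H). apply is_opairE in Hp. now subst.
  - intros H. exists (opair x y). now rewrite is_opairE.
Qed.

Lemma opair_bound a p x y : p ∈ a -> p = opair x y -> x ∈ union (union a) /\ y ∈ union (union a).
Proof.
  intros Hp ->.
  assert (H : upair x y ∈ union a).
  { apply unionE. exists (opair x y). split; auto. apply upairE; auto. }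
  split; apply unionE; exists (upair x y); split; auto; apply upairE; auto.
Qed.

Lemma maps_bound f x y : maps f x y -> x ∈ union (union f) /\ y ∈ union (union f).
Proof. intros H. apply mapsE in H. now apply (opair_bound _ (opair x y)). Qed.

Lemma appE f x z : z ∈ app f x <-> exists y, maps f x y /\ z ∈ y.
Proof.
  apply (set_of_subE (fun z => exists y, maps f x y /\ z ∈ y) (union (union (union f)))).
  - clear z. intros z (y & Hy & Hz). apply unionE. exists y. split; auto.
    now apply maps_bound in Hy.
  - definability.
Qed.

Lemma app_eq f x y : maps f x y -> (forall y', maps f x y' -> y' = y) -> app f x = y.
Proof.
  intros H U. apply set_extensionality. intros z. rewrite appE. split.
  - intros (y' & Hy & Hz). now rewrite <- (U _ Hy).
  - eauto.
Qed.

Lemma the_eq (P : V -> Prop) y : P y -> (forall y', P y' -> y' = y) -> the P = y.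
Proof.
  intros H U. symmetry. apply set_of_eq. left. intros x. split; eauto.
  intros (y' & Hy & Hx). now rewrite <- (U _ Hy).
Qed.

Lemma app_maps f a x : function_on f a -> x ∈ a -> maps f x (app f x).
Proof.
  intros [_ H] Hx. destruct (H x Hx) as (y & Hy & U).
  rewrite (app_eq f x y); auto. intros y' Hy'. symmetry; auto.
Qed.

Lemma maps_dom f a x y : function_on f a -> maps f x y -> x ∈ a.
Proof.
  intros [H _] Hm. apply mapsE in Hm. destruct (H _ Hm) as (x' & y' & Hx & E).
  apply is_opairE in E. apply opair_inj in E as [-> _]. exact Hx.
Qed.

Lemma maps_app f a x y : function_on f a -> maps f x y -> y = app f x.
Proof.
  intros Hf Hm. assert (Hx := maps_dom _ _ _ _ Hf Hm).
  destruct Hf as [_ H]. destruct (H x Hx) as (z & Hz & U).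
  symmetry. apply app_eq; auto. intros y' Hy'. transitivity z; [symmetry|]; auto.
Qed.

Lemma maps_fun f a x y z : function_on f a -> maps f x y -> maps f x z -> y = z.
Proof.
  intros Hf H1 H2. now rewrite (maps_app f a x y), (maps_app f a x z).
Qed.

Lemma graph_maps a (F : V -> V) x y : definable_term (fun e => F (e 0)) ->
  maps (graph a F) x y <-> x ∈ a /\ y = F x.
Proof.
  intros HF. rewrite mapsE, graphE by auto. split.
  - intros (x' & Hx & E). apply opair_inj in E as [-> ->]. auto.
  - intros [Hx ->]. eauto.
Qed.

Lemma graph_function a (F : V -> V) : definable_term (fun e => F (e 0)) ->
  function_on (graph a F) a.
Proof.
  intros HF. split.
  - intros p Hp. apply graphE in Hp as (x & Hx & ->); auto.
    exists x, (F x). now rewrite is_opairE.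
  - intros x Hx. exists (F x). split.
    + now apply graph_maps.
    + intros y Hy. apply graph_maps in Hy; intuition congruence.
Qed.

Lemma graph_app a (F : V -> V) x : definable_term (fun e => F (e 0)) -> x ∈ a ->
  app (graph a F) x = F x.
Proof.
  intros HF Hx. symmetry. apply (maps_app _ a); [now apply graph_function|].
  now apply graph_maps.
Qed.

Lemma graph_ext a (F G : V -> V) : (forall x, x ∈ a -> F x = G x) ->
  graph a F = graph a G.
Proof.
  intros E. apply set_of_ext. intros p.
  split; intros (x & Hx & ->); exists x; split; auto; now rewrite E.
Qed.

Lemma foundation (P : V -> Prop) a : definable (fun e => P (e 0)) ->
  (exists x, x ∈ a /\ P x) ->
  exists x, x ∈ a /\ P x /\ forall y, y ∈ a -> y ∈ x -> ~ P y.
Proof.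
  intros HP (x & Hx & Px).
  destruct (zfc_foundation V hV (sep a P)) as (m & Hm & Mm).
  - exists x. now apply sepE.
  - apply sepE in Hm as [Hm Pm]; auto. exists m. split; [|split]; auto.
    intros y Hy Hym Py. apply (Mm y Hym). now apply sepE.
Qed.

Lemma mem_irrefl x : ~ x ∈ x.
Proof.
  intros H. destruct (zfc_foundation V hV (upair x x)) as (m & Hm & Mm).
  - exists x. apply upairE; auto.
  - apply upairE in Hm. assert (m = x) by tauto. subst m.
    apply (Mm x H). apply upairE; auto.
Qed.

Lemma mem_asym x y : x ∈ y -> ~ y ∈ x.
Proof.
  intros H1 H2. destruct (zfc_foundation V hV (upair x y)) as (m & Hm & Mm).
  - exists x. apply upairE; auto.
  - apply upairE in Hm. destruct Hm as [-> | ->].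
    + apply (Mm y H2), upairE; auto.
    + apply (Mm x H1), upairE; auto.
Qed.

Lemma subset_antisym a b : subset a b -> subset b a -> a = b.
Proof. intros H1 H2. apply set_extensionality. split; auto. Qed.

(** * Ordinals *)

Lemma ordinal_mem a x : ordinal a -> x ∈ a -> ordinal x.
Proof.
  intros [T L] Hx. split.
  - intros y Hy z Hz.
    assert (Hya : y ∈ a) by (apply (T x); auto).
    assert (Hza : z ∈ a) by (apply (T y); auto).
    destruct (L z x Hza Hx) as [H|[H|H]]; auto.
    + subst. exfalso. exact (mem_asym _ _ Hy Hz).
    (* Here z ∈ y ∈ x ∈ z is a cycle, excluded by Foundation for {x, y, z}. *)
    + exfalso. destruct (zfc_foundation V hV (cup (upair x y) (upair z z))) as (m & Hm & Mm).
      * exists x. rewrite cupE, !upairE; auto.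
      * rewrite cupE, !upairE in Hm.
        destruct Hm as [[-> | ->]|[-> | ->]].
        -- apply (Mm y Hy). rewrite cupE, !upairE; auto.
        -- apply (Mm z Hz). rewrite cupE, !upairE; auto.
        -- apply (Mm x H). rewrite cupE, !upairE; auto.
        -- apply (Mm x H). rewrite cupE, !upairE; auto.
  - intros y z Hy Hz. apply L; apply (T x Hx); auto.
Qed.

Lemma ordinal_trans a x y : ordinal a -> y ∈ x -> x ∈ a -> y ∈ a.
Proof. intros [T _] Hy Hx. exact (T x Hx y Hy). Qed.

(** If a is a proper subset of b, the least element of b outside a has exactly the elements of a. *)
Lemma ordinal_subset_le a b : ordinal a -> ordinal b -> subset a b -> ord_le a b.
Proof.
  intros Ha Hb S. destruct (classic (a = b)) as [E|N]; [now right|left].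
  destruct (foundation (fun x => ~ x ∈ a) b) as (m & Hm & Nm & Mm).
  - definability.
  - apply NNPP. intros H. apply N, subset_antisym; auto.
    intros x Hx. apply NNPP. eauto.
  - replace a with m; auto. apply subset_antisym.
    + intros x Hx. apply NNPP. apply Mm; auto. eapply ordinal_trans; eauto.
    + intros x Hx. destruct (proj2 Hb m x Hm (S x Hx)) as [H|[H|H]]; auto.
      * destruct Nm. eapply ordinal_trans; eauto.
      * subst; contradiction.
Qed.

(** The intersection is an ordinal below or equal to both a and b. It cannot be an element of both,
    as it would then be an element of itself. *)
Lemma ordinal_trichotomy a b : ordinal a -> ordinal b -> a ∈ b \/ a = b \/ b ∈ a.
Proof.
  intros Ha Hb.
  set (c := sep a (fun x => x ∈ b)).
  assert (Hc : forall x, x ∈ c <-> x ∈ a /\ x ∈ b) by (apply sepE; definability).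
  assert (Oc : ordinal c).
  { split.
    - intros x Hx y Hy. apply Hc in Hx as [H1 H2]. apply Hc.
      split; eapply ordinal_trans; eauto.
    - intros x y Hx Hy. apply Hc in Hx, Hy. apply (proj2 Ha); tauto. }
  destruct (ordinal_subset_le c a Oc Ha) as [H1|H1].
  { intros x Hx. now apply Hc in Hx. }
  - destruct (ordinal_subset_le c b Oc Hb) as [H2|H2].
    { intros x Hx. now apply Hc in Hx. }
    + exfalso. apply (mem_irrefl c). now apply Hc.
    + rewrite <- H2. auto.
  - destruct (ordinal_subset_le c b Oc Hb) as [H2|H2].
    { intros x Hx. now apply Hc in Hx. }
    + rewrite <- H1. auto.
    + right; left. congruence.
Qed.

Lemma ordinal_le_or a b : ordinal a -> ordinal b -> ord_le a b \/ b ∈ a.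
Proof. intros Ha Hb. unfold ord_le. destruct (ordinal_trichotomy a b Ha Hb); tauto. Qed.

Lemma ord_le_subset a b : ordinal b -> ord_le a b -> subset a b.
Proof. intros Hb [H| ->] x Hx; auto. eapply ordinal_trans; eauto. Qed.

Lemma ord_le_ordinal a b : ordinal b -> ord_le a b -> ordinal a.
Proof. intros Hb [H| ->]; auto. eapply ordinal_mem; eauto. Qed.

Lemma ordinal_succ a : ordinal a -> ordinal (succ a).
Proof.
  intros Ha. split.
  - intros x Hx y Hy. apply succE. left. apply succE in Hx as [Hx| ->]; auto.
    eapply ordinal_trans; eauto.
  - intros x y Hx Hy. apply succE in Hx, Hy.
    destruct Hx as [Hx| ->], Hy as [Hy| ->]; auto. now apply (proj2 Ha).
Qed.

Lemma transitive_ordinals a : transitive_set a -> (forall x, x ∈ a -> ordinal x) -> ordinal a.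
Proof.
  intros T O. split; auto. intros x y Hx Hy. apply ordinal_trichotomy; auto.
Qed.

Lemma ordinal_union a : (forall x, x ∈ a -> ordinal x) -> ordinal (union a).
Proof.
  intros O. apply transitive_ordinals.
  - intros x Hx y Hy. apply unionE in Hx as (z & Hz & Hx). apply unionE.
    exists z. split; auto. apply (ordinal_trans z x); auto.
  - intros x Hx. apply unionE in Hx as (z & Hz & Hx). apply (ordinal_mem z); auto.
Qed.

Lemma ordinal_succ_mem a b : ordinal a -> b ∈ a -> ord_le (succ b) a.
Proof.
  intros Ha Hb. apply ordinal_subset_le; auto.
  - apply ordinal_succ. eapply ordinal_mem; eauto.
  - intros x Hx. apply succE in Hx as [Hx| ->]; auto. eapply ordinal_trans; eauto.
Qed.

Lemma limit_succ a b : limit_ordinal a -> b ∈ a -> succ b ∈ a.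
Proof.
  intros (Ha & _ & L) Hb. destruct (L b Hb) as (c & Hc & Hbc).
  assert (Oc : ordinal c) by (eapply ordinal_mem; eauto).
  destruct (ordinal_succ_mem c b Oc Hbc) as [H|H].
  - eapply ordinal_trans; eauto.
  - now rewrite H.
Qed.

Definition is_successor b : Prop := exists c, is_succ b c.
Hint Unfold is_successor : set_unfold.

Lemma nonsucc_cases a : ordinal a -> ~ is_successor a -> is_empty a \/ limit_ordinal a.
Proof.
  intros Ha N. destruct (classic (exists x, x ∈ a)) as [E|E].
  - right. split; [|split]; auto. intros x Hx.
    exists (succ x). split; [|apply succE; auto].
    destruct (ordinal_succ_mem a x Ha Hx) as [H|H]; auto.
    destruct N. exists x. now rewrite is_succE.
  - left. intros x Hx. eauto.
Qed.

Lemma limit_nonsucc a : limit_ordinal a -> ~ is_successor a.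
Proof.
  intros La (c & Hc). apply is_succE in Hc. subst a.
  apply (mem_irrefl (succ c)). apply limit_succ; auto. apply succE; auto.
Qed.

Lemma succ_inj_ord x y : succ x = succ y -> x = y.
Proof.
  intros E.
  assert (H1 : x ∈ succ y) by (rewrite <- E; apply succE; auto).
  assert (H2 : y ∈ succ x) by (rewrite E; apply succE; auto).
  apply succE in H1, H2. destruct H1, H2; auto. exfalso. eapply mem_asym; eauto.
Qed.

Lemma least_ordinal (P : V -> Prop) a : definable (fun e => P (e 0)) ->
  ordinal a -> P a -> exists b, ord_le b a /\ P b /\ forall c, c ∈ b -> ~ P c.
Proof.
  intros HP Ha Pa.
  destruct (foundation P (succ a)) as (b & Hb & Pb & Mb); auto.
  { exists a. split; auto. apply succE; auto. }
  exists b. split; [now apply succE in Hb|]. split; auto.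
  intros c Hc. apply Mb; auto. eapply ordinal_trans; eauto using ordinal_succ.
Qed.

Lemma ordinal_induction (P : V -> Prop) : definable (fun e => P (e 0)) ->
  (forall a, ordinal a -> (forall b, b ∈ a -> P b) -> P a) ->
  forall a, ordinal a -> P a.
Proof.
  intros HP H a Ha. apply NNPP. intros N.
  destruct (least_ordinal (fun x => ~ P x) a) as (b & Hb & Nb & Mb); auto.
  - apply definable_not, HP.
  - apply Nb, H. 
    + eapply ord_le_ordinal; eauto.
    + intros c Hc. apply NNPP. now apply Mb.
Qed.

(** The axiom only gives an inductive set [a]. Its finite ordinals, those that together with all
    their elements are zero or successors, form a limit ordinal; transitivity holds because a least
    missing element would be zero or a successor, hence in [a]. *)
Lemma limit_exists : exists w : V, limit_ordinal w.
Proof.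
  destruct (zfc_infinity V hV) as (a & (o & Ho & Hoa) & Hs).
  set (fin := fun x => ordinal x /\ forall y, y ∈ x \/ y = x -> is_empty y \/ is_successor y).
  assert (Df : definable (fun e => fin (e 0))) by (unfold fin; definability).
  set (N := sep a fin).
  assert (HN : forall x, x ∈ N <-> x ∈ a /\ fin x) by (apply sepE; auto).
  assert (Hsa : forall x, x ∈ a -> succ x ∈ a).
  { intros x Hx. destruct (Hs x Hx) as (y & Hy & H). apply is_succE in Hy. now subst. }
  assert (Fs : forall x, fin x -> fin (succ x)).
  { intros x [Ox Fx]. split; [now apply ordinal_succ|]. intros y [Hy| ->].
    - apply succE in Hy. auto.
    - right. exists x. now apply is_succE. }
  assert (Fm : forall x y, fin x -> y ∈ x -> fin y).
  { intros x y [Ox Fx] Hy. split; [eapply ordinal_mem; eauto|].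
    intros z [Hz| ->]; apply Fx; left; auto. eapply ordinal_trans; eauto. }
  assert (TN : transitive_set N).
  { intros x Hx y Hy. apply HN in Hx as [Hxa Fx]. apply HN. split; [|eauto].
    apply NNPP. intros Ny.
    destruct (foundation (fun z => ~ z ∈ a) x) as (z & Hz & Nz & Mz);
      [definability|eauto|].
    destruct (proj2 Fx z) as [Ez|(z' & Sz)]; auto.
    - apply Nz. replace z with o; auto. apply set_extensionality. intros u.
      split; intros Hu; exfalso; [exact (Ho u Hu)|exact (Ez u Hu)].
    - apply is_succE in Sz. subst z. apply Nz, Hsa, NNPP.
      assert (Hz' : z' ∈ succ z') by (apply succE; auto).
      apply Mz; auto. exact (ordinal_trans x _ z' (proj1 Fx) Hz' Hz). }
  exists N. split; [|split].
  - apply transitive_ordinals; auto. intros x Hx. apply HN in Hx. apply Hx.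
  - exists o. apply HN. split; auto. split.
    + split; intros x; intros; exfalso; eapply Ho; eauto.
    + intros y [Hy| ->]; [exfalso; eapply Ho; eauto|now left].
  - intros x Hx. exists (succ x). apply HN in Hx as [Hx Fx].
    rewrite HN, succE. auto.
Qed.

End SetTheory.

#[export] Hint Unfold upair opair union cup succ power sep image graph app the
  is_successor : set_unfold.

(** * Recursion on membership *)

Section Recursion.
Context {V : set_structure} {hV : ZFC V}.
Context (G : V -> V -> V).
Context (HG : definable_term (fun e => G (e 0) (e 1))).

(** An attempt at the recursion on [T]. Since [app] is total, [p] may be any set; only its values on
    [T] are constrained. *)
Definition rec_approx (T p : V) : Prop :=
  transitive_set T /\ forall u, u ∈ T -> app p u = G u (graph u (app p)).

Definition mem_rec (x : V) : V :=
  the (fun y => exists T p, rec_approx T p /\ x ∈ T /\ y = app p x).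

Lemma definable_mem_rec : definable_term (fun e => mem_rec (e 0)).
Proof. unfold mem_rec, rec_approx. definability. Qed.

Lemma rec_approx_unique T p T' p' u : rec_approx T p -> rec_approx T' p' ->
  u ∈ T -> u ∈ T' -> app p u = app p' u.
Proof.
  intros [T1 E1] [T2 E2] H1 H2. apply NNPP. intros N.
  destruct (foundation (fun v => v ∈ T' /\ app p v <> app p' v) T) as (m & Hm & [Hm' Nm] & Mm).
  - definability.
  - eauto.
  - apply Nm. rewrite E1, E2 by auto. f_equal. apply graph_ext.
    intros v Hv. apply NNPP. intros Nv. apply (Mm v); auto.
    + exact (T1 m Hm v Hv).
    + split; auto. exact (T2 m Hm' v Hv).
Qed.

Lemma mem_rec_approx T p u : rec_approx T p -> u ∈ T -> mem_rec u = app p u.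
Proof.
  intros HT Hu. apply the_eq; eauto.
  intros y (T' & p' & HT' & Hu' & ->). eapply rec_approx_unique; eauto.
Qed.

(** The transitive set [T] is assumed because transitive closures are themselves built by recursion
    later. A minimal m in [T] without an approximation would get one: all covered elements of [T],
    together with m, form a transitive domain. *)
Lemma mem_rec_local T u : transitive_set T -> u ∈ T ->
  mem_rec u = G u (graph u mem_rec).
Proof.
  intros TT Hu.
  assert (DR := definable_mem_rec).
  set (cov := fun v => exists T p, rec_approx T p /\ v ∈ T).
  assert (Dc : definable (fun e => cov (e 0))) by (unfold cov, rec_approx; definability).
  assert (Eq : forall v, cov v -> mem_rec v = G v (graph v mem_rec)).
  { intros v (T' & p & HT' & Hv). rewrite (mem_rec_approx T' p), (proj2 HT') by auto.
    f_equal. apply graph_ext. intros z Hz. symmetry.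
    apply (mem_rec_approx T'); auto. exact (proj1 HT' v Hv z Hz). }
  apply Eq, NNPP. intros N.
  destruct (foundation (fun v => ~ cov v) T) as (m & Hm & Nm & Mm);
    [apply definable_not, Dc|eauto|].
  apply Nm.
  set (F := fun v => G v (graph v mem_rec)).
  assert (DF : definable_term (fun e => F (e 0))) by (unfold F; definability).
  set (D := sep T cov).
  assert (HD : forall v, v ∈ D <-> v ∈ T /\ cov v) by (apply sepE; auto).
  assert (HmD : forall v, v ∈ m -> v ∈ D).
  { intros v Hv. apply HD. assert (v ∈ T) by exact (TT m Hm v Hv).
    split; auto. apply NNPP. auto. }
  assert (TD : transitive_set D).
  { intros v Hv z Hz. apply HD in Hv as [Hv (T' & p & HT' & Hv')]. apply HD. split.
    - exact (TT v Hv z Hz).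
    - exists T', p. split; auto. exact (proj1 HT' v Hv' z Hz). }
  exists (cup D (upair m m)), (graph (cup D (upair m m)) F). split.
  - assert (S : forall v z, v ∈ cup D (upair m m) -> z ∈ v -> z ∈ D).
    { intros v z Hv Hz. rewrite cupE, upairE in Hv.
      destruct Hv as [Hv|[-> | ->]]; auto. exact (TD v Hv z Hz). }
    split.
    + intros v Hv z Hz. apply cupE. left. eauto.
    + intros v Hv. rewrite graph_app by auto. unfold F at 1. f_equal.
      apply graph_ext. intros z Hz. assert (HzD := S v z Hv Hz).
      rewrite graph_app; auto.
      * apply Eq. now apply HD in HzD.
      * apply cupE. auto.
  - rewrite cupE, upairE. auto.
Qed.

End Recursion.

(** * Transitive closures, ranks, and choice for definable relations *)

Section Hierarchy.
Context {V : set_structure} {hV : ZFC V}.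
Implicit Types (a b c f g p x y z : V).

Lemma transitive_superset x : exists T, transitive_set T /\ x ∈ T.
Proof.
  destruct (@limit_exists V hV) as [w Lw].
  (* Iterated unions along the limit ordinal [w]: stage n consists of x and of the elements of
     elements of earlier stages. The recursion stays inside the transitive set [w], so
     [mem_rec_local] suffices. *)
  set (G := fun n f => cup x (union (union (image n (app f))))).
  assert (DG : definable_term (fun e => G (e 0) (e 1))) by (unfold G; definability).
  set (F := mem_rec G).
  assert (DF : definable_term (fun e => F (e 0))) by apply (definable_mem_rec G DG).
  assert (EF : forall n z, n ∈ w -> (z ∈ F n <-> z ∈ x \/ exists m y, m ∈ n /\ y ∈ F m /\ z ∈ y)).
  { intros n z Hn. unfold F at 1.
    rewrite (mem_rec_local G DG w n (proj1 (proj1 Lw)) Hn).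
    unfold G at 1. rewrite cupE, unionE. apply or_iff_compat_l. fold F. split.
    - intros (y & Hy & Hz). apply unionE in Hy as (u & Hu & Hy).
      apply imageE in Hu as (m & Hm & ->); [|definability].
      rewrite graph_app in Hy; eauto.
    - intros (m & y & Hm & Hy & Hz). exists y. split; auto. apply unionE.
      exists (F m). split; auto. apply imageE; [definability|].
      exists m. now rewrite graph_app. }
  set (C := union (image w F)).
  assert (HC : forall z, z ∈ C <-> exists n, n ∈ w /\ z ∈ F n).
  { intros z. unfold C. rewrite unionE. split.
    - intros (u & Hu & Hz). apply imageE in Hu as (n & Hn & ->); eauto.
    - intros (n & Hn & Hz). exists (F n). split; auto. apply imageE; eauto. }
  exists (cup (upair x x) C). split.
  - intros u Hu z Hz. apply cupE. right. rewrite cupE, upairE, HC in Hu. apply HC.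
    destruct Hu as [Hu|(n & Hn & Hu)].
    + assert (u = x) by tauto. subst u. destruct (proj1 (proj2 Lw)) as [n Hn].
      exists n. split; auto. apply EF; auto.
    + exists (succ n). assert (Hs : succ n ∈ w) by now apply limit_succ.
      split; auto. apply EF; auto. right. exists n, u. rewrite succE. auto.
  - rewrite cupE, upairE. auto.
Qed.

Lemma mem_rec_eq (G : V -> V -> V) x : definable_term (fun e => G (e 0) (e 1)) ->
  mem_rec G x = G x (graph x (mem_rec G)).
Proof.
  intros HG. destruct (transitive_superset x) as (T & TT & Hx).
  eapply mem_rec_local; eauto.
Qed.

Lemma mem_induction (P : V -> Prop) : definable (fun e => P (e 0)) ->
  (forall x, (forall y, y ∈ x -> P y) -> P x) -> forall x, P x.
Proof.
  intros HP H x. apply NNPP. intros N.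
  destruct (transitive_superset x) as (T & TT & Hx).
  destruct (foundation (fun x => ~ P x) T) as (m & Hm & Nm & Mm).
  - apply definable_not, HP.
  - eauto.
  - apply Nm, H. intros y Hy. apply NNPP. apply Mm; auto. exact (TT m Hm y Hy).
Qed.

Definition least (P : V -> Prop) : V :=
  the (fun a => ordinal a /\ P a /\ forall b, b ∈ a -> ~ P b).

Lemma least_spec (P : V -> Prop) : definable (fun e => P (e 0)) ->
  (exists a, ordinal a /\ P a) ->
  ordinal (least P) /\ P (least P) /\ forall b, b ∈ least P -> ~ P b.
Proof.
  intros HP (a & Ha & Pa).
  destruct (least_ordinal P a HP Ha Pa) as (b & Hb & Pb & Mb).
  assert (Ob : ordinal b) by (eapply ord_le_ordinal; eauto).
  unfold least. rewrite (the_eq _ b); auto.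
  intros c (Oc & Pc & Mc).
  destruct (ordinal_trichotomy c b Oc Ob) as [H|[H|H]]; auto.
  - destruct (Mb c H Pc).
  - destruct (Mc b H Pb).
Qed.

(** The von Neumann hierarchy: V_a is the union of the power sets of V_b for b < a. *)
Definition cumulative_step (a f : V) : V := union (image a (fun b => power (app f b))).
Definition cumulative : V -> V := mem_rec cumulative_step.

Lemma definable_cumulative_step :
  definable_term (fun e : nat -> V => cumulative_step (e 0) (e 1)).
Proof. unfold cumulative_step. definability. Qed.

Lemma definable_cumulative : definable_term (fun e : nat -> V => cumulative (e 0)).
Proof. apply definable_mem_rec, definable_cumulative_step. Qed.
Hint Resolve definable_cumulative : defs.

Lemma cumulativeE a x : x ∈ cumulative a <-> exists b, b ∈ a /\ subset x (cumulative b).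
Proof.
  unfold cumulative at 1. rewrite mem_rec_eq by apply definable_cumulative_step.
  fold cumulative. unfold cumulative_step at 1. rewrite unionE. split.
  - intros (y & Hy & Hx). apply imageE in Hy as (b & Hb & ->); [|definability].
    apply powerE in Hx. rewrite graph_app in Hx; eauto with defs.
  - intros (b & Hb & Hx). exists (power (cumulative b)). rewrite powerE. split; auto.
    apply imageE; [definability|]. exists b. rewrite graph_app; auto with defs.
Qed.

Lemma cumulative_exhausts x : exists a, ordinal a /\ subset x (cumulative a).
Proof.
  revert x. apply mem_induction; [definability|]. intros x IH.
  set (lev := fun y => least (fun a => ordinal a /\ subset y (cumulative a))).
  assert (Dl : definable_term (fun e => lev (e 0))) by (unfold lev, least; definability).
  assert (Hl : forall y, y ∈ x -> ordinal (lev y) /\ subset y (cumulative (lev y))).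
  { intros y Hy. destruct (IH y Hy) as (a & Oa & Ha).
    apply (least_spec (fun a => ordinal a /\ subset y (cumulative a))); [definability|eauto]. }
  assert (Di : definable_term (fun e => succ (lev (e 0)))) by definability.
  exists (union (image x (fun y => succ (lev y)))). split.
  - apply ordinal_union. intros z Hz. apply imageE in Hz as (y & Hy & ->); auto.
    apply ordinal_succ, Hl, Hy.
  - intros y Hy. apply cumulativeE. exists (lev y). split; [|apply Hl, Hy].
    apply unionE. exists (succ (lev y)). rewrite succE. split; auto. apply imageE; eauto.
Qed.

(** Scott's trick: each i is sent to the first level of the hierarchy that contains a witness, and
    Replacement collects these levels. *)
Lemma collection (R : V -> V -> Prop) (S : V) : definable (fun e => R (e 0) (e 1)) ->
  exists T, forall i, i ∈ S -> (exists x, R i x) -> exists x, x ∈ T /\ R i x.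
Proof.
  intros HR.
  set (lev := fun i => least (fun a => exists x, x ∈ cumulative a /\ R i x)).
  assert (Dl : definable_term (fun e => lev (e 0))) by (unfold lev, least; definability).
  assert (Di : definable_term (fun e => cumulative (lev (e 0)))) by definability.
  exists (union (image S (fun i => cumulative (lev i)))).
  intros i Hi (x & Hx).
  assert (L : exists x, x ∈ cumulative (lev i) /\ R i x).
  { apply (least_spec (fun a => exists x, x ∈ cumulative a /\ R i x)); [definability|].
    destruct (cumulative_exhausts x) as (a & Oa & Ha).
    exists (succ a). split; [now apply ordinal_succ|]. exists x. split; auto.
    apply cumulativeE. exists a. rewrite succE. auto. }
  destruct L as (y & Hy & Ry). exists y. split; auto. apply unionE.
  exists (cumulative (lev i)). split; auto. apply imageE; eauto.
Qed.

(** The axiom of choice speaks of disjoint families. Tagging the elements of X with X itself makes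
    all nonempty subsets of T disjoint at once. *)
Lemma choice_function (T : V) : exists ch : V -> V,
  definable_term (fun e => ch (e 0)) /\
  forall X, subset X T -> (exists x, x ∈ X) -> ch X ∈ X.
Proof.
  set (fam := fun X => image X (fun x => opair X x)).
  assert (Hf : forall X p, p ∈ fam X <-> exists x, x ∈ X /\ p = opair X x).
  { intros X. apply imageE. definability. }
  assert (Df : definable_term (fun e => fam (e 0))) by (unfold fam; definability).
  set (N := sep (power T) (fun X => exists x, x ∈ X)).
  assert (HN : forall X, X ∈ N <-> subset X T /\ exists x, x ∈ X).
  { intros X. rewrite <- powerE.
    apply (sepE (power T) (fun X => exists x, x ∈ X)). definability. }
  destruct (zfc_choice V hV (image N fam)) as [c Hc].
  - intros y Hy. apply imageE in Hy as (X & HX & ->); auto.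
    apply HN in HX as [_ (x & Hx)]. exists (opair X x). apply Hf. eauto.
  - intros y y' z Hy Hy' Hz Hz'.
    apply imageE in Hy as (X & _ & ->); auto. apply imageE in Hy' as (X' & _ & ->); auto.
    apply Hf in Hz as (x & _ & ->). apply Hf in Hz' as (x' & _ & E).
    apply opair_inj in E as [-> _]. reflexivity.
  - exists (fun X => the (fun x => opair X x ∈ c /\ x ∈ X)). split; [definability|].
    intros X HX HX'. destruct (Hc (fam X)) as (p & [Hpc Hp] & U).
    { apply imageE; auto. exists X. split; auto. now apply HN. }
    apply Hf in Hp as (x & Hx & ->).
    rewrite (the_eq _ x); auto.
    intros y [Hy Hy']. symmetry.
    refine (proj2 (opair_inj _ _ _ _ (U (opair X y) (conj Hy _)))). apply Hf. eauto.
Qed.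

Lemma definable_choice (R : V -> V -> Prop) (S : V) : definable (fun e => R (e 0) (e 1)) ->
  exists F, function_on F S /\ forall i, i ∈ S -> (exists x, R i x) -> R i (app F i).
Proof.
  intros HR. destruct (collection R S HR) as [T HT].
  destruct (choice_function T) as (ch & Dch & Hch).
  assert (D : definable_term (fun e => ch (sep T (R (e 0))))) by definability.
  exists (graph S (fun i => ch (sep T (R i)))). split; [now apply graph_function|].
  intros i Hi Hx. rewrite graph_app by auto.
  assert (HRi : definable (fun e => R i (e 0))) by definability.
  apply (sepE T (R i) HRi). apply Hch.
  - intros x Hx'. now apply (sepE T (R i) HRi) in Hx'.
  - destruct (HT i Hi Hx) as (x & H1 & H2). exists x. now apply sepE.
Qed.

(** * Well-ordering and cardinality *)

Lemma bijection_graph a b (F : V -> V) : definable_term (fun e => F (e 0)) ->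
  (forall x, x ∈ a -> F x ∈ b) ->
  (forall x y, x ∈ a -> y ∈ a -> F x = F y -> x = y) ->
  (forall y, y ∈ b -> exists x, x ∈ a /\ F x = y) ->
  bijection (graph a F) a b.
Proof.
  intros DF Hi Hinj Hs. split; [split|].
  - now apply graph_function.
  - intros x y H. apply graph_maps in H as [Hx ->]; auto.
  - intros y Hy. destruct (Hs y Hy) as (x & Hx & <-). exists x. split.
    + now apply graph_maps.
    + intros x' H. apply graph_maps in H as [Hx' E]; auto.
Qed.

Lemma bijection_app f a b : bijection f a b ->
  (forall x, x ∈ a -> app f x ∈ b) /\
  (forall x y, x ∈ a -> y ∈ a -> app f x = app f y -> x = y) /\
  (forall y, y ∈ b -> exists x, x ∈ a /\ app f x = y).
Proof.
  intros [[Hf Hi] Hb]. repeat split.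
  - intros x Hx. eapply Hi, app_maps; eauto.
  - intros x y Hx Hy E.
    assert (Mx := app_maps f a x Hf Hx). assert (My := app_maps f a y Hf Hy).
    destruct (Hb (app f x) (Hi _ _ Mx)) as (z & _ & U).
    rewrite <- (U x Mx). apply U. now rewrite E.
  - intros y Hy. destruct (Hb y Hy) as (x & Mx & _). exists x. split.
    + eapply maps_dom; eauto.
    + symmetry. eapply maps_app; eauto.
Qed.

Lemma bijection_comp f g a b c : bijection f a b -> bijection g b c ->
  bijection (graph a (fun x => app g (app f x))) a c.
Proof.
  intros Hf Hg. apply bijection_app in Hf as (F1 & F2 & F3), Hg as (G1 & G2 & G3).
  apply bijection_graph; auto.
  - definability.
  - intros z Hz. destruct (G3 z Hz) as (y & Hy & <-). destruct (F3 y Hy) as (x & Hx & <-).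
    eauto.
Qed.

(** The rule for the next value is kept in the conclusion because a suitable [sel] will later
    control the length of the enumeration. *)
Lemma enumeration (B : V) (sel : V -> V) : definable_term (fun e => sel (e 0)) ->
  (forall X, subset X B -> (exists x, x ∈ X) -> sel X ∈ X) ->
  exists a E, ordinal a /\ bijection E a B /\
    forall b, b ∈ a ->
      app E b = sel (sep B (fun y => forall c, c ∈ b -> y <> app E c)).
Proof.
  intros Ds Hs.
  set (G := fun b f => sel (sep B (fun y => forall c, c ∈ b -> y <> app f c))).
  assert (DG : definable_term (fun e => G (e 0) (e 1))) by (unfold G; definability).
  set (F := mem_rec G).
  assert (DF : definable_term (fun e => F (e 0))) by apply (definable_mem_rec G DG).
  set (rest := fun b => sep B (fun y => forall c, c ∈ b -> y <> F c)).
  assert (Dr : definable_term (fun e => rest (e 0))) by (unfold rest; definability).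
  assert (Hr : forall b y, y ∈ rest b <-> y ∈ B /\ forall c, c ∈ b -> y <> F c).
  { intros b. apply sepE. definability. }
  assert (EF : forall b, F b = sel (rest b)).
  { intros b. unfold F at 1. rewrite (mem_rec_eq G b DG). unfold G at 1. fold F.
    f_equal. apply set_of_ext. intros y. apply and_iff_compat_l.
    split; intros H c Hc; specialize (H c Hc); rewrite graph_app in *; auto. }
  assert (Hin : forall b, (exists y, y ∈ rest b) -> F b ∈ rest b).
  { intros b Hb. rewrite EF. apply Hs; auto. intros y Hy. now apply Hr in Hy. }
  assert (Ex : exists a, ordinal a /\ ~ exists y, y ∈ rest a).
  { apply NNPP. intros N.
    assert (H : forall a, ordinal a -> F a ∈ rest a).
    { intros a Oa. apply Hin. apply NNPP. eauto. }
    assert (inj : forall a b, ordinal a -> ordinal b -> F a = F b -> a = b).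
    { intros a b Oa Ob E. destruct (ordinal_trichotomy a b Oa Ob) as [L|[L|L]]; auto; exfalso.
      - apply (proj2 (proj1 (Hr b _) (H b Ob)) a L). auto.
      - apply (proj2 (proj1 (Hr a _) (H a Oa)) b L). auto. }
    (* If B were never exhausted, F would inject the ordinals into B. Replacement along the inverse
       then yields a set [O] of all ordinals, which is the Burali-Forti contradiction. *)
    set (idx := fun y => the (fun a => ordinal a /\ F a = y)).
    assert (Di : definable_term (fun e => idx (e 0))) by (unfold idx; definability).
    set (O := sep (image B idx) ordinal).
    assert (HO : forall a, a ∈ O <-> ordinal a).
    { intros a. unfold O. rewrite sepE by definability. split; [tauto|]. intros Oa.
      split; auto. apply imageE; auto. exists (F a). split.
      - now apply (Hr a), H.
      - symmetry. apply the_eq; auto. intros b [Ob E]. auto. }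
    assert (OU : ordinal (union O)) by (apply ordinal_union; intros x; apply HO).
    apply (mem_irrefl (union O)). apply unionE. exists (succ (union O)).
    rewrite succE, HO. split; auto. now apply ordinal_succ. }
  apply least_spec in Ex; [|definability].
  set (a := least (fun a => ~ exists y, y ∈ rest a)) in Ex.
  destruct Ex as (Oa & Na & Ma).
  assert (H : forall b, b ∈ a -> F b ∈ rest b).
  { intros b Hb. apply Hin, NNPP. auto. }
  exists a, (graph a F). split; [|split]; auto.
  - apply bijection_graph; auto.
    + intros b Hb. now apply (Hr b), H.
    + intros b c Hb Hc E.
      destruct (proj2 Oa b c Hb Hc) as [L|[L|L]]; auto; exfalso.
      * apply (proj2 (proj1 (Hr c _) (H c Hc)) b L). auto.
      * apply (proj2 (proj1 (Hr b _) (H b Hb)) c L). auto.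
    + intros y Hy. apply NNPP. intros N. apply Na. exists y. apply Hr. split; auto.
      intros c Hc E. apply N. exists c. auto.
  - intros b Hb. rewrite graph_app, EF by auto. f_equal. apply set_of_ext.
    intros y. apply and_iff_compat_l.
    assert (S : forall c, c ∈ b -> app (graph a F) c = F c).
    { intros c Hc. apply graph_app; auto. eapply ordinal_trans; eauto. }
    split; intros X c Hc; specialize (X c Hc); rewrite S in *; auto.
Qed.

Lemma well_ordering (B : V) : exists a E, ordinal a /\ bijection E a B.
Proof.
  destruct (choice_function B) as (ch & D & H).
  destruct (enumeration B ch D H) as (a & E & Oa & HE & _). eauto.
Qed.

Lemma cardinal_of_ordinal a : ordinal a ->
  exists c f, cardinal c /\ ord_le c a /\ bijection f c a.
Proof.
  intros Oa.
  destruct (least_ordinal (fun c => exists f, bijection f c a) a) as (c & Hc & (f & Hf) & Mc);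
    auto.
  - definability.
  - exists (graph a (fun x => x)). apply bijection_graph; eauto. definability.
  - exists c, f. split; [split|]; auto.
    + eapply ord_le_ordinal; eauto.
    + intros d g Hd Hg. apply (Mc d Hd). eauto using bijection_comp.
Qed.

Lemma cardinal_of (B : V) : exists c f, cardinal c /\ bijection f c B.
Proof.
  destruct (well_ordering B) as (a & E & Oa & HE).
  destruct (cardinal_of_ordinal a Oa) as (c & f & Hc & _ & Hf).
  eauto using bijection_comp.
Qed.

(** If the cardinality c of a were above k, minimality would give kp <= c <= a, against a < kp. *)
Lemma below_card_succ k kp a : is_card_succ kp k -> ordinal a -> a ∈ kp ->
  ordinal k -> exists c f, cardinal c /\ subset c k /\ bijection f c a.
Proof.
  intros (Ckp & Hk & Min) Oa Ha Ok.
  destruct (cardinal_of_ordinal a Oa) as (c & f & Hc & Hca & Hf).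
  exists c, f. split; [|split]; auto.
  destruct (ordinal_le_or c k (proj1 Hc) Ok) as [L|L].
  - now apply ord_le_subset.
  - exfalso. specialize (Min c Hc L).
    apply (mem_irrefl a). apply (ord_le_subset c a Oa Hca).
    apply (ord_le_subset kp c (proj1 Hc) Min). exact Ha.
Qed.

(** The cardinality of a is at most k^+, and k^+ is at most that of P(k) by Cantor's theorem. *)
Lemma power_injection k kp kpp a : ordinal k -> is_card_succ kp k -> is_card_succ kpp kp ->
  ordinal a -> a ∈ kpp ->
  exists A, function_on A a /\ (forall b, b ∈ a -> subset (app A b) k) /\
    forall b c, b ∈ a -> c ∈ a -> app A b = app A c -> b = c.
Proof.
  intros Ok Hkp Hkpp Oa Ha.
  destruct (cardinal_of (power k)) as (c & f & Hc & Hf).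
  apply bijection_app in Hf as (F1 & F2 & F3).
  assert (Lkc : k ∈ c).
  { destruct (ordinal_le_or c k (proj1 Hc) Ok) as [L|L]; auto. exfalso.
    assert (S := ord_le_subset c k Ok L).
    (* Cantor's diagonal set. It is a subset of k since c is contained in k, so it would have to be
       a value of [f]. *)
    set (d := sep c (fun x => ~ x ∈ app f x)).
    assert (Hd : forall x, x ∈ d <-> x ∈ c /\ ~ x ∈ app f x) by (apply sepE; definability).
    destruct (F3 d) as (x & Hx & Ex).
    { apply powerE. intros x Hx. apply S. now apply Hd in Hx. }
    specialize (Hd x). rewrite Ex in Hd. tauto. }
  assert (Skp : subset kp c).
  { apply ord_le_subset; [apply Hc|]. now apply Hkp. }
  destruct (below_card_succ kp kpp a Hkpp Oa Ha (proj1 (proj1 Hkp))) as (d & g & Hd & Sd & Hg).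
  apply bijection_app in Hg as (G1 & G2 & G3).
  set (idx := fun b => the (fun x => x ∈ d /\ app g x = b)).
  assert (Di : definable_term (fun e => idx (e 0))) by (unfold idx; definability).
  assert (Hi : forall b, b ∈ a -> idx b ∈ d /\ app g (idx b) = b).
  { intros b Hb. destruct (G3 b Hb) as (x & Hx & E). unfold idx.
    rewrite (the_eq _ x); auto. intros y [Hy Ey]. apply G2; congruence. }
  assert (D : definable_term (fun e => app f (idx (e 0)))) by definability.
  exists (graph a (fun b => app f (idx b))). split; [now apply graph_function|]. split.
  - intros b Hb. rewrite graph_app by auto. apply powerE, F1, Skp, Sd, Hi, Hb.
  - intros b b' Hb Hb'. rewrite !graph_app by auto. intros E.
    destruct (Hi b Hb) as [I1 I2], (Hi b' Hb') as [I3 I4].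
    apply F2 in E; auto. congruence.
Qed.

End Hierarchy.
#[export] Hint Unfold least : set_unfold.

(** * Combinatorics of measurable cardinals *)

Section Measure.
Context {V : set_structure} {hV : ZFC V}.
Context (k U : V).
Context (Ok : ordinal k).
Context (HU : complete_ultrafilter k k U).
Context (NU : ~ principal k U).
Implicit Types (P Q : V -> Prop).

Definition almost_all P : Prop := sep k P ∈ U.

Lemma almost_all_mono P Q : definable (fun e => P (e 0)) -> definable (fun e => Q (e 0)) ->
  (forall x, x ∈ k -> P x -> Q x) -> almost_all P -> almost_all Q.
Proof.
  intros DP DQ H HP. eapply (uf_upward _ _ (proj1 HU)); eauto.
  - intros x Hx. apply sepE in Hx as [Hx Px]; auto. apply sepE; auto.
  - intros x Hx. apply sepE in Hx; tauto.
Qed.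

Lemma almost_all_exists P : definable (fun e => P (e 0)) -> almost_all P ->
  exists x, x ∈ k /\ P x.
Proof.
  intros DP HP. apply NNPP. intros N. apply (uf_nonempty _ _ (proj1 HU) _ HP).
  intros x Hx. apply N. exists x. now apply sepE in Hx.
Qed.

Lemma almost_all_and P Q : definable (fun e => P (e 0)) -> definable (fun e => Q (e 0)) ->
  almost_all P -> almost_all Q -> almost_all (fun x => P x /\ Q x).
Proof.
  intros DP DQ HP HQ. eapply (uf_inter _ _ (proj1 HU)); [exact HP|exact HQ|].
  intros x. rewrite !sepE; [tauto|auto..|definability].
Qed.

Lemma almost_all_not P : definable (fun e => P (e 0)) ->
  ~ almost_all P -> almost_all (fun x => ~ P x).
Proof.
  intros DP N. destruct (uf_ultra _ _ (proj1 HU) (sep k P) (sep k (fun x => ~ P x))); auto.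
  - intros x Hx. apply sepE in Hx; tauto.
  - intros x. rewrite !sepE; [tauto|auto|definability].
  - contradiction.
Qed.

Lemma almost_all_meet P Q : almost_all P -> almost_all Q ->
  definable (fun e => P (e 0)) -> definable (fun e => Q (e 0)) ->
  exists x, x ∈ k /\ P x /\ Q x.
Proof.
  intros HP HQ DP DQ. apply (almost_all_exists (fun x => P x /\ Q x)).
  - definability.
  - now apply almost_all_and.
Qed.

Lemma almost_all_complete (R : V -> V -> Prop) g : definable (fun e => R (e 0) (e 1)) ->
  g ∈ k -> (forall i, i ∈ g -> almost_all (R i)) ->
  almost_all (fun x => forall i, i ∈ g -> R i x).
Proof.
  intros DR Hg H.
  assert (Di : forall i, definable (fun e => R i (e 0))) by (intros; definability).
  assert (DF : definable_term (fun e => sep k (R (e 0)))) by definability.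
  apply (proj2 HU g (graph g (fun i => sep k (R i)))); auto.
  - split; [now apply graph_function|]. intros i X Hm.
    apply graph_maps in Hm as [Hi ->]; auto. now apply H.
  - intros x. rewrite sepE by definability. split.
    + intros [Hx HR]. split; auto. intros i X Hm.
      apply graph_maps in Hm as [Hi ->]; auto. apply sepE; auto.
    + intros [Hx HR]. split; auto. intros i Hi.
      apply (sepE k (R i)); auto. apply (HR i). now apply graph_maps.
Qed.

Lemma almost_all_neq a : almost_all (fun x => x <> a).
Proof.
  apply almost_all_not; [definability|]. intros H. apply NU. exists a.
  assert (Ha : a ∈ k).
  { apply almost_all_exists in H as (x & Hx & ->); [exact Hx|definability]. }
  split; auto. intros X. split.
  - intros HX. split; [now apply (uf_subset _ _ (proj1 HU))|]. apply NNPP. intros N.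
    assert (S : sep k (fun x => x ∈ X) = X).
    { apply set_extensionality. intros x. rewrite sepE by definability. split; [tauto|].
      intros Hx. split; auto. exact (uf_subset _ _ (proj1 HU) X HX x Hx). }
    assert (HX' : almost_all (fun x => x ∈ X)) by (unfold almost_all; now rewrite S).
    destruct (almost_all_meet _ _ H HX') as (x & _ & -> & Hx);
      [definability..|contradiction].
  - intros [HX HaX]. eapply (uf_upward _ _ (proj1 HU)); eauto.
    intros x Hx. apply sepE in Hx as [_ ->]; [auto|definability].
Qed.

Lemma almost_all_notin b : b ∈ k -> almost_all (fun x => ~ x ∈ b).
Proof.
  intros Hb.
  apply (almost_all_mono (fun x => forall i, i ∈ b -> x <> i)); try definability.
  - intros x _ H Hx. exact (H x Hx eq_refl).
  - apply (almost_all_complete (fun i x => x <> i)); auto; [definability|].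
    intros i _. apply almost_all_neq.
Qed.

Context (Hw : exists w, limit_ordinal w /\ w ∈ k).

(** The witness is the ordinal sum b + w for a limit w < k. It is below k: otherwise k would be
    covered by b and the points b + n with n < w, which are fewer than k null sets. *)
Lemma limit_above b : b ∈ k -> exists v, v ∈ k /\ limit_ordinal v /\ b ∈ v.
Proof.
  intros Hb. destruct Hw as (w & Lw & Hwk).
  assert (Ob : ordinal b) by (eauto using ordinal_mem).
  (* ordinal addition b + x *)
  set (G := fun x f => cup b (image x (app f))).
  assert (DG : definable_term (fun e => G (e 0) (e 1))) by (unfold G; definability).
  set (p := mem_rec G).
  assert (Dp : definable_term (fun e => p (e 0))) by apply (definable_mem_rec G DG).
  assert (Ep : forall x z, z ∈ p x <-> z ∈ b \/ exists y, y ∈ x /\ z = p y).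
  { intros x z. unfold p at 1. rewrite (mem_rec_eq G x DG). unfold G at 1. fold p.
    rewrite cupE. apply or_iff_compat_l. rewrite imageE by definability.
    split; intros (y & Hy & ->); exists y; split; auto; rewrite graph_app; auto. }
  assert (Op : forall x, ordinal x -> ordinal (p x)).
  { apply ordinal_induction; [definability|]. intros x Ox IH.
    apply transitive_ordinals.
    - intros z Hz u Hu. apply Ep in Hz. apply Ep. destruct Hz as [Hz|(y & Hy & ->)].
      + left. eauto using ordinal_trans.
      + apply Ep in Hu. destruct Hu as [Hu|(y' & Hy' & ->)]; auto.
        right. exists y'. split; auto. eauto using ordinal_trans.
    - intros z Hz. apply Ep in Hz. destruct Hz as [Hz|(y & Hy & ->)]; auto.
      eauto using ordinal_mem. }
  assert (Opw : ordinal (p w)) by (apply Op, Lw).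
  assert (In : forall n, n ∈ w -> p n ∈ p w) by (intros n Hn; apply Ep; eauto).
  destruct (proj1 (proj2 Lw)) as [n0 Hn0].
  assert (Hbw : b ∈ p w).
  { destruct (ordinal_subset_le b (p n0)) as [H|H]; auto.
    - apply Op. apply (ordinal_mem w); auto. apply Lw.
    - intros z Hz. apply Ep. auto.
    - eauto using ordinal_trans.
    - rewrite H. auto. }
  destruct (ordinal_le_or k (p w) Ok Opw) as [L|L].
  - exfalso.
    assert (H1 := almost_all_notin b Hb).
    assert (H2 : almost_all (fun x => forall n, n ∈ w -> x <> p n)).
    { apply (almost_all_complete (fun n x => x <> p n)); auto; [definability|].
      intros n _. apply almost_all_neq. }
    destruct (almost_all_meet _ _ H1 H2) as (x & Hx & Nb & Np); [definability..|].
    apply (ord_le_subset _ _ Opw L) in Hx. apply Ep in Hx.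
    destruct Hx as [Hx|(n & Hn & ->)]; auto. exact (Np n Hn eq_refl).
  - exists (p w). split; [|split]; auto. split; [|split]; eauto.
    intros z Hz. apply Ep in Hz. destruct Hz as [Hz|(n & Hn & ->)].
    + exists b. auto.
    + exists (p (succ n)). split; [apply In; now apply limit_succ|].
      apply Ep. right. exists n. rewrite succE. auto.
Qed.

Lemma measurable_limit : limit_ordinal k.
Proof.
  split; [|split]; auto.
  - destruct Hw as (w & _ & H). eauto.
  - intros x Hx. destruct (limit_above x Hx) as (v & Hv & _ & H). eauto.
Qed.

Definition limit_part (b x : V) : Prop :=
  ord_le b x /\ ~ is_successor b /\
  forall c, ord_le c x -> ~ is_successor c -> ord_le c b.
Hint Unfold limit_part : set_unfold.

Lemma limit_part_exists x : ordinal x -> exists b, limit_part b x.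
Proof.
  revert x. apply ordinal_induction; [definability|]. intros x Ox IH.
  destruct (classic (is_successor x)) as [(y & Hy)|N].
  - assert (Hyx : y ∈ x) by (apply Hy; auto).
    destruct (IH y Hyx) as (b & Hb & Nb & Mb). exists b.
    assert (Oy : ordinal y) by (eauto using ordinal_mem).
    split; [|split]; auto.
    + left. destruct Hb as [Hb| ->]; auto. eauto using ordinal_trans.
    + intros c Hc Nc. apply Mb; auto. destruct Hc as [Hc| ->].
      * now apply Hy in Hc.
      * destruct Nc. now exists y.
  - exists x. split; [|split]; auto. now right.
Qed.

Lemma limit_part_unique b c x : ordinal x -> limit_part b x -> limit_part c x -> b = c.
Proof.
  intros Ox (H1 & H2 & H3) (H4 & H5 & H6).
  apply subset_antisym; apply ord_le_subset; eauto using ord_le_ordinal.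
Qed.

(* With R i b read as "i is in f(b)": an ordinal whose non-successors inject into
   the power set of some d < k is below k. *)
Lemma strong_limit (R : V -> V -> Prop) d l : definable (fun e => R (e 0) (e 1)) ->
  d ∈ k -> ordinal l ->
  (forall b c, b ∈ l -> c ∈ l -> ~ is_successor b -> ~ is_successor c ->
     (forall i, i ∈ d -> (R i b <-> R i c)) -> b = c) ->
  l ∈ k.
Proof.
  intros DR Hd Ol Inj.
  destruct (ordinal_le_or k l Ok Ol) as [L|]; auto. exfalso.
  assert (S := ord_le_subset k l Ol L).
  (* The measure lives on all of k, but f is injective only on non-successors; each x is therefore
     replaced by its limit part. *)
  set (P := fun i x => exists b, limit_part b x /\ R i b).
  assert (DP : definable (fun e => P (e 0) (e 1))) by (unfold P; definability).
  assert (DPi : forall i, definable (fun e => P i (e 0))) by (intros; definability).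
  (* The measure decides each statement that i is in f of the limit part of x. There are fewer than
     k many i, so completeness settles all of them at once: on a set of measure one this value of f
     is constant. *)
  set (Y := fun x => forall i, i ∈ d -> (P i x <-> almost_all (P i))).
  assert (DY : definable (fun e => Y (e 0))) by (unfold Y, almost_all; definability).
  assert (HY : almost_all Y).
  { apply (almost_all_complete (fun i x => P i x <-> almost_all (P i))); auto.
    - unfold almost_all. definability.
    - intros i Hi. destruct (classic (almost_all (P i))) as [H|H].
      + eapply (almost_all_mono (P i)); auto; [unfold almost_all; definability|tauto].
      + eapply (almost_all_mono (fun x => ~ P i x));
          [definability|unfold almost_all; definability|tauto|now apply almost_all_not]. }
  destruct (almost_all_exists Y DY HY) as (x0 & Hx0 & Y0).
  assert (Ox : forall x, x ∈ k -> ordinal x) by (intros; eauto using ordinal_mem).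
  destruct (limit_part_exists x0 (Ox _ Hx0)) as (b0 & T0).
  assert (Tk : forall b x, x ∈ k -> limit_part b x -> b ∈ k).
  { intros b x Hx [[H| ->] _]; auto. eauto using ordinal_trans. }
  assert (PR : forall b x i, x ∈ k -> limit_part b x -> (P i x <-> R i b)).
  { intros b x i Hx T. split.
    - intros (c & Tc & H). rewrite (limit_part_unique b c x); auto.
    - intros H. exists b. auto. }
  (* A point x >= v of that set has a limit part of at least v, hence above b0. Yet f takes the same
     value at both limit parts, against injectivity. *)
  destruct (limit_above b0) as (v & Hv & Lv & Hbv); [eauto|].
  assert (N := almost_all_notin v Hv).
  destruct (almost_all_meet _ _ HY N) as (x & Hx & Yx & Nx); [exact DY|definability|].
  destruct (limit_part_exists x (Ox _ Hx)) as (b & T).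
  assert (E : b = b0).
  { apply Inj; eauto; try apply T; try apply T0. intros i Hi.
    rewrite <- (PR b x), <- (PR b0 x0) by auto. now rewrite (Yx i Hi), (Y0 i Hi). }
  subst b. destruct (ordinal_le_or v x (Ox v Hv) (Ox x Hx)) as [Hvx|Hvx]; [|contradiction].
  destruct T as (T1 & T2 & T3). specialize (T3 v Hvx (limit_nonsucc _ Lv)).
  destruct T3 as [T3| ->]; [eapply mem_asym; eauto|eapply mem_irrefl; eauto].
Qed.

(** ** Images of measures *)

Definition push (F : V -> V) : V :=
  set_of (fun X => subset X k /\ almost_all (fun x => F x ∈ X)).

Lemma pushE F : definable_term (fun e => F (e 0)) -> forall X,
  X ∈ push F <-> subset X k /\ almost_all (fun x => F x ∈ X).
Proof.
  intros DF. apply (set_of_subE _ (power k)).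
  - intros X [H _]. now apply powerE.
  - unfold almost_all. definability.
Qed.

Lemma push_ultrafilter F : definable_term (fun e => F (e 0)) ->
  (forall x, x ∈ k -> F x ∈ k) -> complete_ultrafilter k k (push F).
Proof.
  intros DF HF.
  assert (D : forall X, definable (fun e => F (e 0) ∈ X)) by (intros; definability).
  assert (PE := pushE F DF).
  split; [split|].
  - intros X HX. now apply PE in HX.
  - apply PE. split; [intros x Hx; auto|].
    unfold almost_all. replace (sep k (fun x => F x ∈ k)) with k; [apply HU|].
    apply set_extensionality. intros x. rewrite sepE by auto. split; [auto|tauto].
  - intros X HX E. apply PE in HX as [_ HX].
    apply almost_all_exists in HX as (x & _ & H); auto. exact (E _ H).
  - intros X Y HX S SY. apply PE in HX as [_ HX]. apply PE. split; auto.
    eapply (almost_all_mono (fun x => F x ∈ X)); auto.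
  - intros X Y Z HX HY HZ. apply PE in HX as [SX HX], HY as [SY HY]. apply PE. split.
    + intros x Hx. apply HZ in Hx. apply SX; tauto.
    + eapply (almost_all_mono (fun x => F x ∈ X /\ F x ∈ Y)); auto; [definability|..].
      * intros x _ H. now apply HZ.
      * now apply almost_all_and.
  - intros X Y SX HY. destruct (classic (almost_all (fun x => F x ∈ X))) as [H|H].
    + left. now apply PE.
    + right. apply PE. split; [intros x Hx; now apply HY in Hx|].
      eapply (almost_all_mono (fun x => ~ F x ∈ X)); auto; [definability|..].
      * intros x Hx N. apply HY. auto.
      * now apply almost_all_not.
  - intros g f Z Hg [Hf Hfi] HZ. apply PE. split; [intros x Hx; now apply HZ in Hx|].
    apply (almost_all_mono (fun x => forall i, i ∈ g -> F x ∈ app f i)); auto; [definability|..].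
    + intros x Hx H. apply HZ. split; auto. intros i X Hm.
      rewrite (maps_app f g i X) by auto. apply H. eapply maps_dom; eauto.
    + apply (almost_all_complete (fun i x => F x ∈ app f i)); auto; [definability|].
      intros i Hi. apply PE. eapply Hfi, app_maps; eauto.
Qed.

(** If the image were concentrated at a, almost every x would be sent to a. Injectivity allows only
    one such x, and single points are null. *)
Lemma push_nonprincipal F : definable_term (fun e => F (e 0)) ->
  (forall x, x ∈ k -> F x ∈ k) ->
  (forall x y, x ∈ k -> y ∈ k -> F x = F y -> x = y) -> ~ principal k (push F).
Proof.
  intros DF HF Inj (a & Ha & H).
  assert (HX : upair a a ∈ push F).
  { apply H. split; [|apply upairE; auto]. intros x Hx. apply upairE in Hx.
    now destruct Hx; subst. }
  apply pushE in HX as [_ HX]; auto.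
  assert (D : definable (fun e => F (e 0) ∈ upair a a)) by definability.
  destruct (almost_all_exists _ D HX) as (x & Hx & Ex).
  destruct (almost_all_meet _ _ HX (almost_all_neq x)) as (y & Hy & Ey & Ny);
    [exact D|definability|].
  apply Ny, Inj; auto. apply upairE in Ex, Ey. intuition congruence.
Qed.

(** ** Coding subsets of k by measures *)

(** What matters is that the order type is at most k, so that every bounded subset gets an index
    below k. An arbitrary well-ordering need not do this; the enumeration proceeds by increasing
    bounds. *)
Lemma bounded_subsets_enumeration : exists E,
  (forall y z, maps E y z -> y ∈ k) /\
  (forall y z z', maps E y z -> maps E y z' -> z = z') /\
  (forall y y' z, maps E y z -> maps E y' z -> y = y') /\
  (forall z x, x ∈ k -> subset z x -> exists y, maps E y z).
Proof.
  set (B := sep (power k) (fun y => exists x, x ∈ k /\ subset y x)).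
  assert (HB : forall y, y ∈ B <-> exists x, x ∈ k /\ subset y x).
  { intros y. unfold B. rewrite sepE, powerE by definability. split; [tauto|].
    intros (x & Hx & S). split; [|eauto]. intros z Hz. eauto using ordinal_trans. }
  destruct (choice_function B) as (ch & Dch & Hch).
  (* [sel] takes, among the sets that remain, one whose least bound is minimal; the bounds then
     never decrease along the enumeration. *)
  set (bnd := fun X x : V => exists y, y ∈ X /\ subset y x).
  set (lev := fun X => least (bnd X)).
  assert (Dl : definable_term (fun e => lev (e 0))) by (unfold lev, bnd; definability).
  set (sel := fun X => ch (sep X (fun y => subset y (lev X)))).
  assert (Dsel : definable_term (fun e => sel (e 0))) by (unfold sel; definability).
  assert (DsX : forall X, definable (fun e => subset (e 0) (lev X))) by (intros; definability).
  assert (Dbnd : forall X, definable (fun e => bnd X (e 0))) by (intros; unfold bnd; definability).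
  assert (Hlev : forall X, subset X B -> (exists y, y ∈ X) ->
     ordinal (lev X) /\ bnd X (lev X) /\ forall b, b ∈ lev X -> ~ bnd X b).
  { intros X SX (y & Hy). apply least_spec; auto.
    destruct (proj1 (HB y) (SX y Hy)) as (x & Hx & Sx). exists x. split.
    - eauto using ordinal_mem.
    - exists y; auto. }
  assert (Hsel : forall X, subset X B -> (exists y, y ∈ X) ->
     sel X ∈ X /\ subset (sel X) (lev X)).
  { intros X SX NX. destruct (Hlev X SX NX) as (_ & (y & Hy & Sy) & _).
    apply (sepE X (fun y => subset y (lev X)) (DsX X)). apply Hch.
    - intros z Hz. apply SX. now apply (sepE X _ (DsX X)) in Hz.
    - exists y. now apply sepE. }
  destruct (enumeration B sel Dsel) as (a & E & Oa & HE & EE).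
  { intros X SX NX. now apply Hsel. }
  assert (FE : function_on E a) by apply HE.
  assert (BE := bijection_app _ _ _ HE). destruct BE as (B1 & B2 & B3).
  set (rest := fun b => sep B (fun y => forall c, c ∈ b -> y <> app E c)).
  assert (Hr : forall b y, y ∈ rest b <-> y ∈ B /\ forall c, c ∈ b -> y <> app E c).
  { intros b. apply sepE. definability. }
  assert (SR : forall b, subset (rest b) B) by (intros b y Hy; now apply Hr in Hy).
  assert (Hin : forall b, b ∈ a -> app E b ∈ rest b).
  { intros b Hb. apply Hr. split; auto. intros c Hc Ec.
    apply B2 in Ec; auto; [subst; eapply mem_irrefl; eauto|eauto using ordinal_trans]. }
  assert (Hak : forall b, b ∈ a -> b ∈ k).
  { intros b Hb.
    assert (Nb : exists y, y ∈ rest b) by eauto.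
    destruct (Hlev _ (SR b) Nb) as (Ol & (y & Hy & Sy) & Ml).
    assert (Hlk : lev (rest b) ∈ k).
    { destruct (proj1 (HB (app E b)) (B1 b Hb)) as (x & Hx & Sx).
      destruct (ordinal_le_or (lev (rest b)) x Ol) as [L|L].
      - eauto using ordinal_mem.
      - destruct L as [L| ->]; auto. eauto using ordinal_trans.
      - destruct (Ml x L). exists (app E b). auto. }
    assert (Hsub : forall c, c ∈ b -> subset (app E c) (lev (rest b))).
    { intros c Hc. assert (Hca : c ∈ a) by (eauto using ordinal_trans).
      assert (Hyc : y ∈ rest c).
      { apply Hr in Hy as [HyB Hy]. apply Hr. split; auto. intros u Hu. apply Hy.
        apply (ordinal_trans b c u); eauto using ordinal_mem. }
      assert (Nc : exists y, y ∈ rest c) by eauto.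
      destruct (Hlev _ (SR c) Nc) as (Oc & _ & Mc).
      assert (Lc : subset (lev (rest c)) (lev (rest b))).
      { destruct (ordinal_le_or (lev (rest c)) (lev (rest b)) Oc Ol) as [L|L].
        - now apply ord_le_subset.
        - destruct (Mc _ L). exists y; auto. }
      rewrite EE by auto. fold (rest c). intros i Hi. apply Lc.
      exact (proj2 (Hsel _ (SR c) Nc) i Hi). }
    (* The sets listed before stage b are distinct subsets of the single ordinal lev (rest b) < k,
       so b injects into its power set. *)
    apply (strong_limit (fun i c => i ∈ app E c) (lev (rest b))); auto.
    - definability.
    - eauto using ordinal_mem.
    - intros c c' Hc Hc' _ _ H. apply B2; try (eauto using ordinal_trans).
      apply set_extensionality. intros i. split; intros Hi.
      + apply H; auto. exact (Hsub c Hc i Hi).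
      + apply H; auto. exact (Hsub c' Hc' i Hi). }
  exists E. repeat split.
  - intros y z Hm. apply Hak. eapply maps_dom; eauto.
  - intros y z z' H1 H2. eapply maps_fun; eauto.
  - intros y y' z H1 H2. apply B2; try (eapply maps_dom; eauto).
    now rewrite <- (maps_app E a y z), <- (maps_app E a y' z).
  - intros z x Hx S. destruct (B3 z) as (y & Hy & Ey); [apply HB; eauto|].
    exists y. rewrite <- Ey. eapply app_maps; eauto.
Qed.

(** One and the same [E] decodes all the measures, which allows M to use the single set j(E).
    Decoding works because almost every x is above i, and for such x the traced set contains i
    exactly when A does. *)
Lemma coding_measures : exists (E : V) (code : V -> V),
  definable_term (fun e => code (e 0)) /\
  forall A, subset A k ->
    complete_ultrafilter k k (code A) /\ ~ principal k (code A) /\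
    forall i, i ∈ k ->
      (sep k (fun y => exists z, maps E y z /\ i ∈ z) ∈ code A <-> i ∈ A).
Proof.
  destruct bounded_subsets_enumeration as (E & E1 & E2 & E3 & E4).
  (* the added point x makes the map injective *)
  set (trace := fun A x => cup (sep A (fun i => i ∈ x)) (upair x x)).
  set (F := fun A x => the (fun y => maps E y (trace A x))).
  assert (DF : definable_term (fun e => F (e 0) (e 1))) by (unfold F, trace; definability).
  assert (DFA : forall A, definable_term (fun e => F A (e 0))) by (intros; definability).
  assert (Ht : forall A x i, i ∈ trace A x <-> i ∈ A /\ i ∈ x \/ i = x).
  { intros A x i. unfold trace. rewrite cupE, upairE, sepE by definability. tauto. }
  assert (HF : forall A x, x ∈ k -> maps E (F A x) (trace A x)).
  { intros A x Hx. destruct (E4 (trace A x) (succ x)) as (y & Hy).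
    - apply limit_succ; auto. apply measurable_limit.
    - intros i Hi. apply Ht in Hi. apply succE. tauto.
    - unfold F. rewrite (the_eq _ y); eauto. }
  assert (HFk : forall A x, x ∈ k -> F A x ∈ k) by eauto.
  exists E, (fun A => push (F A)). split; [unfold push, almost_all; definability|].
  intros A SA. split; [|split].
  - apply push_ultrafilter; auto.
  - apply push_nonprincipal; auto. intros x y Hx Hy Exy.
    assert (Et : trace A x = trace A y).
    { apply (E2 (F A x)); auto. rewrite Exy. auto. }
    assert (Hxy : x ∈ trace A y) by (rewrite <- Et; apply Ht; auto).
    assert (Hyx : y ∈ trace A x) by (rewrite Et; apply Ht; auto).
    apply Ht in Hxy, Hyx. destruct Hxy as [[_ Hxy]|Hxy]; auto.
    destruct Hyx as [[_ Hyx]|Hyx]; auto. exfalso. eapply mem_asym; eauto.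
  - intros i Hi.
    set (X := sep k (fun y => exists z, maps E y z /\ i ∈ z)).
    assert (HX : forall y, y ∈ X <-> y ∈ k /\ exists z, maps E y z /\ i ∈ z).
    { apply sepE. definability. }
    rewrite pushE by auto.
    assert (Big : almost_all (fun x => i ∈ x)).
    { apply (almost_all_mono (fun x => ~ x ∈ succ i)); try definability.
      - intros x Hx N. rewrite succE in N.
        destruct (proj2 Ok i x Hi Hx) as [H|[H|H]]; auto; exfalso; auto.
      - apply almost_all_notin, limit_succ; auto. apply measurable_limit. }
    assert (DX : definable (fun e => F A (e 0) ∈ X)) by definability.
    assert (Eq : forall x, x ∈ k -> i ∈ x -> (F A x ∈ X <-> i ∈ A)).
    { intros x Hx Hix. rewrite HX. split.
      - intros (_ & z & Hz & Hiz). rewrite (E2 _ _ _ Hz (HF A x Hx)) in Hiz.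
        apply Ht in Hiz. destruct Hiz as [[H _]|H]; auto. subst. exfalso. eapply mem_irrefl; eauto.
      - intros HiA. split; auto. exists (trace A x). split; auto. apply Ht. auto. }
    split.
    + intros [_ H]. destruct (almost_all_meet _ _ H Big) as (x & Hx & H1 & H2);
        [exact DX|definability|].
      now apply (Eq x).
    + intros HiA. split; [intros y Hy; now apply HX in Hy|].
      apply (almost_all_mono (fun x => i ∈ x)); auto; [definability|].
      intros x Hx Hix. now apply Eq.
Qed.

End Measure.
#[export] Hint Unfold limit_part : set_unfold.

(** * Relativized definability *)

Section Relative.
Context {V : set_structure} {hV : ZFC V}.
Implicit Types (P Q : (V -> Prop) -> (nat -> V) -> Prop).

Definition transitive_class (D : V -> Prop) : Prop := forall x y, D x -> y ∈ x -> D y.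

(* P D e is the relativization to D of one parameter-free formula, for all
   transitive classes D at once; a P that ignores D is thus absolute. *)
Definition relative P : Prop :=
  exists p, forall D e, transitive_class D -> (forall n, D (e n)) ->
    (sat D e p <-> P D e).

Lemma relative_ext P Q :
  (forall D e, transitive_class D -> (forall n, D (e n)) -> (P D e <-> Q D e)) ->
  relative P -> relative Q.
Proof.
  intros H (p & Hp). exists p. intros D e TD De. now rewrite Hp, H.
Qed.

Lemma relative_subst P (r : nat -> nat) :
  relative P -> relative (fun D e => P D (fun n => e (r n))).
Proof.
  intros (p & Hp). exists (rename r p). intros D e TD De.
  rewrite sat_rename. apply Hp; auto.
Qed.

Lemma relative_mem m n : relative (fun D e => e m ∈ e n).
Proof. exists (FMem m n). simpl; tauto. Qed.

Lemma relative_eq m n : relative (fun D e => e m = e n).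
Proof. exists (FEq m n). simpl; tauto. Qed.

Lemma relative_bot : relative (fun D e => False).
Proof. exists FBot. simpl; tauto. Qed.

Lemma relative_imp P Q : relative P -> relative Q -> relative (fun D e => P D e -> Q D e).
Proof.
  intros (p & Hp) (q & Hq). exists (FImp p q). intros D e TD De. simpl.
  now rewrite Hp, Hq.
Qed.

Lemma relative_and P Q : relative P -> relative Q -> relative (fun D e => P D e /\ Q D e).
Proof.
  intros HP HQ. apply (relative_ext (fun D e => (P D e -> Q D e -> False) -> False)).
  - intros; tauto.
  - auto using relative_imp, relative_bot.
Qed.

Lemma relative_or P Q : relative P -> relative Q -> relative (fun D e => P D e \/ Q D e).
Proof.
  intros HP HQ. apply (relative_ext (fun D e => (P D e -> False) -> Q D e)).
  - intros; tauto.
  - auto using relative_imp, relative_bot.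
Qed.

Lemma scons_class (D : V -> Prop) e x : D x -> (forall n, D (e n)) -> forall n, D (scons x e n).
Proof. intros Dx De [|n]; simpl; auto. Qed.

Lemma relative_all (Q : (V -> Prop) -> (nat -> V) -> V -> Prop) :
  relative (fun D e => Q D (fun n => e (S n)) (e 0)) ->
  relative (fun D e => forall x, D x -> Q D e x).
Proof.
  intros (q & Hq). exists (FAll q). intros D e TD De. simpl.
  split; intros H x Dx; specialize (H x Dx);
    apply (Hq D (scons x e) TD (scons_class D e x Dx De)); exact H.
Qed.

Lemma relative_ex (Q : (V -> Prop) -> (nat -> V) -> V -> Prop) :
  relative (fun D e => Q D (fun n => e (S n)) (e 0)) ->
  relative (fun D e => exists x, D x /\ Q D e x).
Proof.
  intros HQ. apply (relative_ext (fun D e => (forall x, D x -> Q D e x -> False) -> False)).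
  - intros D e _ _. split.
    + intros H. apply NNPP. intros N. apply H. eauto.
    + intros (x & Dx & Hx) H. eauto.
  - apply relative_imp; [|apply relative_bot].
    apply (relative_all (fun D e x => Q D e x -> False)).
    apply relative_imp; [exact HQ|apply relative_bot].
Qed.

(** In a transitive class, the elements of a member of the class all belong to it, so a bounded
    quantifier has the same range before and after relativization. *)
Lemma relative_ball n (Q : (V -> Prop) -> (nat -> V) -> V -> Prop) :
  relative (fun D e => Q D (fun n => e (S n)) (e 0)) ->
  relative (fun D e => forall x, x ∈ e n -> Q D e x).
Proof.
  intros HQ. apply (relative_ext (fun D e => forall x, D x -> x ∈ e n -> Q D e x)).
  - intros D e TD De. split; intros H x; [intros Hx; eauto|auto].
  - apply (relative_all (fun D e x => x ∈ e n -> Q D e x)).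
    apply relative_imp; [apply relative_mem|exact HQ].
Qed.

Lemma relative_bex n (Q : (V -> Prop) -> (nat -> V) -> V -> Prop) :
  relative (fun D e => Q D (fun n => e (S n)) (e 0)) ->
  relative (fun D e => exists x, x ∈ e n /\ Q D e x).
Proof.
  intros HQ. apply (relative_ext (fun D e => exists x, D x /\ (x ∈ e n /\ Q D e x))).
  - intros D e TD De. split.
    + intros (x & _ & H). eauto.
    + intros (x & Hx & H). exists x. split; eauto.
  - apply (relative_ex (fun D e x => x ∈ e n /\ Q D e x)).
    apply relative_and; [apply relative_mem|exact HQ].
Qed.

End Relative.

Ltac relativity_atom := fail.

Ltac relativity_step :=
  cbv beta; unfold iff, not;
  lazymatch goal with
  | |- relative (fun D e => @?P D e /\ @?Q D e) => apply (relative_and P Q)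
  | |- relative (fun D e => @?P D e \/ @?Q D e) => apply (relative_or P Q)
  | |- relative (fun D e => @?P D e -> @?Q D e) => apply (relative_imp P Q)
  | |- relative (fun D e => forall x, D x -> @?Q D e x) => apply (relative_all Q)
  | |- relative (fun D e => exists x, D x /\ @?Q D e x) => apply (relative_ex Q)
  | |- relative (fun D e => forall x, x ∈ e ?n -> @?Q D e x) => apply (relative_ball n Q)
  | |- relative (fun D e => exists x, x ∈ e ?n /\ @?Q D e x) => apply (relative_bex n Q)
  | |- relative (fun D e => e ?m ∈ e ?n) => apply (relative_mem m n)
  | |- relative (fun D e => e ?m = e ?n) => apply (relative_eq m n)
  | |- relative (fun D e => False) => apply relative_bot
  | _ => relativity_atom
  end.

Ltac relativity := solve [repeat relativity_step].

(** * Absoluteness of the basic notions, each rewritten with bounded quantifiers *)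

Section Absolute.
Context {V : set_structure} {hV : ZFC V}.

Lemma relative_subset m n : relative (fun (D : V -> Prop) e => subset (e m) (e n)).
Proof. unfold subset. relativity. Qed.

Lemma relative_is_upair m n q : relative (fun (D : V -> Prop) e => is_upair (e m) (e n) (e q)).
Proof.
  apply (relative_ext (fun D e => e n ∈ e m /\ e q ∈ e m /\
    forall x, x ∈ e m -> x = e n \/ x = e q)).
  - intros D e _ _. split.
    + intros (H1 & H2 & H3) z. split; auto. intros [-> | ->]; auto.
    + intros H. split; [|split]; intros; apply H; auto.
  - relativity.
Qed.

Lemma relative_is_opair m n q : relative (fun (D : V -> Prop) e => is_opair (e m) (e n) (e q)).
Proof.
  apply (relative_ext (fun D e => exists u, u ∈ e m /\ exists v, v ∈ e m /\
    (is_upair u (e n) (e n) /\ is_upair v (e n) (e q) /\ is_upair (e m) u v))).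
  - intros D e _ _. split.
    + intros (u & _ & v & _ & H). exists u, v. exact H.
    + intros (u & v & H1 & H2 & H3). exists u. split; [apply H3; auto|].
      exists v. split; [apply H3; auto|]. auto.
  - apply (relative_bex m (fun D e u => exists v, v ∈ e m /\
      (is_upair u (e n) (e n) /\ is_upair v (e n) (e q) /\ is_upair (e m) u v))).
    apply (relative_bex (S m) (fun D e v =>
      (is_upair (e 0) (e (S n)) (e (S n)) /\ is_upair v (e (S n)) (e (S q)) /\
       is_upair (e (S m)) (e 0) v))).
    repeat apply relative_and; apply relative_is_upair.
Qed.

Lemma relative_maps m n q : relative (fun (D : V -> Prop) e => maps (e m) (e n) (e q)).
Proof.
  apply (relative_ext (fun D e => exists p, p ∈ e m /\ is_opair p (e n) (e q))).
  - intros D e _ _. unfold maps. split; intros (p & H1 & H2); exists p; auto.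
  - apply (relative_bex m (fun D e p => is_opair p (e n) (e q))), relative_is_opair.
Qed.

(* x and y lie in elements of elements of f, so these quantifiers are bounded. *)
Lemma relative_all_maps n (Q : (V -> Prop) -> (nat -> V) -> V -> V -> Prop) :
  relative (fun D e => Q D (fun n => e (S (S n))) (e 1) (e 0)) ->
  relative (fun D e => forall x y, maps (e n) x y -> Q D e x y).
Proof.
  intros HQ.
  apply (relative_ext (fun D e => forall x, D x -> forall y, D y -> maps (e n) x y -> Q D e x y)).
  - intros D e TD De. split; intros H x; [|auto]. intros y Hm.
    assert (B := maps_bound _ _ _ Hm).
    assert (U : forall z, z ∈ union (union (e n)) -> D z).
    { intros z Hz. apply unionE in Hz as (u & Hu & Hz). apply unionE in Hu as (v & Hv & Hu).
      eauto. }
    apply H; auto; apply U, B.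
  - apply (relative_all (fun D e x => forall y, D y -> maps (e n) x y -> Q D e x y)).
    apply (relative_all (fun D e y => maps (e (S n)) (e 0) y ->
      Q D (fun n => e (S n)) (e 0) y)).
    apply relative_imp; [apply relative_maps|exact HQ].
Qed.

Lemma relative_ex_maps n (Q : (V -> Prop) -> (nat -> V) -> V -> V -> Prop) :
  relative (fun D e => Q D (fun n => e (S (S n))) (e 1) (e 0)) ->
  relative (fun D e => exists x y, maps (e n) x y /\ Q D e x y).
Proof.
  intros HQ.
  apply (relative_ext (fun D e =>
    (forall x y, maps (e n) x y -> Q D e x y -> False) -> False)).
  - intros D e _ _. split.
    + intros H. apply NNPP. intros N. apply H. eauto.
    + intros (x & y & Hm & Hx) H. eauto.
  - apply relative_imp; [|apply relative_bot].
    apply (relative_all_maps n (fun D e x y => Q D e x y -> False)).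
    apply relative_imp; [exact HQ|apply relative_bot].
Qed.

End Absolute.

Ltac relativity_atom ::=
  match goal with
  | |- relative (fun D e => forall x y, maps (e ?n) x y -> @?Q D e x y) =>
      apply (relative_all_maps n Q)
  | |- relative (fun D e => exists x y, maps (e ?n) x y /\ @?Q D e x y) =>
      apply (relative_ex_maps n Q)
  | _ => solve [auto with defs]
  end.

#[export] Hint Resolve relative_subset relative_is_upair relative_is_opair relative_maps : defs.

Section AbsoluteNotions.
Context {V : set_structure} {hV : ZFC V}.

Lemma relative_function_on m n : relative (fun (D : V -> Prop) e => function_on (e m) (e n)).
Proof.
  apply (relative_ext (fun D e =>
    (forall p, p ∈ e m -> exists x, x ∈ e n /\ exists u, u ∈ p /\ exists y, y ∈ u /\
       is_opair p x y) /\
    (forall x, x ∈ e n -> exists x' y, maps (e m) x' y /\ (x' = x /\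
       forall x'' y', maps (e m) x'' y' -> x'' = x -> y = y')))).
  - intros D e _ _. split; intros [H1 H2]; split.
    + intros p Hp. destruct (H1 p Hp) as (x & Hx & _ & _ & y & _ & H). eauto.
    + intros x Hx. destruct (H2 x Hx) as (x' & y & Hm & -> & U). exists y. split; eauto.
    + intros p Hp. destruct (H1 p Hp) as (x & y & Hx & H). exists x. split; auto.
      exists (upair x y). apply is_opairE in H. subst p. split; [apply upairE; auto|].
      exists y. split; [apply upairE; auto|]. now apply is_opairE.
    + intros x Hx. destruct (H2 x Hx) as (y & Hm & U). exists x, y. split; auto.
      split; auto. intros x'' y' Hm' ->. auto.
  - relativity.
Qed.

Lemma relative_ordinal n : relative (fun (D : V -> Prop) e => ordinal (e n)).
Proof.
  apply (relative_ext (fun D e => (forall x, x ∈ e n -> subset x (e n)) /\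
    forall x, x ∈ e n -> forall y, y ∈ e n -> x ∈ y \/ x = y \/ y ∈ x)).
  - intros D e _ _. unfold ordinal, transitive_set. split; intros [H1 H2]; auto.
  - relativity.
Qed.

Lemma relative_is_succ m n : relative (fun (D : V -> Prop) e => is_succ (e m) (e n)).
Proof.
  apply (relative_ext (fun D e => (forall x, x ∈ e m -> x ∈ e n \/ x = e n) /\
    (forall x, x ∈ e n -> x ∈ e m) /\ e n ∈ e m)).
  - intros D e _ _. split.
    + intros (H1 & H2 & H3) x. split; auto. intros [H| ->]; auto.
    + intros H. split; [|split]; intros; apply H; auto.
  - relativity.
Qed.
Hint Resolve relative_function_on relative_ordinal relative_is_succ : defs.

Lemma relative_is_successor n : relative (fun (D : V -> Prop) e => is_successor (e n)).
Proof.
  apply (relative_ext (fun D e => exists c, c ∈ e n /\ is_succ (e n) c)).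
  - intros D e _ _. split; intros (c & H); exists c; [apply H|].
    split; auto. apply H; auto.
  - relativity.
Qed.

Lemma relative_limit_ordinal n : relative (fun (D : V -> Prop) e => limit_ordinal (e n)).
Proof.
  apply (relative_ext (fun D e => ordinal (e n) /\
    (exists x, x ∈ e n /\ x = x) /\ (forall x, x ∈ e n -> exists y, y ∈ e n /\ x ∈ y))).
  - intros D e _ _. unfold limit_ordinal. split.
    + intros (H1 & (x & Hx & _) & H3). eauto.
    + intros (H1 & (x & Hx) & H3). eauto.
  - relativity.
Qed.

Lemma relative_function_into m n q :
  relative (fun (D : V -> Prop) e => function_into (e m) (e n) (e q)).
Proof. unfold function_into. relativity. Qed.

End AbsoluteNotions.

#[export] Hint Resolve relative_function_on relative_ordinal relative_is_succ
  relative_is_successor relative_limit_ordinal relative_function_into : defs.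

(* A variable is interpreted by a relation that defines its value, so that the value
   f(i) of a function can be plugged into a formula without a term for it. *)
Fixpoint rsat {V : set_structure} (D : V -> Prop) (r : nat -> V -> Prop) (p : formula) : Prop :=
  match p with
  | FMem m n => exists x, D x /\ exists y, D y /\ (r m x /\ r n y /\ x ∈ y)
  | FEq m n => exists x, D x /\ exists y, D y /\ (r m x /\ r n y /\ x = y)
  | FBot => False
  | FImp p q => rsat D r p -> rsat D r q
  | FAll p => forall x, D x ->
      rsat D (fun n => match n with O => eq x | S m => r m end) p
  end.

Section RSat.
Context {V : set_structure} {hV : ZFC V}.

(** Eliminating terms in favour of their graphs loses nothing when each relation holds of exactly
    one value and that value lies in D. *)
Lemma rsat_sat (D : V -> Prop) p : forall r v,
  (forall n y, r n y <-> y = v n) -> (forall n, D (v n)) -> (rsat D r p <-> sat D v p).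
Proof.
  induction p as [m n|m n| |p IHp q IHq|p IHp]; intros r v Hr Dv; simpl.
  - split.
    + intros (x & _ & y & _ & Hx & Hy & H). apply Hr in Hx, Hy. now subst.
    + intros H. exists (v m). split; auto. exists (v n). rewrite !Hr. auto.
  - split.
    + intros (x & _ & y & _ & Hx & Hy & H). apply Hr in Hx, Hy. now subst.
    + intros H. exists (v m). split; auto. exists (v n). rewrite !Hr. auto.
  - tauto.
  - now rewrite (IHp r v), (IHq r v).
  - assert (E : forall x, D x ->
      (rsat D (fun n => match n with O => eq x | S m => r m end) p <-> sat D (scons x v) p)).
    { intros x Dx. apply IHp.
      - intros [|n] y; simpl; [split; auto|apply Hr].
      - intros [|n]; simpl; auto. }
    split; intros H x Dx; apply E; auto.
Qed.

Lemma rsat_ext (D : V -> Prop) p : forall r r' : nat -> V -> Prop,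
  (forall n y, r n y <-> r' n y) -> (rsat D r p <-> rsat D r' p).
Proof.
  induction p as [m n|m n| |p IHp q IHq|p IHp]; intros r r' E; simpl.
  - split; intros (x & Dx & y & Dy & H); exists x; split; auto; exists y;
      rewrite !E in *; auto.
  - split; intros (x & Dx & y & Dy & H); exists x; split; auto; exists y;
      rewrite !E in *; auto.
  - tauto.
  - now rewrite (IHp r r'), (IHq r r').
  - split; intros H x Dx; specialize (H x Dx); revert H; apply IHp;
      intros [|n] y; first [tauto|apply E|symmetry; apply E].
Qed.

(** The relations may depend on the environment. Hence truth of p at the values f_n(i), with i
    itself quantified, is a single formula to which elementarity applies. *)
Lemma relative_rsat p : forall r : nat -> (nat -> V) -> V -> Prop,
  (forall n, relative (fun D e => r n (fun m => e (S m)) (e 0))) ->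
  relative (fun D e => rsat D (fun n => r n e) p).
Proof.
  assert (At : forall (r : nat -> (nat -> V) -> V -> Prop) m n R,
    (forall n, relative (fun D e => r n (fun m => e (S m)) (e 0))) ->
    relative (fun (D : V -> Prop) (e : nat -> V) => R (e 1) (e 0)) ->
    relative (fun D e => exists x, D x /\ exists y, D y /\ (r m e x /\ r n e y /\ R x y))).
  { intros r m n R Hr HR.
    apply (relative_ex (fun D e x => exists y, D y /\ (r m e x /\ r n e y /\ R x y))).
    apply (relative_ex (fun D e y => r m (fun m => e (S m)) (e 0) /\
      r n (fun m => e (S m)) y /\ R (e 0) y)).
    apply relative_and; [|apply relative_and; auto].
    - exact (relative_subst _ S (Hr m)).
    - exact (relative_subst _ (fun n => match n with O => O | S m => S (S m) end) (Hr n)). }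
  induction p as [m n|m n| |p IHp q IHq|p IHp]; intros r Hr; simpl.
  - apply At; auto. apply relative_mem.
  - apply At; auto. apply relative_eq.
  - apply relative_bot.
  - apply relative_imp; auto.
  - apply (relative_all (fun D e x =>
      rsat D (fun n => match n with O => eq x | S m => r m e end) p)).
    pose (r' := fun n (e : nat -> V) => match n with
      O => eq (e 0) | S m => r m (fun k => e (S k)) end).
    apply (relative_ext (fun D e => rsat D (fun n => r' n e) p)).
    + intros D e _ _. apply rsat_ext. intros [|n] y; reflexivity.
    + apply IHp. intros [|n]; simpl.
      * apply (relative_eq 1 0).
      * exact (relative_subst _ (fun n => match n with O => O | S m => S (S m) end) (Hr n)).
Qed.

End RSat.

(** * Elementary embeddings *)

Section DefinabilityTransfer.
Context {V : set_structure} {hV : ZFC V}.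

Lemma definable_function_term (F : V -> V) : definable_function F ->
  definable_term (fun e => F (e 0)).
Proof.
  intros (p & c & Hp).
  apply (definable_intro _ p (fun n => match n with O => inl 1 | S O => inl 0
    | S (S m) => inr m end) c).
  intros e. transitivity (F (e 1) = e 0); [split; auto|]. rewrite Hp.
  apply sat_ext. intros [|[|n]]; reflexivity.
Qed.

Lemma definable_term_function (F : V -> V) : definable_term (fun e => F (e 0)) ->
  definable_function F.
Proof.
  intros (p & c & Hp).
  exists (rename (fun n => match nat_split n with inl O => 1 | inl _ => O
    | inr m => S (S m) end) p), c.
  intros x y. rewrite sat_rename. specialize (Hp (scons y (fun _ => x))). simpl in Hp.
  transitivity (y = F x); [split; auto|]. rewrite Hp. apply sat_ext.
  intros n. now destruct (nat_split n) as [[|m]|m].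
Qed.

Lemma definable_class_intro (M : V -> Prop) : definable (fun e => M (e 0)) -> definable_class M.
Proof.
  intros (p & c & Hp).
  exists (rename (fun n => match nat_split n with inl _ => O | inr m => S m end) p), c.
  intros x. rewrite sat_rename, (Hp (fun _ => x)). apply sat_ext.
  intros n. now destruct (nat_split n).
Qed.

Lemma opair_in_power x y a : x ∈ a -> y ∈ a -> opair x y ∈ power (power a).
Proof.
  intros Hx Hy. apply powerE. intros u Hu. apply powerE. intros z Hz.
  apply upairE in Hu. destruct Hu as [-> | ->]; apply upairE in Hz; destruct Hz; subst; auto.
Qed.

End DefinabilityTransfer.

Section Embedding.
Context {V : set_structure} {hV : ZFC V}.
Context (M : V -> Prop) (j : V -> V).
Context (hj : elementary_embedding M j).

Lemma embedding_transitive : transitive_class M.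
Proof. exact (ee_transitive _ _ hj). Qed.

Lemma embedding_definable : definable_term (fun e => j (e 0)).
Proof. apply definable_function_term, hj. Qed.

Lemma transfer (P : (V -> Prop) -> (nat -> V) -> Prop) e : relative P ->
  (P (universe V) e <-> P M (fun n => j (e n))).
Proof.
  intros (p & Hp). rewrite <- !Hp.
  - apply hj.
  - apply embedding_transitive.
  - intros n. apply hj.
  - intros x y _ _. exact I.
  - intros n. exact I.
Qed.

Lemma transfer1 (P : (V -> Prop) -> V -> Prop) x :
  relative (fun D e => P D (e 0)) -> (P (universe V) x <-> P M (j x)).
Proof. intros H. apply (transfer _ (fun _ => x) H). Qed.

Lemma transfer2 (P : (V -> Prop) -> V -> V -> Prop) x y :
  relative (fun D e => P D (e 0) (e 1)) -> (P (universe V) x y <-> P M (j x) (j y)).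
Proof. intros H. apply (transfer _ (scons x (fun _ => y)) H). Qed.

Lemma transfer3 (P : (V -> Prop) -> V -> V -> V -> Prop) x y z :
  relative (fun D e => P D (e 0) (e 1) (e 2)) ->
  (P (universe V) x y z <-> P M (j x) (j y) (j z)).
Proof. intros H. apply (transfer _ (scons x (scons y (fun _ => z))) H). Qed.

Lemma transfer4 (P : (V -> Prop) -> V -> V -> V -> V -> Prop) x y z u :
  relative (fun D e => P D (e 0) (e 1) (e 2) (e 3)) ->
  (P (universe V) x y z u <-> P M (j x) (j y) (j z) (j u)).
Proof. intros H. apply (transfer _ (scons x (scons y (scons z (fun _ => u)))) H). Qed.

Lemma embedding_mem x y : x ∈ y <-> j x ∈ j y.
Proof. apply (transfer2 (fun D x y => x ∈ y)). relativity. Qed.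

Lemma embedding_maps f x y : maps f x y <-> maps (j f) (j x) (j y).
Proof. apply (transfer3 (fun D => maps)). relativity. Qed.

Lemma embedding_function_on f a : function_on f a <-> function_on (j f) (j a).
Proof. apply (transfer2 (fun D => function_on)). relativity. Qed.

Lemma embedding_subset a b : subset a b <-> subset (j a) (j b).
Proof. apply (transfer2 (fun D => subset)). relativity. Qed.

Lemma embedding_ordinal a : ordinal a <-> ordinal (j a).
Proof. apply (transfer1 (fun D => ordinal)). relativity. Qed.

Lemma target_opair x y : M x -> M y -> M (opair x y).
Proof.
  intros Mx My.
  (* The transferred sentence, pairing, has no parameter; the outer x merely fills the slot of
     [transfer1]. *)
  assert (H := transfer1 (fun D _ => forall x, D x -> forall y, D y ->
    exists p, D p /\ is_opair p x y) x ltac:(relativity)).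
  destruct (proj1 H) with (x := x) (y := y) as (p & Mp & Hp); auto.
  - intros u _ v _. exists (opair u v). split; [exact I|]. now apply is_opairE.
  - apply is_opairE in Hp. now subst.
Qed.

(** For the least b with j(b) < b, applying j gives j(j(b)) < j(b), so j(b) would be a smaller
    example. *)
Lemma embedding_ordinal_le a : ordinal a -> ord_le a (j a).
Proof.
  assert (Dj := embedding_definable).
  intros Oa. destruct (ordinal_le_or a (j a)) as [L|L]; auto.
  { now apply -> embedding_ordinal. }
  exfalso.
  destruct (least_ordinal (fun b => j b ∈ b) a) as (b & _ & Hb & Mb); auto.
  - definability.
  - apply (Mb (j b) Hb). now apply -> embedding_mem.
Qed.

Lemma target_ordinal a : ordinal a -> M a.
Proof.
  intros Oa. destruct (embedding_ordinal_le a Oa) as [H|H].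
  - eapply (ee_transitive _ _ hj); [apply (ee_into _ _ hj)|exact H].
  - rewrite H. apply (ee_into _ _ hj).
Qed.

Lemma critical_point_image k : critical_point j k -> k ∈ j k.
Proof.
  intros (Ok & N & F). destruct (embedding_ordinal_le k Ok) as [H|H]; auto.
  destruct N. auto.
Qed.

(** ** Hulls of a seed *)

Section Hull.
Context (A s : V).
Context (Hs : s ∈ j A).

Definition hull (x : V) : Prop := exists f, function_on f A /\ maps (j f) s x.

Lemma definable_hull : definable (fun e => hull (e 0)).
Proof. assert (Dj := embedding_definable). unfold hull. definability. Qed.
Hint Resolve definable_hull : defs.

Lemma hull_target x : hull x -> M x.
Proof.
  intros (f & _ & Hm). apply maps_bound in Hm as [_ Hx].
  apply unionE in Hx as (u & Hu & Hx). apply unionE in Hu as (v & Hv & Hu).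
  apply (embedding_transitive u); auto. apply (embedding_transitive v); auto.
  apply (embedding_transitive (j f)); auto. apply hj.
Qed.

Lemma seed_value f : function_on f A -> maps (j f) s (app (j f) s).
Proof.
  intros Hf. apply (app_maps _ (j A)); auto. now apply -> embedding_function_on.
Qed.

Lemma hull_value f : function_on f A -> hull (app (j f) s).
Proof. intros Hf. exists f. split; auto. now apply seed_value. Qed.

Lemma hull_inv x : hull x -> exists f, function_on f A /\ app (j f) s = x.
Proof.
  intros (f & Hf & Hm). exists f. split; auto. symmetry.
  apply (maps_app _ (j A)); auto. now apply -> embedding_function_on.
Qed.

Lemma embedding_const c a : is_const c A a -> app (j c) s = j a.
Proof.
  intros [Fc Hc]. symmetry. apply (maps_app _ (j A)); [now apply -> embedding_function_on|].
  apply (transfer3 (fun D A c a => forall i, i ∈ A -> maps c i a) A c a).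
  - relativity.
  - intros i Hi. rewrite <- (Hc i (app c i)); eapply app_maps; eauto.
  - exact Hs.
Qed.

Lemma hull_embedding x : hull (j x).
Proof.
  assert (D : definable_term (fun _ => x)) by definability.
  rewrite <- (embedding_const (graph A (fun _ => x))).
  - apply hull_value. now apply graph_function.
  - split; [now apply graph_function|]. intros i y Hm. now apply graph_maps in Hm.
Qed.

Lemma hull_seed : hull s.
Proof.
  assert (D : definable_term (fun e : nat -> V => e 0)) by definability.
  exists (graph A (fun x => x)). split; [apply (graph_function A (fun x => x) D)|].
  apply (proj1 (transfer2 (fun D A f => forall i, i ∈ A -> maps f i i) A _ ltac:(relativity))); auto.
  intros i Hi. now apply (graph_maps A (fun x => x) _ _ D).
Qed.

(** Łoś's theorem read in M: the truth set B of p satisfies in V an equivalence for all i in A, and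
    j carries it to an equivalence for all elements of j(A), in particular for s. *)
Lemma los (f : nat -> V) p : (forall n, function_on (f n) A) ->
  (sat M (fun n => app (j (f n)) s) p <->
   s ∈ j (sep A (fun i => sat (universe V) (fun n => app (f n) i) p))).
Proof.
  intros Hf.
  set (B := sep A (fun i => sat (universe V) (fun n => app (f n) i) p)).
  assert (HB : forall i, i ∈ B <-> i ∈ A /\ sat (universe V) (fun n => app (f n) i) p).
  { apply sepE. apply (definable_sat p (fun n e => app (f n) (e 0))).
    intros n. definability. }
  (* Places 0 and 1 of the environment hold A and B; the functions f_n start at place 2. *)
  pose (P := fun (D : V -> Prop) e => forall i, i ∈ e 0 ->
     (i ∈ e 1 <-> rsat D (fun n y => maps (e (2 + n)) i y) p)).
  assert (RP : relative P).
  { apply (relative_ball 0 (fun D e i =>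
      (i ∈ e 1 <-> rsat D (fun n y => maps (e (2 + n)) i y) p))).
    assert (R : relative (fun (D : V -> Prop) e => rsat D (fun n y => maps (e (3 + n)) (e 0) y) p)).
    { apply (relative_rsat p (fun n (e : nat -> V) y => maps (e (3 + n)) (e 0) y)). intros n.
      apply (relative_maps (4 + n) 1 0). }
    apply relative_and; apply relative_imp; auto; apply (relative_mem 0 2). }
  assert (T := transfer P (scons A (scons B f)) RP).
  assert (H : P M (fun n => j (scons A (scons B f) n))).
  { apply T. intros i Hi. simpl.
    rewrite (rsat_sat _ p _ (fun n => app (f n) i)).
    - rewrite HB. simpl in Hi. tauto.
    - intros n y. split.
      + intros Hm. now apply (maps_app _ A).
      + intros ->. eapply app_maps; eauto.
    - intros n. exact I. }
  specialize (H s Hs). simpl in H. rewrite H. symmetry. apply rsat_sat.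
  - intros n y. split.
    + intros Hm. apply (maps_app _ (j A)); auto. now apply -> embedding_function_on.
    + intros ->. now apply seed_value.
  - intros n. apply hull_target, hull_value, Hf.
Qed.

(** The Tarski-Vaught criterion by induction on p. For a quantifier, a function F on A choosing
    counterexamples is available in V, and j(F)(s) is a value in the hull at which the hypothesis
    can be tested. *)
Lemma hull_elementary p : forall e, (forall n, hull (e n)) -> (sat hull e p <-> sat M e p).
Proof.
  induction p as [m n|m n| |p IHp q IHq|p IHp]; intros e He; simpl; try tauto.
  - now rewrite IHp, IHq.
  - split; [|intros H x Hx; apply IHp; [now apply scons_class|];
      apply H, hull_target, Hx].
    intros H. apply NNPP. intros N.
    (* The environment is an external sequence, so the representing functions are chosen in the
       metatheory, for all n at once. *)
    assert (Cf : exists f : nat -> V, forall n, function_on (f n) A /\ app (j (f n)) s = e n).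
    { exists (fun n => epsilon universe_inhabited
        (fun f => function_on f A /\ app (j f) s = e n)).
      intros n. apply epsilon_spec, hull_inv, He. }
    destruct Cf as (f & Hf).
    assert (Ff : forall n, function_on (f n) A) by (intros n; apply Hf).
    pose (R := fun i x => ~ sat (universe V) (scons x (fun n => app (f n) i)) p).
    assert (DR : definable (fun e => R (e 0) (e 1))).
    { apply definable_not.
      apply (definable_ext (fun e => sat (universe V)
        (fun n => match n with O => e 1 | S m => app (f m) (e 0) end) p)).
      - intros e'. apply sat_ext. intros [|n]; reflexivity.
      - apply (definable_sat p (fun n e => match n with O => e 1 | S m => app (f m) (e 0) end)).
        intros [|n]; definability. }
    destruct (definable_choice R A DR) as (F & FF & HF).
    pose (f' := fun n => match n with O => F | S m => f m end).
    assert (Ff' : forall n, function_on (f' n) A) by (intros [|n]; simpl; auto).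
    assert (L1 := los f (FAll p) Ff).
    assert (L2 := los f' p Ff').
    set (B1 := sep A (fun i => sat (universe V) (fun n => app (f n) i) (FAll p))) in L1.
    set (B2 := sep A (fun i => sat (universe V) (fun n => app (f' n) i) p)) in L2.
    assert (HB1 : forall i, i ∈ B1 <-> i ∈ A /\ sat (universe V) (fun n => app (f n) i) (FAll p)).
    { apply sepE. apply (definable_sat (FAll p) (fun n e => app (f n) (e 0))).
      intros n. definability. }
    assert (HB2 : forall i, i ∈ B2 <-> i ∈ A /\ sat (universe V) (fun n => app (f' n) i) p).
    { apply sepE. apply (definable_sat p (fun n e => app (f' n) (e 0))).
      intros n. definability. }
    (* F(i) is a counterexample whenever one exists; if p holds at F(i), it therefore holds at every
       x. *)
    assert (S21 : subset B2 B1).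
    { intros i Hi. apply HB2 in Hi as [Hi Hp]. apply HB1. split; auto.
      apply NNPP. intros Nx.
      assert (Ex : exists x, R i x).
      { apply NNPP. intros Nx'. apply Nx. simpl. intros x _. apply NNPP.
        intros Nx''. apply Nx'. exists x. exact Nx''. }
      apply (HF i Hi Ex). revert Hp. apply sat_ext. intros [|n]; reflexivity. }
    assert (HsB2 : s ∈ j B2).
    { apply L2. assert (Hh : hull (app (j F) s)) by now apply hull_value.
      assert (H' : sat M (scons (app (j F) s) e) p).
      { apply IHp; [now apply scons_class|]. apply H, Hh. }
      revert H'. apply sat_ext. intros [|n]; simpl; auto. apply Hf. }
    apply N. apply (embedding_subset B2 B1) in S21. apply S21, L1 in HsB2.
    assert (E : sat M e (FAll p)).
    { revert HsB2. apply sat_ext. intros n. symmetry. apply Hf. }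
    exact E.
Qed.

(** The form in which elementarity is used: an object that M can single out by a formula with
    parameters from the hull lies in the hull. *)
Lemma hull_witness (Q : (V -> Prop) -> (nat -> V) -> V -> Prop) e :
  relative (fun D e => Q D (fun n => e (S n)) (e 0)) -> (forall n, hull (e n)) ->
  (exists x, M x /\ Q M e x) -> exists x, hull x /\ Q M e x.
Proof.
  intros (q & Hq) He (x & Mx & Hx). apply NNPP. intros N.
  assert (Neg : sat hull e (FAll (FImp q FBot))).
  { simpl. intros y Hy Hs'. apply N. exists y. split; auto.
    apply hull_elementary in Hs'; [|now apply scons_class].
    apply (Hq M (scons y e)) in Hs'; auto.
    - apply embedding_transitive.
    - intros n. apply hull_target. now apply scons_class. }
  apply hull_elementary in Neg; auto. apply (Neg x Mx).
  apply (Hq M (scons x e)); auto.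
  - apply embedding_transitive.
  - apply scons_class; auto. intros n. apply hull_target; auto.
Qed.

Lemma hull_witness1 (Q : (V -> Prop) -> V -> V -> Prop) a :
  relative (fun D e => Q D (e 1) (e 0)) -> hull a ->
  (exists x, M x /\ Q M a x) -> exists x, hull x /\ Q M a x.
Proof. intros H Ha. apply (hull_witness (fun D e => Q D (e 0)) (fun _ => a)); auto. Qed.

Lemma hull_witness2 (Q : (V -> Prop) -> V -> V -> V -> Prop) a b :
  relative (fun D e => Q D (e 1) (e 2) (e 0)) -> hull a -> hull b ->
  (exists x, M x /\ Q M a b x) -> exists x, hull x /\ Q M a b x.
Proof.
  intros H Ha Hb.
  apply (hull_witness (fun D e => Q D (e 0) (e 1)) (scons a (fun _ => b))); auto.
  now apply scons_class.
Qed.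

Lemma hull_witness3 (Q : (V -> Prop) -> V -> V -> V -> V -> Prop) a b c :
  relative (fun D e => Q D (e 1) (e 2) (e 3) (e 0)) -> hull a -> hull b -> hull c ->
  (exists x, M x /\ Q M a b c x) -> exists x, hull x /\ Q M a b c x.
Proof.
  intros H Ha Hb Hc.
  apply (hull_witness (fun D e => Q D (e 0) (e 1) (e 2))
    (scons a (scons b (fun _ => c)))); auto.
  now repeat apply scons_class.
Qed.

Lemma hull_opair x y : hull x -> hull y -> hull (opair x y).
Proof.
  intros Hx Hy. destruct (hull_witness2 (fun D x y p => is_opair p x y) x y) as (p & Hp & E);
    auto.
  - relativity.
  - exists (opair x y). split; [apply target_opair; now apply hull_target|].
    now apply is_opairE.
  - apply is_opairE in E. now subst.
Qed.

Lemma hull_maps f x y : hull f -> hull x -> maps f x y ->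
  (forall y', maps f x y' -> y' = y) -> hull y.
Proof.
  intros Hf Hx Hm U.
  destruct (hull_witness2 (fun D f x y => maps f x y) f x) as (z & Hz & E); auto.
  - relativity.
  - exists y. split; auto. apply maps_bound in Hm as [_ H].
    apply unionE in H as (u & Hu & H). apply unionE in Hu as (v & Hv & Hu).
    apply (embedding_transitive u); auto. apply (embedding_transitive v); auto.
    apply (embedding_transitive f); auto. now apply hull_target.
  - now rewrite <- (U z).
Qed.

(** ** The collapse of the hull *)

(** The Mostowski collapse of the hull. The recursion runs through all sets and skips the members
    outside the hull. *)
Definition collapse_step (x f : V) : V := image (sep x hull) (app f).
Definition collapse : V -> V := mem_rec collapse_step.

Lemma definable_collapse_step : definable_term (fun e => collapse_step (e 0) (e 1)).
Proof. unfold collapse_step. definability. Qed.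

Lemma definable_collapse : definable_term (fun e => collapse (e 0)).
Proof. apply definable_mem_rec, definable_collapse_step. Qed.
Hint Resolve definable_collapse : defs.

Lemma collapseE x z : z ∈ collapse x <-> exists y, y ∈ x /\ hull y /\ z = collapse y.
Proof.
  unfold collapse at 1. rewrite mem_rec_eq by apply definable_collapse_step.
  fold collapse. unfold collapse_step. rewrite imageE by definability. split.
  - intros (y & Hy & ->). apply sepE in Hy as [Hy Hh]; [|apply definable_hull].
    exists y. rewrite graph_app; auto with defs.
  - intros (y & Hy & Hh & ->). exists y. rewrite sepE by apply definable_hull.
    rewrite graph_app; auto with defs.
Qed.

(** M sees an element in the difference of two distinct sets, and by elementarity one can be found
    in the hull. *)
Lemma hull_extensional x y : hull x -> hull y ->
  (forall z, hull z -> (z ∈ x <-> z ∈ y)) -> x = y.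
Proof.
  assert (H : forall x y, hull x -> hull y -> (forall z, hull z -> z ∈ x -> z ∈ y) -> subset x y).
  { intros u v Hu Hv H z Hz. apply NNPP. intros N.
    destruct (hull_witness2 (fun D x y z => z ∈ x /\ ~ z ∈ y) u v) as (t & Ht & E1 & E2); auto.
    - relativity.
    - exists z. split; auto. apply (embedding_transitive u); auto. now apply hull_target. }
  intros Hx Hy E. apply subset_antisym; apply H; auto; intros z Hz; now apply E.
Qed.

Lemma collapse_inj x y : hull x -> hull y -> collapse x = collapse y -> x = y.
Proof.
  revert y. revert x. apply (mem_induction (fun x => forall y, hull x -> hull y ->
    collapse x = collapse y -> x = y)); [definability|].
  intros x IH y Hx Hy E. apply hull_extensional; auto. intros z Hz. split; intros Hm.
  - assert (H : collapse z ∈ collapse y) by (rewrite <- E; apply collapseE; eauto).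
    apply collapseE in H as (z' & Hz' & Hh & Ez). now rewrite (IH z Hm z').
  - assert (H : collapse z ∈ collapse x) by (rewrite E; apply collapseE; eauto).
    apply collapseE in H as (z' & Hz' & Hh & Ez). rewrite <- (IH z' Hz' z); auto.
Qed.

Lemma collapse_mem x y : hull x -> hull y -> (x ∈ y <-> collapse x ∈ collapse y).
Proof.
  intros Hx Hy. rewrite collapseE. split; [eauto|].
  intros (z & Hz & Hh & E). now rewrite (collapse_inj x z).
Qed.

Definition collapsed (y : V) : Prop := exists x, hull x /\ y = collapse x.

Lemma collapsed_transitive : transitive_class collapsed.
Proof.
  intros x y (x' & Hx & ->) Hy. apply collapseE in Hy as (y' & _ & H). exists y'. auto.
Qed.

Lemma sat_collapse p : forall e, (forall n, hull (e n)) ->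
  (sat hull e p <-> sat collapsed (fun n => collapse (e n)) p).
Proof.
  induction p as [m n|m n| |p IHp q IHq|p IHp]; intros e He; simpl.
  - now apply collapse_mem.
  - split; [congruence|]. now apply collapse_inj.
  - tauto.
  - now rewrite IHp, IHq.
  - assert (E : forall x, hull x ->
      (sat hull (scons x e) p <-> sat collapsed (scons (collapse x) (fun n => collapse (e n))) p)).
    { intros x Hx. rewrite IHp by now apply scons_class.
      apply sat_ext. intros [|n]; reflexivity. }
    split.
    + intros H y (x & Hx & ->). apply E; auto.
    + intros H x Hx. apply E; auto. apply H. exists x. auto.
Qed.

Lemma collapse_transfer (P : (V -> Prop) -> (nat -> V) -> Prop) e : relative P ->
  (forall n, hull (e n)) -> (P M e <-> P collapsed (fun n => collapse (e n))).
Proof.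
  intros (p & Hp) He. rewrite <- !Hp.
  - rewrite <- hull_elementary by auto. now apply sat_collapse.
  - apply collapsed_transitive.
  - intros n. exists (e n). auto.
  - apply embedding_transitive.
  - intros n. now apply hull_target.
Qed.

Lemma collapse_opair x y : hull x -> hull y ->
  collapse (opair x y) = opair (collapse x) (collapse y).
Proof.
  intros Hx Hy. apply is_opairE.
  apply (collapse_transfer (fun D e => is_opair (e 0) (e 1) (e 2))
    (scons (opair x y) (scons x (fun _ => y)))).
  - relativity.
  - repeat apply scons_class; auto using hull_opair.
  - now apply is_opairE.
Qed.

Lemma collapse_ordinal x : hull x -> ordinal x -> ordinal (collapse x).
Proof.
  intros Hx. apply (collapse_transfer (fun D e => ordinal (e 0)) (fun _ => x)); auto.
  relativity.
Qed.

Definition hull_map (x : V) : V := collapse (j x).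

Lemma hull_map_elementary : elementary_embedding collapsed hull_map.
Proof.
  assert (Dj := embedding_definable).
  split.
  - apply definable_class_intro. unfold collapsed. definability.
  - apply definable_term_function. unfold hull_map. definability.
  - exact collapsed_transitive.
  - intros x. exists (j x). split; auto. apply hull_embedding.
  - intros p e. rewrite (ee_elementary _ _ hj p e).
    rewrite <- hull_elementary by (intros; apply hull_embedding).
    apply sat_collapse. intros; apply hull_embedding.
Qed.

Definition seed_measure : V := sep (power A) (fun X => s ∈ j X).

Lemma seed_measureE X : X ∈ seed_measure <-> subset X A /\ s ∈ j X.
Proof.
  assert (Dj := embedding_definable).
  unfold seed_measure. rewrite <- powerE. apply (sepE (power A) (fun X => s ∈ j X)). definability.
Qed.

(** The atomic cases of Łoś's theorem, in the shape that [ultrapower_embedding] asks for. R is a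
    variable so that equality and membership share one proof. *)
Lemma seed_relation (R : V -> V -> Prop) f g : function_on f A -> function_on g A ->
  definable (fun e => R (e 0) (e 1)) ->
  relative (fun (D : V -> Prop) e => R (e 0) (e 1)) ->
  (R (app (j f) s) (app (j g) s) <->
   exists X, X ∈ seed_measure /\
     forall i, i ∈ X <-> i ∈ A /\ exists x y, maps f i x /\ maps g i y /\ R x y).
Proof.
  intros Hf Hg DR RR.
  set (X := sep A (fun i => exists x y, maps f i x /\ maps g i y /\ R x y)).
  assert (HX : forall i, i ∈ X <-> i ∈ A /\ exists x y, maps f i x /\ maps g i y /\ R x y).
  { apply sepE. definability. }
  assert (T : s ∈ j X <-> R (app (j f) s) (app (j g) s)).
  { assert (H := transfer4 (fun D A X f g => forall i, i ∈ A -> (i ∈ X <->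
      exists i' x, maps f i' x /\ (i' = i /\
        exists i'' y, maps g i'' y /\ (i'' = i /\ R x y)))) A X f g).
    assert (H' := fun P1 P2 => proj1 (H P1) P2 s Hs). rewrite H'.
    - split.
      + intros (i & x & Hm & -> & i' & y & Hm' & -> & HR).
        apply (maps_app _ (j A)) in Hm; [|now apply -> embedding_function_on].
        apply (maps_app _ (j A)) in Hm'; [|now apply -> embedding_function_on].
        now subst.
      + intros HR. exists s, (app (j f) s). split; [now apply seed_value|]. split; auto.
        exists s, (app (j g) s). split; [now apply seed_value|]. auto.
    - assert (RR' : relative (fun (D : V -> Prop) e => R (e 2) (e 0))).
      { exact (relative_subst _ (fun n => match n with O => 2 | _ => 0 end) RR). }
      apply (relative_ball 0 (fun D e i => (i ∈ e 1 <->
        exists i' x, maps (e 2) i' x /\ (i' = i /\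
        exists i'' y, maps (e 3) i'' y /\ (i'' = i /\ R x y))))).
      assert (R1 : relative (fun (D : V -> Prop) e => exists i' x, maps (e 3) i' x /\ (i' = e 0 /\
        exists i'' y, maps (e 4) i'' y /\ (i'' = e 0 /\ R x y)))).
      { relativity_step. apply relative_and; [relativity|].
        relativity_step. apply relative_and; [relativity|]. exact RR'. }
      apply relative_and; apply relative_imp; auto; relativity.
    - intros i Hi. rewrite HX. split.
      + intros (_ & x & y & H1 & H2 & H3). exists i, x. split; auto. split; auto.
        exists i, y. auto.
      + intros (i' & x & H1 & -> & i'' & y & H2 & -> & H3). eauto 6. }
  rewrite <- T. split.
  - intros H. exists X. split; auto. apply seed_measureE. split; auto.
    intros i Hi. now apply HX in Hi.
  - intros (X' & HX' & E). replace X with X'.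
    + now apply seed_measureE in HX'.
    + apply set_extensionality. intros i. now rewrite HX.
Qed.

Lemma hull_ultrapower : ultrapower_embedding A seed_measure collapsed hull_map.
Proof.
  assert (Dj := embedding_definable).
  split; [exact collapsed_transitive|].
  exists (fun f => collapse (app (j f) s)). split; [|split; [|split; [|split]]].
  - apply definable_term_function. definability.
  - intros y. split.
    + intros (x & Hx & ->). apply hull_inv in Hx as (f & Hf & <-). eauto.
    + intros (f & Hf & <-). exists (app (j f) s). split; auto. now apply hull_value.
  - intros f g Hf Hg.
    assert (H := seed_relation eq f g Hf Hg ltac:(definability) ltac:(relativity)).
    transitivity (app (j f) s = app (j g) s).
    + split; [|congruence]. apply collapse_inj; now apply hull_value.
    + rewrite H. split; intros (X & HX & E); exists X; split; auto; intros i; rewrite E;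
        apply and_iff_compat_l; split.
      * intros (x & y & H1 & H2 & <-). eauto.
      * intros (x & H1 & H2). eauto.
      * intros (x & H1 & H2). eauto.
      * intros (x & y & H1 & H2 & <-). eauto.
  - intros f g Hf Hg.
    assert (H := seed_relation mem f g Hf Hg ltac:(definability) ltac:(relativity)).
    rewrite <- H. symmetry. apply collapse_mem; now apply hull_value.
  - intros a c Hc. unfold hull_map. now rewrite (embedding_const c a).
Qed.

(** Each clause is j applied to a statement about subsets of A. For completeness, g < k gives j(g) =
    g and j(F)(b) = j(F(b)) for b < g, so s lies in all members of the family j(F). *)
Lemma seed_measure_ultrafilter k : critical_point j k ->
  complete_ultrafilter k A seed_measure.
Proof.
  intros (Ok & _ & Fix).
  split; [split|].
  - intros X HX. now apply seed_measureE in HX.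
  - apply seed_measureE. split; auto. intros x; auto.
  - intros X HX E. apply seed_measureE in HX as [_ HX].
    assert (H := transfer1 (fun D X => forall x, x ∈ X -> False) X ltac:(relativity)).
    apply (proj1 H) in HX; auto.
  - intros X Y HX SX SY. apply seed_measureE in HX as [_ HX]. apply seed_measureE.
    split; auto. apply -> embedding_subset in SX. auto.
  - intros X Y Z HX HY HZ. apply seed_measureE in HX as [SX HX], HY as [SY HY].
    apply seed_measureE. split; [intros x Hx; apply SX; now apply HZ|].
    assert (H := transfer3 (fun D X Y Z => forall x, x ∈ X -> x ∈ Y -> x ∈ Z) X Y Z
      ltac:(relativity)).
    apply (proj1 H); auto. intros x H1 H2. apply HZ. auto.
  - intros X Y SX HY. rewrite !seed_measureE.
    assert (SY : subset Y A) by (intros x Hx; now apply HY in Hx).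
    assert (H := transfer3 (fun D X Y Z => forall x, x ∈ X -> x ∈ Y \/ x ∈ Z) A X Y
      ltac:(relativity)).
    assert (T : s ∈ j X \/ s ∈ j Y); [|tauto].
    apply (proj1 H); auto. intros x Hx. destruct (classic (x ∈ X)); auto.
    right. apply HY. auto.
  - intros g F Z Hg [HF HFi] HZ. apply seed_measureE.
    split; [intros x Hx; now apply HZ in Hx|].
    assert (H := transfer3 (fun D A F Z => forall x, x ∈ A ->
      (forall b X, maps F b X -> x ∈ X) -> x ∈ Z) A F Z ltac:(relativity)).
    apply (proj1 H); auto.
    + intros x Hx HX. apply HZ. auto.
    + intros b X Hm. assert (HF' := proj1 (embedding_function_on F g) HF).
      assert (Hb : b ∈ j g) by (eapply maps_dom; eauto).
      rewrite (Fix g Hg) in Hb.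
      assert (Eb : j b = b) by (apply Fix; eauto using ordinal_trans).
      assert (Hm' := app_maps F g b HF Hb).
      assert (HXb := HFi _ _ Hm'). apply seed_measureE in HXb as [_ HXb].
      apply -> embedding_maps in Hm'. rewrite Eb in Hm'.
      now rewrite (maps_fun _ _ _ _ _ HF' Hm Hm').
Qed.

Section CriticalPoint.
Context (k : V).
Context (Hk : critical_point j k).
Context (Hhk : hull k).

Lemma hull_below_critical i : i ∈ k -> hull i.
Proof. intros Hi. destruct Hk as (_ & _ & F). rewrite <- (F i Hi). apply hull_embedding. Qed.

(** All ordinals below k are fixed by j and therefore lie in the hull, so nothing is skipped when k
    or a smaller ordinal is collapsed. *)
Lemma collapse_fix i : ord_le i k -> collapse i = i.
Proof.
  destruct Hk as (Ok & _ & _).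
  intros Hi. assert (Oi : ordinal i) by (eapply ord_le_ordinal; eauto).
  revert i Oi Hi.
  apply (ordinal_induction (fun i => ord_le i k -> collapse i = i)); [definability|].
  intros i Oi IH Hi. assert (Si := ord_le_subset _ _ Ok Hi).
  apply set_extensionality. intros z. rewrite collapseE. split.
  - intros (y & Hy & _ & ->). rewrite IH; auto. left. auto.
  - intros Hz. exists z. split; auto. split; [apply hull_below_critical; auto|].
    rewrite IH; auto. left. auto.
Qed.

Lemma hull_map_critical : critical_point hull_map k.
Proof.
  assert (Hkk := critical_point_image k Hk).
  destruct Hk as (Ok & _ & F). split; [|split]; auto.
  - unfold hull_map. intros E. apply (mem_irrefl k).
    assert (H : collapse k ∈ collapse (j k)).
    { apply -> collapse_mem; auto. apply hull_embedding. }
    rewrite E, collapse_fix in H; auto. now right.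
  - intros a Ha. unfold hull_map. rewrite F by auto. apply collapse_fix. now left.
Qed.

(** Functions F(i) representing the terms of the sequence are chosen in V. The sequence of the
    j(F(i))(s) is then definable in M from j(F), k and s, hence in the hull, and it collapses to
    [f]. *)
Lemma hull_closed_under_seqs : closed_under_seqs collapsed k.
Proof.
  assert (Dj := embedding_definable).
  destruct Hk as (Ok & _ & Fix).
  intros f Hf Hfv.
  destruct (definable_choice (fun i h => function_on h A /\ collapse (app (j h) s) = app f i) k)
    as (F & HF & HFv); [definability|].
  assert (HF' : forall i, i ∈ k -> function_on (app F i) A /\
     collapse (app (j (app F i)) s) = app f i).
  { intros i Hi. apply HFv; auto.
    destruct (Hfv i (app f i)) as (x & Hx & E); [eapply app_maps; eauto|].
    apply hull_inv in Hx as (h & Hh & <-). eauto. }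
  assert (HjF := proj1 (embedding_function_on F k) HF).
  (* Since i < k is fixed by j, the one element j(F) of the hull carries all the functions
     j(F(i)). *)
  assert (HFi : forall i, i ∈ k -> maps (j F) i (j (app F i))).
  { intros i Hi. rewrite <- (Fix i Hi) at 1. apply -> embedding_maps. eapply app_maps; eauto. }
  (* t is the sequence of the j(F(i))(s) for i < k *)
  set (Q := fun (D : V -> Prop) F k s t => forall p, D p -> (p ∈ t <->
     exists i h, maps F i h /\ (i ∈ k /\ exists s' y, maps h s' y /\ (s' = s /\
       is_opair p i y)))).
  assert (RQ : relative (fun D e => Q D (e 1) (e 2) (e 3) (e 0))) by (unfold Q; relativity).
  assert (Ex : forall F k s, M F -> M k -> M s -> exists t, M t /\ Q M F k s t).
  { intros F0 k0 s0 MF Mk Ms.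
    (* That such a t exists for arbitrary F, k and s is provable in V by Separation; M inherits this
       as a sentence. *)
    assert (T := transfer1 (fun D _ => forall F, D F -> forall k, D k -> forall s, D s ->
      exists t, D t /\ Q D F k s t) s ltac:(unfold Q; relativity)).
    apply (proj1 T); auto. clear -hV Q. intros F _ k _ s _.
    set (P := fun p => exists i h, maps F i h /\ (i ∈ k /\ exists s' y, maps h s' y /\ (s' = s /\
       is_opair p i y))).
    exists (set_of P). split; [exact I|]. intros p _.
    apply (set_of_subE P (power (power (cup k (union (union (union (union (union F))))))))).
    - clear p. intros p (i & h & Hm & Hi & s' & y & Hm' & _ & Hp). apply is_opairE in Hp.
      subst p. apply opair_in_power; apply cupE; auto. right.
      apply maps_bound in Hm as [_ Hh]. apply maps_bound in Hm' as [_ Hy].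
      apply unionE in Hy as (u & Hu & Hy). apply unionE in Hu as (v & Hv & Hu).
      apply unionE. exists u. split; auto. apply unionE. exists v. split; auto.
      apply unionE. eauto.
    - unfold P. definability. }
  assert (HjFh := hull_embedding F).
  destruct (hull_witness3 Q (j F) k s RQ HjFh Hhk hull_seed) as (t & Ht & Qt).
  { apply Ex; auto using hull_target, hull_seed. }
  assert (Qt' : forall p, p ∈ t <-> exists i, i ∈ k /\ p = opair i (app (j (app F i)) s)).
  { intros p. split.
    - intros Hp. apply Qt in Hp.
      + destruct Hp as (i & h & Hm & Hi & s' & y & Hm' & -> & E). apply is_opairE in E.
        exists i. split; auto. rewrite (maps_fun _ _ _ _ _ HjF Hm (HFi i Hi)) in Hm'.
        subst p. f_equal. apply (maps_app _ (j A)); auto.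
        apply -> embedding_function_on. apply HF', Hi.
      + apply (embedding_transitive t); auto. now apply hull_target.
    - intros (i & Hi & ->). apply Qt.
      + apply hull_target, hull_opair; [now apply hull_below_critical|].
        now apply hull_value, HF'.
      + exists i, (j (app F i)). split; [now apply HFi|]. split; auto.
        exists s, (app (j (app F i)) s). split; [apply seed_value, HF', Hi|].
        split; auto. now apply is_opairE. }
  exists t. split; auto.
  assert (Ci : forall i, i ∈ k -> collapse (opair i (app (j (app F i)) s)) = opair i (app f i)).
  { intros i Hi. rewrite collapse_opair.
    - rewrite (proj2 (HF' i Hi)), collapse_fix; auto. now left.
    - now apply hull_below_critical.
    - now apply hull_value, HF'. }
  apply set_extensionality. intros q. rewrite collapseE. split.
  - intros Hq. destruct (proj1 Hf q Hq) as (i & y & Hi & E). apply is_opairE in E. subst q.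
    apply mapsE in Hq. rewrite (maps_app f k i y Hf Hq).
    exists (opair i (app (j (app F i)) s)). split; [apply Qt'; eauto|].
    split; [|now rewrite Ci]. apply hull_opair; [now apply hull_below_critical|].
    now apply hull_value, HF'.
  - intros (p & Hp & _ & ->). apply Qt' in Hp as (i & Hi & ->). rewrite Ci by auto.
    apply mapsE. eapply app_maps; eauto.
Qed.

Lemma hull_suitable : suitable_embedding k collapsed hull_map.
Proof.
  split; [|split].
  - exact hull_map_elementary.
  - exact hull_map_critical.
  - exact hull_closed_under_seqs.
Qed.

End CriticalPoint.
End Hull.
End Embedding.

(** * Gluing *)

Section Gluing.
Context {V : set_structure} {hV : ZFC V}.

(** A surjection from a subset of k onto a turns the pairs (b, eta_b) into a k-sequence of elements
    of M. By closure it belongs to M, and [eta] is its range. *)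
Lemma small_sequence_in_target (k kp a eta : V) (M : V -> Prop) (j : V -> V) :
  is_card_succ kp k -> ordinal k -> ordinal a -> a ∈ kp -> (exists b, b ∈ a) ->
  elementary_embedding M j -> closed_under_seqs M k ->
  function_on eta a -> (forall b s, maps eta b s -> M s) -> M eta.
Proof.
  intros Hkp Ok Oa Ha (b0 & Hb0) hj Hcl Feta Meta.
  destruct (below_card_succ k kp a Hkp Oa Ha Ok) as (c & f & _ & Sc & Hf).
  apply bijection_app in Hf as (F1 & _ & F3).
  set (pt := fun b => opair b (app eta b)).
  assert (Dpt : definable_term (fun e => pt (e 0))) by (unfold pt; definability).
  assert (Hpt : forall p, p ∈ eta <-> exists b, b ∈ a /\ p = pt b).
  { intros p. split.
    - intros Hp. destruct (proj1 Feta p Hp) as (x & y & Hx & E). apply is_opairE in E.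
      subst p. exists x. split; auto. apply mapsE in Hp. unfold pt.
      now rewrite (maps_app eta a x y).
    - intros (b & Hb & ->). apply mapsE. eapply app_maps; eauto. }
  assert (Mpt : forall b, b ∈ a -> M (pt b)).
  { intros b Hb. apply (target_opair M j hj).
    - apply (target_ordinal M j hj). eauto using ordinal_mem.
    - apply (Meta b). eapply app_maps; eauto. }
  (* Closure is stated for sequences of length exactly k, so the places outside c are filled with
     the pair at b0. *)
  set (g := fun i => the (fun y => (i ∈ c /\ y = pt (app f i)) \/ (~ i ∈ c /\ y = pt b0))).
  assert (Dg : definable_term (fun e => g (e 0))) by (unfold g; definability).
  assert (G1 : forall i, i ∈ c -> g i = pt (app f i)).
  { intros i Hi. apply the_eq; [left; auto|]. intros y [[_ H]|[N _]]; auto; contradiction. }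
  assert (G2 : forall i, ~ i ∈ c -> g i = pt b0).
  { intros i Hi. apply the_eq; [right; auto|]. intros y [[H _]|[_ H]]; auto; contradiction. }
  assert (Gv : forall i, exists b, b ∈ a /\ g i = pt b).
  { intros i. destruct (classic (i ∈ c)); [exists (app f i)|exists b0]; auto. }
  assert (MG : M (graph k g)).
  { apply Hcl; [now apply graph_function|]. intros x y Hm.
    apply graph_maps in Hm as [_ ->]; auto. destruct (Gv x) as (b & Hb & ->). auto. }
  (* The existence of ranges, transferred to M, puts the range of the k-sequence into M. *)
  assert (T := transfer1 M j hj (fun D _ => forall h, D h -> exists r, D r /\
    forall y, D y -> (y ∈ r <-> exists x y', maps h x y' /\ y' = y)) k ltac:(relativity)).
  destruct (proj1 T) with (h := graph k g) as (r & Mr & Hr); auto.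
  { intros h _. exists (set_of (fun y => exists x y', maps h x y' /\ y' = y)).
    split; [exact I|]. intros y _. revert y.
    apply (set_of_subE _ (union (union h))); [|definability].
    intros y (x & y' & Hm & ->). now apply maps_bound in Hm. }
  replace eta with r; auto. apply set_extensionality. intros p. split.
  - intros Hp. assert (Mp : M p) by (eapply (embedding_transitive M j hj); eauto).
    apply Hr in Hp as (x & y' & Hm & ->); auto. apply graph_maps in Hm as [_ ->]; auto.
    apply Hpt. auto.
  - intros Hp. apply Hpt in Hp as (b & Hb & ->). apply Hr; auto.
    destruct (F3 b Hb) as (i & Hi & <-). exists i, (pt (app f i)). split; auto.
    apply graph_maps; auto. split; auto. now rewrite G1.
Qed.

(** This closes the cycle of implications below k^+: the seeds are ordinals, and all ordinals lie in
    M. *)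
Lemma GP_super_GP (k kp a : V) : is_card_succ kp k -> ordinal k -> ordinal a -> a ∈ kp ->
  (exists b, b ∈ a) -> GP k a -> super_GP k a.
Proof.
  intros Hkp Ok Oa Ha Na H U HU. destruct (H U HU) as (M & j & eta & Hj & Hs & Hi).
  exists M, j, eta. split; [|split; [|split]]; auto.
  destruct Hj as (hj & _ & Hcl), Hs as (F & O & _).
  eapply (small_sequence_in_target k kp a); eauto.
  intros b s Hm. apply (target_ordinal M j hj). eauto.
Qed.

Lemma GP_via_ultrafilters_GP (k a : V) : GP_via_ultrafilters k a -> GP k a.
Proof.
  intros H U HU. destruct (H U HU) as (M & j & eta & H1 & H2 & H3 & _).
  exists M, j, eta. auto.
Qed.

Lemma GP_weak_GP (k a : V) : GP k a -> weak_GP k a.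
Proof.
  intros H U HU. destruct (H U HU) as (M & j & eta & H1 & H2 & _). exists M, j, eta. auto.
Qed.

Lemma lt_power_exists (k : V) : ordinal k -> exists P, is_lt_power P k.
Proof.
  intros Ok. exists (set_of (fun t => exists g, g ∈ k /\ function_into t g k)). intros t.
  apply (set_of_subE (fun t => exists g, g ∈ k /\ function_into t g k)
    (power (power (power k)))); [|definability].
  clear t. intros t (g & Hg & Ft & It). apply powerE. intros p Hp.
  destruct (proj1 Ft p Hp) as (x & y & Hx & E). apply is_opairE in E. subst p.
  apply opair_in_power; eauto using ordinal_trans. apply (It x). now apply mapsE.
Qed.

(** * From the super gluing property to ultrapowers *)

Section SuperGP.
Context (k kp kpp a U0 : V).
Context (Ok : ordinal k).
Context (HU0 : complete_ultrafilter k k U0).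
Context (NU0 : ~ principal k U0).
Context (Hw : exists w, limit_ordinal w /\ w ∈ k).
Context (Hwa : exists w, limit_ordinal w /\ ord_le w a).
Context (hkp : is_card_succ kp k).
Context (hkpp : is_card_succ kpp kp).
Context (Oa : ordinal a).
Context (Ha : a ∈ kpp).

(* i is in E(q(b)); the equations put the quantifiers in the form of [relative_ex_maps]. *)
Definition decodes (q E i b : V) : Prop :=
  exists b' r, maps q b' r /\ (b' = b /\ exists y z, maps E y z /\ (y = r /\ i ∈ z)).
Hint Unfold decodes : set_unfold.

(** The largest non-successor could also be zero; the limit ordinal w <= a rules this out. *)
Lemma limit_part_limit : exists l, limit_part l a /\ limit_ordinal l.
Proof.
  destruct (limit_part_exists a Oa) as (l & Hl). exists l. split; auto.
  destruct Hl as (L1 & L2 & L3).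
  assert (Ol : ordinal l) by (eapply ord_le_ordinal; eauto).
  destruct (nonsucc_cases l Ol L2) as [E|]; auto. exfalso.
  destruct Hwa as (w & Lw & Hwa'). specialize (L3 w Hwa' (limit_nonsucc _ Lw)).
  destruct (proj1 (proj2 Lw)) as (x & Hx).
  apply (E x). exact (ord_le_subset _ _ Ol L3 x Hx).
Qed.

Section Sequence.
Context (l A E U : V).
Context (code : V -> V).
Context (Hl : limit_part l a).
Context (Ll : limit_ordinal l).
Context (SA : forall b, b ∈ a -> subset (app A b) k).
Context (IA : forall b c, b ∈ a -> c ∈ a -> app A b = app A c -> b = c).
Context (Dcode : definable_term (fun e => code (e 0))).
Context (Hcode : forall A, subset A k ->
    complete_ultrafilter k k (code A) /\ ~ principal k (code A) /\
    forall i, i ∈ k ->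
      (sep k (fun y => exists z, maps E y z /\ i ∈ z) ∈ code A <-> i ∈ A)).
Context (HU : ultrafilter_seq k a U).

Lemma limit_part_below b : b ∈ l -> b ∈ a.
Proof. destruct Hl as (L & _). exact (ord_le_subset _ _ Oa L b). Qed.

(* Below l the sequence is shifted by one, which frees the non-successor
   positions for the codes. *)
Definition shift (b : V) : V := the (fun y => (b ∈ l /\ y = succ b) \/ (~ b ∈ l /\ y = b)).

(** From l on the given measures stay in place: l will be definable from the length, and all later
    indices are successors. *)
Definition glued_term (b : V) : V :=
  the (fun y => (b ∈ l /\ exists c, is_succ b c /\ y = app U c) \/
    (b ∈ l /\ ~ is_successor b /\ y = code (app A b)) \/ (~ b ∈ l /\ y = app U b)).

Lemma shift_below b : b ∈ l -> shift b = succ b.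
Proof.
  intros Hb. apply the_eq; [left; auto|]. intros y [[_ H]|[N _]]; auto; contradiction.
Qed.

Lemma shift_above b : ~ b ∈ l -> shift b = b.
Proof.
  intros Hb. apply the_eq; [right; auto|]. intros y [[H _]|[_ H]]; auto; contradiction.
Qed.

Lemma shift_mem b : b ∈ a -> shift b ∈ a.
Proof.
  intros Hb. destruct (classic (b ∈ l)) as [H|H].
  - rewrite shift_below by auto. apply limit_part_below. now apply limit_succ.
  - now rewrite shift_above.
Qed.

(** The only delicate case is b < l <= c, where b + 1 stays below l because l is a limit. *)
Lemma shift_increasing b c : b ∈ a -> c ∈ a -> b ∈ c -> shift b ∈ shift c.
Proof.
  intros Hb Hc Hbc.
  assert (Oc : ordinal c) by eauto using ordinal_mem.
  destruct (classic (c ∈ l)) as [Hcl|Hcl].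
  - assert (Hbl : b ∈ l) by (apply (ordinal_trans l c b (proj1 Ll)); auto).
    rewrite !shift_below by auto. apply succE.
    destruct (ordinal_succ_mem c b Oc Hbc); auto.
  - rewrite (shift_above c) by auto.
    destruct (classic (b ∈ l)) as [Hbl|Hbl]; [|now rewrite shift_above].
    rewrite shift_below by auto.
    assert (Hs : succ b ∈ l) by now apply limit_succ.
    destruct (ordinal_le_or l c (proj1 Ll) Oc) as [[L| ->]|L]; auto; [|contradiction].
    eauto using ordinal_trans.
Qed.

Lemma glued_shift b : b ∈ a -> glued_term (shift b) = app U b.
Proof.
  intros Hb. destruct (classic (b ∈ l)) as [H|H].
  - rewrite shift_below by auto. assert (Hs : succ b ∈ l) by now apply limit_succ.
    apply the_eq.
    + left. split; auto. exists b. split; auto. now apply is_succE.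
    + intros y [(_ & c & Hc & ->)|[(_ & N & _)|(N & _)]]; try contradiction.
      * apply is_succE, succ_inj_ord in Hc. now subst.
      * destruct N. exists b. now apply is_succE.
  - rewrite shift_above by auto. apply the_eq; [right; right; auto|].
    intros y [(N & _)|[(N & _)|(_ & ->)]]; auto; contradiction.
Qed.

Lemma glued_code b : b ∈ l -> ~ is_successor b -> glued_term b = code (app A b).
Proof.
  intros Hb N. apply the_eq; [right; left; auto|].
  intros y [(_ & c & Hc & _)|[(_ & _ & H)|(N' & _)]]; auto; try contradiction.
  destruct N. now exists c.
Qed.

Lemma definable_shift : definable_term (fun e => shift (e 0)).
Proof. unfold shift. definability. Qed.

Lemma definable_glued_term : definable_term (fun e => glued_term (e 0)).
Proof. unfold glued_term. definability. Qed.
Hint Resolve definable_shift definable_glued_term : defs.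

Lemma glued_sequence : ultrafilter_seq k a (graph a glued_term).
Proof.
  split; [apply graph_function; auto with defs|].
  intros b Ub Hm. apply graph_maps in Hm as [Hb ->]; auto with defs.
  assert (HUb : forall c, c ∈ a -> complete_ultrafilter k k (app U c) /\ ~ principal k (app U c)).
  { intros c Hc. apply (proj2 HU c). eapply app_maps; eauto. apply HU. }
  destruct (classic (b ∈ l)) as [H|H].
  - destruct (classic (is_successor b)) as [(c & Hc)|N].
    + assert (Hcb : c ∈ b) by (apply Hc; auto).
      assert (Hcl : c ∈ l) by (apply (ordinal_trans l b c (proj1 Ll)); auto).
      assert (Hca := limit_part_below c Hcl).
      apply is_succE in Hc. subst b. rewrite <- (shift_below c) by auto.
      rewrite glued_shift; auto.
    + rewrite glued_code by auto. destruct (Hcode (app A b)) as (C1 & C2 & _); auto.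
  - rewrite <- (shift_above b) by auto. rewrite glued_shift; auto.
Qed.

(** * Reading the codes in M, and the bound on the length *)

Context (M : V -> Prop).
Context (j : V -> V).
Context (eta : V).
Context (Hj : suitable_embedding k M j).
Context (Hseeds : seeds k a (graph a glued_term) j eta).
Context (Hinc : strictly_increasing eta).
Context (Meta : M eta).

Let hj : elementary_embedding M j := proj1 Hj.
Let Hcrit : critical_point j k := proj1 (proj2 Hj).

Lemma glued_seed b X : b ∈ a -> (X ∈ glued_term b <-> subset X k /\ app eta b ∈ j X).
Proof.
  intros Hb. apply (proj2 (proj2 Hseeds) b).
  - apply graph_maps; auto with defs.
  - apply (app_maps eta a); auto. apply Hseeds.
Qed.

Lemma glued_seed_bound b : b ∈ a -> app eta b ∈ j k.
Proof.
  intros Hb. apply (glued_seed b k Hb).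
  assert (H := proj2 glued_sequence b (glued_term b)).
  apply H. apply graph_maps; auto with defs.
Qed.

(** The set X of all y with i in E(y) is measured by the code exactly when i is in A_b. The seed
    translates this into membership in j(X), which M computes from j(E) since j(i) = i. *)
Lemma decodes_code b i : b ∈ l -> ~ is_successor b -> i ∈ k ->
  (decodes eta (j E) i b <-> i ∈ app A b).
Proof.
  intros Hb N Hi. assert (Hba := limit_part_below b Hb).
  destruct (Hcode (app A b)) as (_ & _ & C); auto.
  rewrite <- (C i Hi), <- (glued_code b), glued_seed by auto.
  set (X := sep k (fun y => exists z, maps E y z /\ i ∈ z)).
  assert (HX : forall y, y ∈ X <-> y ∈ k /\ exists z, maps E y z /\ i ∈ z).
  { apply sepE. definability. }
  assert (T := transfer4 M j hj (fun D k X E i => forall y, y ∈ k -> (y ∈ X <->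
    exists y' z, maps E y' z /\ (y' = y /\ i ∈ z))) k X E i ltac:(relativity)).
  assert (T' : forall y, y ∈ k -> (y ∈ X <-> exists y' z, maps E y' z /\ (y' = y /\ i ∈ z))).
  { intros y Hy. rewrite HX. split.
    - intros (_ & z & H1 & H2). eauto 6.
    - intros (y' & z & H1 & -> & H2). eauto. }
  assert (T2 := proj1 T T' (app eta b) (glued_seed_bound b Hba)). cbv beta in T2.
  rewrite (proj2 (proj2 Hcrit) i Hi) in T2. rewrite T2.
  assert (Feta : function_on eta a) by apply Hseeds.
  split.
  - intros (b' & r & Hm & -> & H). rewrite (maps_app _ _ _ _ Feta Hm) in H. split; auto.
    intros y Hy. now apply HX in Hy.
  - intros [_ H]. exists b, (app eta b). split; [eapply app_maps; eauto|]. auto.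
Qed.

Lemma glued_decodes_inj b c : b ∈ l -> c ∈ l -> ~ is_successor b -> ~ is_successor c ->
  (forall i, i ∈ k -> (decodes eta (j E) i b <-> decodes eta (j E) i c)) -> b = c.
Proof.
  intros Hb Hc Nb Nc H.
  assert (Hba := limit_part_below b Hb). assert (Hca := limit_part_below c Hc).
  apply IA; auto. apply set_extensionality. intros i.
  split; intros Hi; assert (Hik : i ∈ k) by
    first [exact (SA b Hba i Hi)|exact (SA c Hca i Hi)];
    specialize (H i Hik); rewrite !decodes_code in H by auto; tauto.
Qed.

Lemma limit_image : limit_ordinal (j k).
Proof.
  apply (proj1 (transfer1 M j hj (fun D => limit_ordinal) k ltac:(relativity))).
  eapply measurable_limit; eauto.
Qed.

(** [strong_limit] is applied inside M to j(k), with d = k < j(k). The coded injection into the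
    power set of k is available there because [eta] and j(E) are elements of M; this is where the
    super version enters. *)
Lemma limit_part_bound : l ∈ j k.
Proof.
  assert (T := transfer1 M j hj (fun D k => forall d, d ∈ k -> forall l, D l ->
    forall q, D q -> forall E, D E -> ordinal l ->
    (forall b, b ∈ l -> forall c, c ∈ l -> ~ is_successor b -> ~ is_successor c ->
      (forall i, i ∈ d -> (decodes q E i b <-> decodes q E i c)) -> b = c) -> l ∈ k) k
    ltac:(unfold decodes; relativity)).
  apply (proj1 T) with (d := k) (q := eta) (E := j E); auto.
  - clear - hV Ok HU0 NU0 Hw. intros d Hd l _ q _ E _ Ol H.
    apply (strong_limit k U0 Ok HU0 NU0 Hw (decodes q E) d l); auto. definability.
  - apply (critical_point_image M j hj k Hcrit).
  - apply (target_ordinal M j hj), Ll.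
  - apply (ee_into _ _ hj).
  - apply Ll.
  - intros b Hb c Hc Nb Nc. now apply glued_decodes_inj.
Qed.

(** A least b <= a outside j(k) is not a successor, as j(k) is a limit, and a non-successor is at
    most l < j(k). *)
Lemma length_bound : a ∈ j k.
Proof.
  assert (Lj := limit_image). apply NNPP. intros N.
  destruct (least_ordinal (fun b => ~ b ∈ j k) a) as (b & Hb & Nb & Mb); auto; [definability|].
  assert (Ob : ordinal b) by (eapply ord_le_ordinal; eauto).
  destruct (classic (is_successor b)) as [(c & Hc)|Ns].
  - assert (Hcb : c ∈ b) by (apply Hc; auto).
    apply is_succE in Hc. subst b. apply Nb, limit_succ; auto.
    apply NNPP. now apply Mb.
  - destruct Hl as (_ & _ & L3). specialize (L3 b Hb Ns). apply Nb.
    destruct L3 as [L3| ->]; [|apply limit_part_bound].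
    apply (ordinal_trans (j k) l b (proj1 Lj)); auto. apply limit_part_bound.
Qed.

(* The ultrapower is generated by the seed sequence together with k. *)
Definition master_seed : V := cup eta (upair (opair a k) (opair a k)).

Lemma master_seed_maps x y : maps master_seed x y <-> maps eta x y \/ (x = a /\ y = k).
Proof.
  rewrite !mapsE. unfold master_seed. rewrite cupE, upairE. apply or_iff_compat_l. split.
  - intros [H|H]; now apply opair_inj in H.
  - intros [-> ->]. auto.
Qed.

Lemma master_seed_function : function_on master_seed (succ a).
Proof.
  assert (Feta : function_on eta a) by apply Hseeds.
  split.
  - intros p Hp. unfold master_seed in Hp. rewrite cupE, upairE in Hp. destruct Hp as [Hp|Hp].
    + destruct (proj1 Feta p Hp) as (x & y & Hx & H). exists x, y. rewrite succE. auto.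
    + exists a, k. rewrite succE, is_opairE. split; auto. tauto.
  - intros x Hx. apply succE in Hx as [Hx| ->].
    + exists (app eta x). split.
      * apply master_seed_maps. left. eapply app_maps; eauto.
      * intros y Hy. apply master_seed_maps in Hy as [Hy|[-> _]].
        -- symmetry. eapply maps_app; eauto.
        -- now apply mem_irrefl in Hx.
    + exists k. split; [apply master_seed_maps; auto|].
      intros y Hy. apply master_seed_maps in Hy as [Hy|[_ ->]]; auto.
      apply (maps_dom _ _ _ _ Feta) in Hy. now apply mem_irrefl in Hy.
Qed.

Lemma master_seed_target : M master_seed.
Proof.
  assert (T := transfer1 M j hj (fun D _ => forall x, D x -> forall y, D y ->
    exists z, D z /\ forall u, D u -> (u ∈ z <-> u ∈ x \/ u = y)) k ltac:(relativity)).
  assert (Mp : M (opair a k)).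
  { apply (target_opair M j hj); now apply (target_ordinal M j hj). }
  destruct (proj1 T) with (x := eta) (y := opair a k) as (z & Mz & Hz); auto.
  - intros x _ y _. exists (cup x (upair y y)). split; [exact I|]. intros u _.
    rewrite cupE, upairE. tauto.
  - replace master_seed with z; auto. apply set_extensionality. intros u.
    unfold master_seed. rewrite cupE, upairE.
    assert (TM := embedding_transitive M j hj). split.
    + intros Hu. apply Hz in Hu; [tauto|exact (TM z u Mz Hu)].
    + intros Hu. apply Hz; [|tauto]. destruct Hu as [Hu|[-> | ->]]; auto. exact (TM eta u Meta Hu).
Qed.

Context (P : V).
Context (HP : is_lt_power P k).

Lemma master_seed_mem : master_seed ∈ j P.
Proof.
  assert (T := transfer2 M j hj (fun D P k => forall t, D t ->
    (exists g, g ∈ k /\ function_into t g k) -> t ∈ P) P k ltac:(relativity)).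
  apply (proj1 T).
  - intros t _ Ht. now apply HP.
  - exact master_seed_target.
  (* Appending k makes the domain a + 1, which is still below the limit j(k); the new value k lies
     below j(k) as the critical point. *)
  - exists (succ a). split; [apply limit_succ; [apply limit_image|apply length_bound]|].
    split; [apply master_seed_function|]. intros x y Hm.
    apply master_seed_maps in Hm as [Hm|[_ ->]].
    + assert (Feta : function_on eta a) by apply Hseeds.
      rewrite (maps_app _ _ _ _ Feta Hm). apply glued_seed_bound. eapply maps_dom; eauto.
    + exact (critical_point_image M j hj k Hcrit).
Qed.

(** * All indices and all seeds lie in the hull *)

Let hulls (x : V) : Prop := hull j P master_seed x.

Lemma seed_in_hull : hulls master_seed.
Proof. exact (hull_seed M j hj P master_seed master_seed_mem). Qed.

(** M can define a from the seed as the largest element of its domain. *)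
Lemma length_in_hull : hulls a.
Proof.
  destruct (hull_witness1 M j hj P master_seed master_seed_mem
    (fun D q x => (exists x' y, maps q x' y /\ x' = x) /\
       forall x' y, maps q x' y -> x' ∈ x \/ x' = x) master_seed) as (x & Hx & (x' & y & Hm & ->) & H2).
  - relativity.
  - exact seed_in_hull.
  - exists a. split; [now apply (target_ordinal M j hj)|]. split.
    + exists a, k. split; auto. apply master_seed_maps. auto.
    + intros x y Hm. apply succE. eapply maps_dom; eauto using master_seed_function.
  - assert (Hxa : x ∈ succ a) by (eapply maps_dom; eauto using master_seed_function).
    assert (Hax := H2 a k (proj2 (master_seed_maps a k) (or_intror (conj eq_refl eq_refl)))).
    apply succE in Hxa. replace a with x; auto.
    destruct Hxa as [Hxa|Hxa]; auto. destruct Hax as [Hax|Hax]; auto.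
    exfalso. eapply mem_asym; eauto.
Qed.

Lemma critical_in_hull : hulls k.
Proof.
  apply (hull_maps M j hj P master_seed master_seed_mem master_seed a).
  - exact seed_in_hull.
  - exact length_in_hull.
  - apply master_seed_maps. auto.
  - intros y Hm. eapply maps_fun; [apply master_seed_function|exact Hm|].
    apply master_seed_maps. auto.
Qed.

(** The definition of l from a is evaluated correctly in M, since M contains all ordinals and being
    a successor is absolute. *)
Lemma limit_part_in_hull : hulls l.
Proof.
  assert (Ml : M l) by (apply (target_ordinal M j hj), Ll).
  destruct Hl as (L1 & L2 & L3).
  destruct (hull_witness1 M j hj P master_seed master_seed_mem
    (fun D a x => (x ∈ a \/ x = a) /\ ~ is_successor x /\
       forall c, D c -> (c ∈ a \/ c = a) -> ~ is_successor c -> c ∈ x \/ c = x) a)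
    as (x & Hx & X1 & X2 & X3).
  - relativity.
  - exact length_in_hull.
  - exists l. split; auto. split; [|split]; auto. intros c _. apply L3.
  - replace l with x; auto. assert (Ox : ordinal x) by (eapply ord_le_ordinal; eauto).
    apply subset_antisym; apply ord_le_subset.
    + apply Ll.
    + now apply L3.
    + exact Ox.
    + now apply X3.
Qed.

(** A minimal index outside the hull is not a successor, since its predecessor is in the hull. Nor
    is it l. Below l, it is the only non-successor whose code agrees on k with j(A_b). *)
Lemma index_in_hull b0 : b0 ∈ a -> hulls b0.
Proof.
  intros Hb0. apply NNPP. intros N0.
  destruct (foundation (fun b => ~ hulls b) a) as (b & Hb & Nb & Mb).
  { apply definable_not. apply (definable_hull M j hj). }
  { eauto. }
  assert (Ob : ordinal b) by eauto using ordinal_mem.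
  assert (Mb' : M b) by now apply (target_ordinal M j hj).
  apply Nb. destruct (classic (is_successor b)) as [(c & Hc)|Ns].
  - assert (Hcb : c ∈ b) by (apply Hc; auto).
    assert (Hhc : hulls c).
    { apply NNPP. apply Mb; auto. eauto using ordinal_trans. }
    destruct (hull_witness1 M j hj P master_seed master_seed_mem (fun D c x => is_succ x c) c)
      as (x & Hx & E1); auto.
    + relativity.
    + eauto.
    + apply is_succE in E1, Hc. now subst.
  - destruct (classic (b ∈ l)) as [Hbl|Hbl].
    (* Places 0 to 4 of the environment hold l, k, j(A_b), the master seed and j(E), all of them in
       the hull. *)
    + pose (Q := fun (D : V -> Prop) e x => x ∈ e 0 /\ ~ is_successor x /\
        forall i, i ∈ e 1 -> (i ∈ e 2 <-> decodes (e 3) (e 4) i x)).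
      assert (EA : forall i, i ∈ k -> (i ∈ j (app A b) <-> i ∈ app A b)).
      { intros i Hi. rewrite <- (proj2 (proj2 Hcrit) i Hi) at 1.
        symmetry. apply (embedding_mem M j hj). }
      (* The bare sequence [eta] is not among the hull parameters. The master seed replaces it, as
         the two differ only at position a, which is not below l. *)
      assert (Ems : forall i x, x ∈ l ->
        (decodes master_seed (j E) i x <-> decodes eta (j E) i x)).
      { intros i x Hx. assert (Hxa := limit_part_below x Hx).
        split; intros (b' & r & Hm & -> & H); exists x, r; (split; [|auto]).
        - apply master_seed_maps in Hm as [Hm|[-> _]]; auto. now apply mem_irrefl in Hxa.
        - apply master_seed_maps. auto. }
      destruct (hull_witness M j hj P master_seed master_seed_mem Q
        (scons l (scons k (scons (j (app A b)) (scons master_seed (fun _ => j E))))))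
        as (x & Hx & X1 & X2 & X3).
      * unfold Q, decodes. relativity.
      * repeat apply scons_class; auto.
        -- exact limit_part_in_hull.
        -- exact critical_in_hull.
        -- apply (hull_embedding M j hj _ _ master_seed_mem).
        -- exact seed_in_hull.
        -- intros _. apply (hull_embedding M j hj _ _ master_seed_mem).
      * exists b. split; auto. split; [|split]; auto.
        intros i Hi. cbn [scons] in *. rewrite EA, Ems, decodes_code by auto. tauto.
      * cbn [scons] in *. replace b with x; auto.
        apply glued_decodes_inj; auto. intros i Hi.
        rewrite <- (Ems i x), <- X3, EA, decodes_code by auto. tauto.
    + replace b with l; [exact limit_part_in_hull|].
      destruct Hl as (_ & _ & L3). destruct (L3 b) as [H| ->]; auto; [now left|contradiction].
Qed.

Lemma seed_value_in_hull b : b ∈ a -> hulls (app eta b).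
Proof.
  intros Hb. assert (Feta : function_on eta a) by apply Hseeds.
  assert (Hm : maps master_seed b (app eta b)).
  { apply master_seed_maps. left. eapply app_maps; eauto. }
  apply (hull_maps M j hj P master_seed master_seed_mem master_seed b); auto.
  - exact seed_in_hull.
  - now apply index_in_hull.
  - intros y Hy. eapply maps_fun; [apply master_seed_function|exact Hy|exact Hm].
Qed.

Lemma glued_ultrafilter_witness :
  exists (N : V -> Prop) (i : V -> V) (eta' : V),
    suitable_embedding k N i /\ seeds k a U i eta' /\ strictly_increasing eta' /\
    exists S W, is_lt_power S k /\ complete_ultrafilter k S W /\ ultrapower_embedding S W N i.
Proof.
  set (c := collapse j P master_seed).
  (* The new seed for U_b is the collapse of the seed at the shifted position. Collapsing preserves
     membership between elements of the hull, so it keeps both the derived measure and the order. *)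
  set (F := fun b => c (app eta (shift b))).
  assert (Dc : definable_term (fun e => c (e 0))) by exact (definable_collapse M j hj P master_seed).
  assert (DF : definable_term (fun e => F (e 0))) by (unfold F; definability).
  assert (Feta : function_on eta a) by apply Hseeds.
  assert (Hh : forall b, b ∈ a -> hulls (app eta (shift b))).
  { intros b Hb. apply seed_value_in_hull, shift_mem, Hb. }
  exists (collapsed j P master_seed), (hull_map j P master_seed), (graph a F).
  split; [|split; [|split]].
  - exact (hull_suitable M j hj P master_seed master_seed_mem k Hcrit critical_in_hull).
  - split; [now apply graph_function|]. split.
    + intros b s Hm. apply graph_maps in Hm as [Hb ->]; auto.
      apply (collapse_ordinal M j hj P master_seed master_seed_mem); [now apply Hh|].
      apply (proj1 (proj2 Hseeds) (shift b)). apply (app_maps eta a); auto using shift_mem.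
    + intros b Ub s HmU Hm X. apply graph_maps in Hm as [Hb ->]; auto.
      rewrite (maps_app U a b Ub (proj1 HU) HmU), <- glued_shift by auto.
      rewrite glued_seed by now apply shift_mem.
      apply and_iff_compat_l. apply (collapse_mem M j hj P master_seed master_seed_mem).
      * now apply Hh.
      * apply (hull_embedding M j hj P master_seed master_seed_mem).
  - intros b d s t Hs Ht Hbd. apply graph_maps in Hs as [Hb ->], Ht as [Hd ->]; auto.
    refine (proj1 (collapse_mem M j hj P master_seed master_seed_mem _ _
      (Hh b Hb) (Hh d Hd)) _).
    apply (Hinc (shift b) (shift d)).
    + apply (app_maps eta a); auto using shift_mem.
    + apply (app_maps eta a); auto using shift_mem.
    + now apply shift_increasing.
  - exists P, (seed_measure j P master_seed). split; [exact HP|]. split.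
    + exact (seed_measure_ultrafilter M j hj P master_seed master_seed_mem k Hcrit).
    + exact (hull_ultrapower M j hj P master_seed master_seed_mem).
Qed.

End Sequence.

Lemma super_GP_via_ultrafilters : super_GP k a -> GP_via_ultrafilters k a.
Proof.
  intros H U HU.
  destruct limit_part_limit as (l & Hl & Ll).
  destruct (power_injection k kp kpp a Ok hkp hkpp Oa Ha) as (A & _ & SA & IA).
  destruct (coding_measures k U0 Ok HU0 NU0 Hw) as (E & code & Dcode & Hcode).
  destruct (lt_power_exists k Ok) as (P & HP).
  destruct (H (graph a (glued_term l A U code))) as (M & j & eta & Hj & Hs & Hi & Me).
  - eapply glued_sequence; eauto.
  - eapply glued_ultrafilter_witness; eauto.
Qed.

End SuperGP.
End Gluing.

Theorem mainTheorem3 (V : set_structure) (hV : ZFC V)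
  (w k kp kpp a : V)
  (hw : is_omega w)
  (hk : measurable k)
  (hkp : is_card_succ kp k)
  (hkpp : is_card_succ kpp kp)
  (ha : ordinal a)
  (hwa : ord_le w a)
  (hakpp : a ∈ kpp) :
  (super_GP k a -> GP_via_ultrafilters k a) /\
  (GP_via_ultrafilters k a -> GP k a) /\
  (GP k a -> weak_GP k a) /\
  (a ∈ kp ->
     (super_GP k a <-> GP_via_ultrafilters k a) /\
     (GP_via_ultrafilters k a <-> GP k a)).
Proof.
  destruct hk as (Ck & (w' & Hw' & Hwk) & U0 & HU0 & NU0).
  assert (H12 : super_GP k a -> GP_via_ultrafilters k a).
  { apply (super_GP_via_ultrafilters k kp kpp a U0); auto.
    - apply Ck.
    - exists w'. split; auto. apply Hw'.
    - exists w. split; auto. apply hw. }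
  assert (H23 := GP_via_ultrafilters_GP k a).
  split; [|split; [|split]]; auto using GP_weak_GP.
  intros hakp.
  assert (H31 : GP k a -> super_GP k a).
  { apply (GP_super_GP k kp a); auto.
    - apply Ck.
    - destruct hw as [(Ow & (x & Hx) & _) _]. exists x.
      exact (ord_le_subset w a ha hwa x Hx). }
  tauto.
Qed.
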